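(* Let $\mathcal{G}\subseteq SL(2,\mathbb{C})$ be isomorphic to one of $A_4^{SL(2)}$, $S_4^{SL(2)}$, $A_5^{SL(2)}$. Let $$q(x)=\frac14\left(\frac{A}{x^2}+\frac{B}{x(x-1)}+\frac{C}{(x-1)^2}\right),\qquad A=1-\frac1{m^2},\quad C=1-\frac1{n^2},\quad A+B+C=1-\frac1{p^2},$$ where $(m,n,p)$ is some permutation of $(2,3,3)$ if $\mathcal{G}\cong A_4^{SL(2)}$, of $(2,3,4)$ if $\mathcal{G}\cong S_4^{SL(2)}$, of $(2,3,5)$ if $\mathcal{G}\cong A_5^{SL(2)}$, so that the linear differential equation $y''(x)+q(x)y(x)=0$ over $\mathbb{C}(x)$ has differential Galois group $\mathcal{G}$. Let $K=\mathbb{C}(x,y,z)$ and let $\Omega$ be the 2-form over $K$ associated to the vector field $$\dot x=1,\qquad \dot y=q(x)\,z-1,\qquad \dot z=-y.$$ Then this system is Liouvillian integrable, but $\mathcal{I}(\Omega)\cap K'=\emptyset$.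
   Context: $A_4^{SL(2)},S_4^{SL(2)},A_5^{SL(2)}\subset SL(2,\mathbb{C})$ are the inverse images, under the projection $SL(2,\mathbb{C})\to PGL(2,\mathbb{C})$, of the subgroups of $PGL(2,\mathbb{C})$ isomorphic to $A_4$, $S_4$, $A_5$ (the symmetry groups of the Platonic solids). The 2-form associated to a vector field $\dot x=P,\ \dot y=Q,\ \dot z=R$ over $K$ is $\Omega=P\,dy\wedge dz+Q\,dz\wedge dx+R\,dx\wedge dy$. For a differential extension field $L$ of $K$, $L'$ denotes the space of one-forms $a\,dx+b\,dy+c\,dz$ with $a,b,c\in L$ (and $K'$ is the case $L=K$). A differential extension field $L$ of $K$ is Liouvillian if it has the same constants as $K$ and there is a tower $K=K_0\subset K_1\subset\dots\subset K_m=L$ such that for each $i$ one of the following holds: (i) $K_{i+1}=K_i(t_i)$ with $t_i\neq0$, $dt_i=\delta_it_i$, $\delta_i\in K_i'$; (ii) $K_{i+1}=K_i(t_i)$ with $dt_i=\delta_i\in K_i'$; (iii) $K_{i+1}$ is a finite algebraic extension of $K_i$. The system (or $\Omega$) is Liouvillian integrable if there is a non-constant element $\phi$ of some Liouvillian extension of $K$ with $d\phi\wedge\Omega=0$; equivalently, if there exist a Liouvillian extension $L$ of $K$ and $\omega\in L'\setminus\{0\}$, $\alpha\in L'$ with $\omega\wedge\Omega=0$, $d\omega=\alpha\wedge\omega$, $d\alpha=0$. Let $L_0$ be the Picard-Vessiot extension of $\mathbb{C}(x)$ for $y''+qy=0$ and $L=L_0(y,z)$, a finite Galois extension of $K$.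 $\mathcal{I}(\Omega)$ is the set of all $0\neq\omega\in L'$ for which there exists $\alpha\in L'$ such that $\omega\wedge\Omega=0$, $d\omega=\alpha\wedge\omega$, $d\alpha=0$. *)

(* Defs.v *)
From HB Require Import structures.
From mathcomp Require Import all_boot all_order all_algebra all_fingroup ring.
From mathcomp Require Import alt fraction generic_quotient.
From mathcomp Require Import boolp classical_sets functions.

Set Implicit Arguments.
Unset Strict Implicit.
Unset Printing Implicit Defensive.

Import GRing.Theory.
Local Open Scope ring_scope.
Local Open Scope quotient_scope.
Local Open Scope classical_set_scope.

Local Notation "x %:F" := (@FracField.tofrac _ x) : ring_scope.

Definition derivation (A : comNzRingType) (D : A -> A) : Prop :=
  (forall a b, D (a + b) = D a + D b) /\
  (forall a b, D (a * b) = D a * b + a * D b).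

(* Derivations and maps extended to fraction fields through the canonical
   representative; [der_fracE] and [map_fracE] show that any other
   representative gives the same value. *)
Definition der_frac (A : idomainType) (D : A -> A) (f : {fraction A}) :
    {fraction A} :=
  let r := repr f in
  (D \n_r * \d_r - \n_r * D \d_r)%:F / (\d_r ^+ 2)%:F.

Definition map_frac (A B : idomainType) (h : A -> B) (f : {fraction A}) :
    {fraction B} :=
  (h \n_(repr f))%:F / (h \d_(repr f))%:F.

Lemma frac_numden (A : idomainType) (f : {fraction A}) :
  f = (\n_(repr f))%:F / (\d_(repr f))%:F.
Proof.
set r := repr f; have r0 : \d_r != 0 by exact: denom_ratioP.
have Epi (g h : {ratio A}) : \pi_({fraction A}) g * \pi_({fraction A}) h
    = \pi_({fraction A}) (FracField.mulf g h) by rewrite FracField.pi_mul.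
apply: (canRL (mulfK _)); first by rewrite tofrac_eq0.
rewrite -{1}[f]reprK -/r; unlock FracField.tofrac; rewrite Epi.
have dD : \d_(Ratio \d_r 1) = 1 by rewrite numden_Ratio ?oner_neq0.
have nD : \n_(Ratio \d_r 1) = \d_r by rewrite numden_Ratio ?oner_neq0.
have dN : \d_(Ratio \n_r 1) = 1 by rewrite numden_Ratio ?oner_neq0.
have nN : \n_(Ratio \n_r 1) = \n_r by rewrite numden_Ratio ?oner_neq0.
apply/eqP; rewrite FracField.equivf_def /FracField.mulf nD dD nN dN !mulr1.
by rewrite !numden_Ratio ?mulr1 // mulrC.
Qed.

Lemma repr_fracE (A : idomainType) (a b : A) (r := repr (a%:F / b%:F)) :
  b != 0 -> a * \d_r = \n_r * b.
Proof.
move=> b0; have r0 : \d_r != 0 by exact: denom_ratioP.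
apply/eqP; rewrite -tofrac_eq !tofracM -eqr_div ?tofrac_eq0 //.
by rewrite -frac_numden.
Qed.

Lemma der_fracE (A : idomainType) (D : A -> A) (a b : A) :
  derivation D -> b != 0 ->
  der_frac D (a%:F / b%:F) = (D a * b - a * D b)%:F / (b ^+ 2)%:F.
Proof.
move=> [_ DM] b0; rewrite /der_frac; have := repr_fracE a b0.
set r := repr _ => E; have r0 : \d_r != 0 by exact: denom_ratioP.
apply/eqP; rewrite eqr_div ?tofrac_eq0 ?expf_neq0 // -!tofracM tofrac_eq.
have := congr1 D E; rewrite !DM => DE; rewrite -subr_eq0.
have -> : (D \n_r * \d_r - \n_r * D \d_r) * b ^+ 2
            - (D a * b - a * D b) * \d_r ^+ 2
  = \d_r * b * ((D \n_r * b + \n_r * D b) - (D a * \d_r + a * D \d_r))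
    + (a * \d_r - \n_r * b) * (\d_r * D b + b * D \d_r) by ring.
by rewrite DE E !subrr mulr0 mul0r addr0 eqxx.
Qed.

Lemma map_fracE (A B : idomainType) (h : {rmorphism A -> B}) (a b : A) :
  injective h -> b != 0 -> map_frac h (a%:F / b%:F) = (h a)%:F / (h b)%:F.
Proof.
move=> hI b0; rewrite /map_frac; have := repr_fracE a b0.
set r := repr _ => E; have r0 : \d_r != 0 by exact: denom_ratioP.
have h0 c : c != 0 -> h c != 0 by rewrite -(inj_eq hI) rmorph0.
apply/eqP; rewrite eqr_div ?tofrac_eq0 ?h0 //.
by rewrite -!tofracM tofrac_eq -!rmorphM E.
Qed.

(* F(t), and the two kinds of derivations on it: d/dt, and the extension of a
   derivation of F that kills t. *)
Definition ratfun (F : fieldType) : fieldType := {fraction {poly F}}.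

Definition rconst (F : fieldType) (c : F) : ratfun F := (c%:P)%:F.
Definition rvar (F : fieldType) : ratfun F := ('X)%:F.
Definition rderiv (F : fieldType) : ratfun F -> ratfun F :=
  der_frac (fun P : {poly F} => P^`()).
Definition rlift (F : fieldType) (D : F -> F) : ratfun F -> ratfun F :=
  der_frac (fun P : {poly F} => map_poly D P).
Definition rmap (F E : fieldType) (h : F -> E) : ratfun F -> ratfun E :=
  map_frac (fun P : {poly F} => map_poly h P).

(* For a field F with derivation D (playing the role of d/dx):
   F(y, z) = F(y)(z) with its partial derivatives, where the indices 0, 1, 2
   stand for x, y, z. *)
Definition ratfun2 (F : fieldType) : fieldType := ratfun (ratfun F).

Definition r2const (F : fieldType) (c : F) : ratfun2 F := rconst (rconst c).
Definition r2y (F : fieldType) : ratfun2 F := rconst (rvar F).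
Definition r2z (F : fieldType) : ratfun2 F := rvar (ratfun F).
Definition r2map (F E : fieldType) (h : F -> E) : ratfun2 F -> ratfun2 E :=
  rmap (rmap h).

Definition partials (F : fieldType) (D : F -> F) (i : 'I_3) :
    ratfun2 F -> ratfun2 F :=
  match val i with
  | 0%N => rlift (rlift D)
  | 1%N => rlift (@rderiv F)
  | _ => @rderiv (ratfun F)
  end.

(* Exterior calculus over a field L with partial derivatives D 0, D 1, D 2.
   A one-form a dx + b dy + c dz is the row (a, b, c); a two-form
   P dy/\dz + Q dz/\dx + R dx/\dy is the row (P, Q, R); a three-form
   f dx/\dy/\dz is f.  Indices are added modulo 3. *)
Section Forms.
Variables (L : fieldType) (D : 'I_3 -> L -> L).

Definition dfun (f : L) : 'rV[L]_3 := \row_i D i f.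

Definition dform (w : 'rV[L]_3) : 'rV[L]_3 :=
  \row_(i < 3) (D (i + 1) (w 0 (i + 2%:R)) - D (i + 2%:R) (w 0 (i + 1))).

Definition wedge11 (u v : 'rV[L]_3) : 'rV[L]_3 :=
  \row_(i < 3) (u 0 (i + 1) * v 0 (i + 2%:R) - u 0 (i + 2%:R) * v 0 (i + 1)).

Definition wedge12 (w Omega : 'rV[L]_3) : L := \sum_i w 0 i * Omega 0 i.

(* The set I(Omega), with forms over L. *)
Definition integrating_forms (Omega : 'rV[L]_3) : set 'rV[L]_3 :=
  [set w | w != 0 /\ exists alpha : 'rV[L]_3,
    [/\ wedge12 w Omega = 0, dform w = wedge11 alpha w & dform alpha = 0]].

End Forms.

Definition vf_form (L : fieldType) (P Q R : L) : 'rV[L]_3 :=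
  \row_i tnth [tuple P; Q; R] i.

Definition subfield (L : fieldType) (S : set L) : Prop :=
  [/\ S 1, forall a b, S a -> S b -> S (a - b)
         & forall a b, S a -> S b -> S (a / b)].

Definition field_adjoin (L : fieldType) (S A : set L) : set L :=
  smallest (@subfield L) (S `|` A).

Definition finite_over (L : fieldType) (S T : set L) : Prop :=
  exists s : seq L, (forall i : 'I_(size s), T s`_i) /\
    forall u, T u -> exists c : 'I_(size s) -> L,
      (forall i, S (c i)) /\ u = \sum_i c i * s`_i.

Definition form_over (L : fieldType) (S : set L) : set 'rV[L]_3 :=
  [set w | forall i, S (w 0 i)].

Section Liouvillian.
Variables (K : fieldType) (DK : 'I_3 -> K -> K).
Variables (L : fieldType) (DL : 'I_3 -> L -> L) (iota : {rmorphism K -> L}).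

Definition diff_extension : Prop :=
  [/\ forall i, derivation (DL i),
      forall i j a, DL i (DL j a) = DL j (DL i a)
    & forall i a, DL i (iota a) = iota (DK i a)].

Definition same_constants : Prop :=
  [set c | forall i, DL i c = 0] = iota @` [set c | forall i, DK i c = 0].

Definition liouvillian_step (S T : set L) : Prop :=
  [\/ exists t delta, [/\ t != 0, form_over S delta,
        dfun DL t = t *: delta & T = field_adjoin S [set t]],
      exists t delta, [/\ form_over S delta,
        dfun DL t = delta & T = field_adjoin S [set t]]
    | [/\ subfield T, S `<=` T & finite_over S T]].

Definition liouvillian_extension : Prop :=
  [/\ diff_extension, same_constants
    & exists (m : nat) (S : nat -> set L),
        [/\ S 0%N = range iota, S m = setT
          & forall i, (i < m)%N -> liouvillian_step (S i) (S i.+1)]].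

End Liouvillian.

Definition liouvillian_integrable (K : fieldType) (DK : 'I_3 -> K -> K)
    (Omega : 'rV[K]_3) : Prop :=
  exists (L : fieldType) (DL : 'I_3 -> L -> L) (iota : {rmorphism K -> L}),
    liouvillian_extension DK DL iota /\
    exists2 phi : L, dfun DL phi != 0
      & wedge12 (dfun DL phi) (map_mx iota Omega) = 0.

(* The equation u'' + q u = 0 over C(x), where C(x) = ratfun C carries d/dx and
   iota embeds it in the differential field (L0, delta). *)
Section PicardVessiot.
Variables (C : fieldType) (q : ratfun C).
Variables (L0 : fieldType) (delta : L0 -> L0).
Variable iota : {rmorphism ratfun C -> L0}.

Definition ode_solution (u : L0) : Prop := delta (delta u) + iota q * u = 0.

Definition fundamental_system (y : 'rV[L0]_2) : Prop :=
  (forall j, ode_solution (y 0 j)) /\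
  y 0 0 * delta (y 0 1) - delta (y 0 0) * y 0 1 != 0.

Definition picard_vessiot : Prop :=
  [/\ derivation delta,
      forall f, delta (iota f) = iota (rderiv f),
      forall c, delta c = 0 -> exists a : C, c = iota (rconst a)
    & exists2 y, fundamental_system y
        & field_adjoin (range iota)
            [set u | exists j, u = y 0 j \/ u = delta (y 0 j)] = setT].

Definition diff_galois : set {rmorphism L0 -> L0} :=
  [set s : {rmorphism L0 -> L0} |
    [/\ bijective s, forall u, s (delta u) = delta (s u)
             & forall f, s (iota f) = iota f]].

(* The matrix group of the differential Galois group is defined up to the
   choice of a fundamental system. *)
Definition has_galois_group (G : set 'M[C]_2) : Prop :=
  exists2 y, fundamental_system y & forall M : 'M[C]_2,
    G M <-> exists2 s, diff_galois s
              & map_mx s y = y *m map_mx (fun c => iota (rconst c)) M.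

End PicardVessiot.

Section MatrixGroups.
Variable C : fieldType.

Definition SL2_subgroup (G : set 'M[C]_2) : Prop :=
  [/\ G 1%:M, forall M N, G M -> G N -> G (M *m N),
      forall M, G M -> G (invmx M) & forall M, G M -> \det M = 1].

Definition mx_isog (G H : set 'M[C]_2) : Prop :=
  exists2 f : 'M[C]_2 -> 'M[C]_2, set_bij G H f
    & forall M N, G M -> G N -> f (M *m N) = f M *m f N.

(* Equality in PGL(2, C) of the classes of two invertible matrices. *)
Definition proj_eq (M N : 'M[C]_2) : Prop := exists2 c : C, c != 0 & M = c *: N.

(* r lifts to matrices an injective homomorphism A -> PGL(2, C); the subgroups
   of PGL(2, C) isomorphic to A are the images of such homomorphisms. *)
Definition PGL2_embedding (gT : finGroupType) (A : {group gT})
    (r : gT -> 'M[C]_2) : Prop :=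
  [/\ forall g, g \in A -> r g \in unitmx,
      forall g h, g \in A -> h \in A -> proj_eq (r (g * h)%g) (r g *m r h)
    & forall g, g \in A -> proj_eq (r g) 1%:M -> g = 1%g].

Definition SL2_preimage (gT : finGroupType) (A : {group gT})
    (r : gT -> 'M[C]_2) : set 'M[C]_2 :=
  [set M | \det M = 1 /\ exists2 g, g \in A & proj_eq M (r g)].

(* G is isomorphic to A^{SL(2)}. *)
Definition isog_SL2_cover (gT : finGroupType) (A : {group gT})
    (G : set 'M[C]_2) : Prop :=
  exists2 r, PGL2_embedding A r & mx_isog G (SL2_preimage A r).

End MatrixGroups.

Definition platonic_case (C : fieldType) (G : set 'M[C]_2) (m n p : nat) :
    Prop :=
  [\/ isog_SL2_cover 'Alt_('I_4) G /\ perm_eq [:: m; n; p] [:: 2; 3; 3]%N,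
      isog_SL2_cover 'Sym_('I_4) G /\ perm_eq [:: m; n; p] [:: 2; 3; 4]%N
    | isog_SL2_cover 'Alt_('I_5) G /\ perm_eq [:: m; n; p] [:: 2; 3; 5]%N].

Definition q_coef (C : fieldType) (a b c : C) : ratfun C :=
  let x := rvar C in
  4%:R^-1 * (rconst a / x ^+ 2 + rconst b / (x * (x - 1))
             + rconst c / (x - 1) ^+ 2).

(* The two-form of x' = 1, y' = q z - 1, z' = - y over C(x)(y, z). *)
Definition Omega_q (C : fieldType) (q : ratfun C) : 'rV[ratfun2 (ratfun C)]_3 :=
  vf_form 1 (r2const q * r2z _ - 1) (- r2y _).

(* Main.v *)
From HB Require Import structures.
Require Import Defs.
From mathcomp Require Import all_boot all_algebra all_fingroup all_field ring zify.
From mathcomp Require Import alt fraction generic_quotient complex boolp classical_sets functions reals.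

(** The rotation group of a regular solid acts on the Riemann sphere with three
    exceptional orbits, and Klein's forms X, Y, Z vanish on them. They satisfy
    a syzygy [cX X^2 + cY Y^3 + cZ Z^p = 0] with p = 3, 4 or 5
    ([klein_syzygy]). Order its three terms as P1 + P2 + P3 = 0 according to
    the given permutation of (2, 3, p). The rational function
    [phi = - P1 / P3] has degree N, the order of the group, and is the quotient
    by the group. Its Schwarzian derivative, obtained from the functional
    determinant and the Hessian of the forms, is the one that q prescribes
    ([schwarz_triple_forms], [schwarz_equation]). Therefore, whenever
    [phi t = x] and [w ^ 2 = dx / dt], the functions w and t w form a basis of
    solutions of y'' + q y = 0 ([ode_from_root], [schwarz_sol_pair]), and they
    are algebraic over C(x).

    Integrability. Let E be a finite extension of C(x) that contains a nonzero
    solution u ([schwarz_extension]). Adjoin to E(y, z) a primitive U of u,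
    unless E contains one. Then U + u y + u' z is a first integral
    ([primitive_first_integral], [finite_solution_integrable]).

    Galois group. A Picard-Vessiot field contains a pair w, t w as above
    ([pv_schwarz_sol]), and each of its elements is [a(t) + b(t) w]. An
    automorphism is given by the matrix through which it acts on the pair, and
    it moves t by the corresponding Moebius transformation to another root of
    phi T = x; conversely each matrix of determinant 1 whose Moebius
    transformation sends t to a root comes from an automorphism
    ([acts_realized]). The symmetries of the forms supply two such matrices
    ([klein_symmetries]). The group G contains two matrices that generate it up
    to sign and have the same traces ([cover_generators]), and an irreducible
    pair in SL(2) is determined by its traces up to conjugation
    ([trace_pair_conjugate]). So a conjugate of G consists of matrices of
    automorphisms. It contains all of them because phi T = x has at most N
    roots ([galois_group]).

    No invariant form. Let P, Q be the components along dy, dz of an invariant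
    form over L0(y, z). For each solution u the flow of the system multiplies
    P u' - Q u by a factor that does not depend on u
    ([integrating_form_flow], [invariant_form_solution]), so the quotient of
    two of these expressions is a first integral. First integrals in L0(y, z)
    are constant ([first_integral_const]): the coordinates u y + u' z turn the
    flow into two successive adjunctions of primitives of solutions, and no
    nonzero solution has a primitive in L0 ([no_primitive]). Indeed, by
    variation of constants such a primitive would produce a solution of
    z'' + q z = 1 in L0, whose mean over the Galois group would be rational,
    but at the points 0, 1 and infinity the exponents of the equation leave no
    room for a rational solution ([no_rational_solution]). Hence P u' = Q u for
    some nonzero solution u. If P and Q lie in C(x, y, z), then u' / u is fixed
    by the Galois group, which would therefore preserve the line of u, whereas
    G is irreducible ([solution_moved], [no_invariant_form]). *)

Set Implicit Arguments.
Unset Strict Implicit.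
Unset Printing Implicit Defensive.

Import GRing.Theory.
Local Open Scope ring_scope.
Local Open Scope classical_set_scope.

Local Notation "x %:F" := (@FracField.tofrac _ x) : ring_scope.

(** * Derivations *)

Definition char0 (A : nzRingType) : Prop := forall n, n.+1%:R != 0 :> A.

Lemma char0_morph (F E : fieldType) (h : {rmorphism F -> E}) :
  char0 F -> char0 E.
Proof. by move=> F0 n; rewrite -(rmorph_nat h) fmorph_eq0. Qed.

Section Derivations.
Variables (A : comNzRingType) (D : A -> A).
Hypothesis dD : derivation D.

Lemma derD a b : D (a + b) = D a + D b. Proof. exact: dD.1. Qed.
Lemma derM a b : D (a * b) = D a * b + a * D b. Proof. exact: dD.2. Qed.
Lemma der0 : D 0 = 0.
Proof. by apply: (addrI (D 0)); rewrite -derD !addr0. Qed.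
Lemma der1 : D 1 = 0.
Proof. by apply: (addrI (D 1)); rewrite addr0 -{3}[1]mulr1 derM mulr1 mul1r. Qed.
Lemma derN a : D (- a) = - D a.
Proof. by apply: (addrI (D a)); rewrite -derD !subrr der0. Qed.
Lemma derB a b : D (a - b) = D a - D b.
Proof. by rewrite derD derN. Qed.
Lemma derX n a : D (a ^+ n) = n%:R * a ^+ n.-1 * D a.
Proof.
elim: n => [|n IH]; first by rewrite expr0 der1 !mul0r.
rewrite exprS derM IH /= -natr1; case: n {IH} => [|n] /=; first by ring.
by rewrite exprS; ring.
Qed.
Lemma der_nat n : D n%:R = 0.
Proof. by elim: n => [|n IH]; rewrite ?der0 // -natr1 derD IH der1 addr0. Qed.
Lemma der_sum I (r : seq I) (P : pred I) (f : I -> A) :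
  D (\sum_(i <- r | P i) f i) = \sum_(i <- r | P i) D (f i).
Proof. exact: (big_morph D derD der0). Qed.

End Derivations.

Section DerivationsField.
Variables (F : fieldType) (D : F -> F).
Hypothesis dD : derivation D.

Lemma derV a : D a^-1 = - D a / a ^+ 2.
Proof.
have [->|a0] := eqVneq a 0; first by rewrite invr0 (der0 dD) oppr0 mul0r.
apply: (mulfI a0); have := der1 dD; rewrite -(divff a0) (derM dD).
by move/eqP; rewrite addrC addr_eq0 => /eqP ->; field.
Qed.

Lemma der_div a b : D (a / b) = D a / b - a * D b / b ^+ 2.
Proof. by rewrite (derM dD) derV; ring. Qed.

Lemma deriv_const_subfield : subfield [set a | D a = 0].
Proof.
split=> [|a b|a b] /=; first exact: der1.
  by move=> Da Db; rewrite (derB dD) Da Db subrr.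
by move=> Da Db; rewrite der_div Da Db; ring.
Qed.

End DerivationsField.

(** * Subfields *)

Section Subfields.
Variables (L : fieldType) (S : set L).
Hypothesis sS : subfield S.

Lemma subfield1 : S 1. Proof. by case: sS. Qed.
Lemma subfieldB a b : S a -> S b -> S (a - b). Proof. by case: sS => _ H _; apply: H. Qed.
Lemma subfield_div a b : S a -> S b -> S (a / b). Proof. by case: sS => _ _; apply. Qed.
Lemma subfield0 : S 0. Proof. by rewrite -(subrr 1); apply: subfieldB; exact: subfield1. Qed.
Lemma subfieldN a : S a -> S (- a).
Proof. by move=> Sa; rewrite -sub0r; apply: subfieldB => //; exact: subfield0. Qed.
Lemma subfieldD a b : S a -> S b -> S (a + b).
Proof. by move=> Sa Sb; rewrite -[b]opprK; apply/subfieldB/subfieldN. Qed.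
Lemma subfieldV a : S a -> S a^-1.
Proof. by move=> Sa; rewrite -div1r; apply: subfield_div => //; exact: subfield1. Qed.
Lemma subfieldM a b : S a -> S b -> S (a * b).
Proof. by move=> Sa Sb; rewrite -[b]invrK; apply/subfield_div/subfieldV. Qed.
Lemma subfieldX a n : S a -> S (a ^+ n).
Proof.
by move=> Sa; elim: n => [|n IH]; [exact: subfield1|rewrite exprS; exact: subfieldM].
Qed.
Lemma subfield_sum I (r : seq I) (P : pred I) (f : I -> L) :
  (forall i, P i -> S (f i)) -> S (\sum_(i <- r | P i) f i).
Proof. by move=> Sf; apply: (big_ind S) => //; [exact: subfield0|exact: subfieldD]. Qed.
End Subfields.

Lemma subfield_range (F E : fieldType) (h : {rmorphism F -> E}) :
  subfield (range h).
Proof.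
split=> [|_ _ [a _ <-] [b _ <-]|_ _ [a _ <-] [b _ <-]].
- by exists 1 => //; rewrite rmorph1.
- by exists (a - b) => //; rewrite rmorphB.
- by exists (a / b) => //; rewrite fmorph_div.
Qed.

Lemma subfield_preimage (F E : fieldType) (h : {rmorphism F -> E}) (S : set E) :
  subfield S -> subfield (h @^-1` S).
Proof.
move=> sS; split=> [|a b|a b] /=; first by rewrite rmorph1; exact: subfield1.
  by rewrite rmorphB; exact: subfieldB.
by rewrite fmorph_div; exact: subfield_div.
Qed.

Lemma subfield_equalizer (F E : fieldType) (g h : {rmorphism F -> E}) :
  subfield [set a | g a = h a].
Proof.
split=> [|a b|a b] /=; first by rewrite !rmorph1.
  by rewrite !rmorphB => -> ->.
by rewrite !fmorph_div => -> ->.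
Qed.

Lemma subfield_der_equalizer (F E : fieldType) (D : F -> F) (D' : E -> E)
    (h : {rmorphism F -> E}) :
  derivation D -> derivation D' -> subfield [set a | D' (h a) = h (D a)].
Proof.
move=> dD dD'; split=> [|a b|a b] /=.
- by rewrite rmorph1 (der1 dD) (der1 dD') rmorph0.
- by rewrite rmorphB (derB dD) (derB dD') rmorphB => -> ->.
- move=> Da Db; rewrite fmorph_div (der_div dD) (der_div dD') Da Db.
  by rewrite rmorphB !(fmorph_div, rmorphM, rmorphXn).
Qed.

Lemma field_adjoin_setT (L : fieldType) (S A T : set L) :
  field_adjoin S A = setT -> subfield T -> S `<=` T -> A `<=` T ->
  forall a, T a.
Proof.
move=> adjT sT ST AT a.
have: field_adjoin S A a by rewrite adjT.
by apply: smallest_sub => // b [/ST|/AT].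
Qed.

Lemma field_adjoin_setTP (L : fieldType) (S A : set L) :
  (forall T : set L, subfield T -> S `<=` T -> A `<=` T -> forall a, T a) ->
  field_adjoin S A = setT.
Proof.
move=> H; apply/seteqP; split=> // a _ T [sT SAT].
by apply: H => // b Sb; apply: SAT; [left|right].
Qed.

(** * Fraction fields and rational functions *)

Lemma fracP (A : idomainType) (f : {fraction A}) :
  exists a b, b != 0 /\ f = a%:F / b%:F.
Proof.
exists (\n_(repr f)), (\d_(repr f)); split; last exact: frac_numden.
exact: denom_ratioP.
Qed.

Lemma quotient_rule_add (K : fieldType) (a b c d a' b' c' d' : K) :
  b != 0 -> d != 0 ->
  ((a' * d + a * d' + (c' * b + c * b')) * (b * d)
     - (a * d + c * b) * (b' * d + b * d')) / (b * d) ^+ 2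
  = (a' * b - a * b') / b ^+ 2 + (c' * d - c * d') / d ^+ 2.
Proof. by move=> b0 d0; field; rewrite b0 d0. Qed.

Lemma quotient_rule_mul (K : fieldType) (a b c d a' b' c' d' : K) :
  b != 0 -> d != 0 ->
  ((a' * c + a * c') * (b * d) - (a * c) * (b' * d + b * d')) / (b * d) ^+ 2
  = (a' * b - a * b') / b ^+ 2 * (c / d) + a / b * ((c' * d - c * d') / d ^+ 2).
Proof. by move=> b0 d0; field; rewrite b0 d0. Qed.

Lemma der_frac_derivation (A : idomainType) (D : A -> A) :
  derivation D -> derivation (der_frac D).
Proof.
move=> dD; split=> f g;
  have [a [b [b0 ->]]] := fracP f; have [c [d [d0 ->]]] := fracP g;
  have b0' : b%:F != 0 by [rewrite tofrac_eq0];
  have d0' : d%:F != 0 by [rewrite tofrac_eq0].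
  rewrite addf_div // -!tofracM -tofracD.
  rewrite !der_fracE ?mulf_neq0 // !(derM dD, derD dD).
  by rewrite !(tofracB, tofracD, tofracM, tofracXn) quotient_rule_add.
rewrite mulf_div -!tofracM.
rewrite !der_fracE ?mulf_neq0 // !(derM dD, derD dD).
by rewrite !(tofracB, tofracD, tofracM, tofracXn) quotient_rule_mul.
Qed.

Lemma der_frac_tofrac (A : idomainType) (D : A -> A) (a : A) :
  derivation D -> der_frac D a%:F = (D a)%:F.
Proof.
move=> dD; rewrite -[a%:F]divr1 -tofrac1 der_fracE ?oner_neq0 //.
by rewrite (der1 dD) mulr0 subr0 expr1n mulr1 tofrac1 divr1.
Qed.

Lemma frac_lift (A : idomainType) (E : fieldType) (g : {rmorphism A -> E}) :
  injective g -> exists G : {rmorphism {fraction A} -> E}, forall a, G a%:F = g a.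
Proof.
move=> gI; have g0 b : b != 0 -> g b != 0 by rewrite -(inj_eq gI) rmorph0.
pose G (f : {fraction A}) := g \n_(repr f) / g \d_(repr f).
have GE a b : b != 0 -> G (a%:F / b%:F) = g a / g b.
  move=> b0; rewrite /G; have := repr_fracE a b0.
  set r := repr _ => e; have r0 : \d_r != 0 by exact: denom_ratioP.
  by apply/eqP; rewrite eqr_div ?g0 // -!rmorphM e.
have GF a : G a%:F = g a.
  by rewrite -[a%:F]divr1 -tofrac1 GE ?oner_neq0 // rmorph1 divr1.
have GD : zmod_morphism G.
  move=> f h; have [a [b [b0 ->]]] := fracP f; have [c [d [d0 ->]]] := fracP h.
  have b0' : b%:F != 0 by rewrite tofrac_eq0.
  have d0' : d%:F != 0 by rewrite tofrac_eq0.
  rewrite -mulNr -tofracN addf_div // -!tofracM -tofracD.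
  rewrite !GE ?mulf_neq0 // rmorphD !rmorphM rmorphN.
  by field; rewrite !g0.
have GM : monoid_morphism G.
  split; first by rewrite -tofrac1 GF rmorph1.
  move=> f h; have [a [b [b0 ->]]] := fracP f; have [c [d [d0 ->]]] := fracP h.
  have b0' : b%:F != 0 by rewrite tofrac_eq0.
  have d0' : d%:F != 0 by rewrite tofrac_eq0.
  rewrite mulf_div -!tofracM.
  by rewrite !GE ?mulf_neq0 // !rmorphM; field; rewrite !g0.
pose add := GRing.isZmodMorphism.Build _ _ G GD.
pose mul := GRing.isMonoidMorphism.Build _ _ G GM.
pose GG : {rmorphism {fraction A} -> E} := HB.pack G add mul.
by exists GG.
Qed.

Lemma map_poly_derivation (F : fieldType) (D : F -> F) :
  derivation D -> derivation (fun P : {poly F} => map_poly D P).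
Proof.
move=> dD; have cE (P : {poly F}) i : (map_poly D P)`_i = D P`_i.
  by rewrite coef_map_id0 // (der0 dD).
split=> P Q; apply/polyP=> i; first by rewrite coefD !cE coefD (derD dD).
rewrite coefD !cE !coefM (der_sum dD) -big_split /=; apply: eq_bigr => j _.
by rewrite !cE (derM dD).
Qed.

Lemma map_poly_derC (F : fieldType) (D : F -> F) (c : F) :
  derivation D -> map_poly D c%:P = (D c)%:P.
Proof.
move=> dD; apply/polyP=> i; rewrite coef_map_id0 ?(der0 dD) // !coefC.
by case: (i == 0%N); rewrite ?(der0 dD).
Qed.

Lemma map_poly_derX (F : fieldType) (D : F -> F) :
  derivation D -> map_poly D 'X = 0.
Proof.
move=> dD; apply/polyP=> i.
by rewrite coef_map_id0 ?(der0 dD) // coefX coef0 (der_nat dD).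
Qed.

Lemma deriv_derivation (F : fieldType) : derivation (@deriv F).
Proof. by split=> P Q; rewrite (derivD, derivM). Qed.

Lemma rderiv_derivation (F : fieldType) : derivation (@rderiv F).
Proof. exact/der_frac_derivation/deriv_derivation. Qed.

Lemma rderiv_poly (F : fieldType) (P : {poly F}) : rderiv P%:F = (P^`())%:F.
Proof. exact/der_frac_tofrac/deriv_derivation. Qed.

Lemma rderiv_const (F : fieldType) (c : F) : rderiv (rconst c) = 0.
Proof. by rewrite /rconst rderiv_poly derivC tofrac0. Qed.

Lemma rderiv_var (F : fieldType) : rderiv (rvar F) = 1.
Proof. by rewrite /rvar rderiv_poly derivX tofrac1. Qed.

Section RLift.
Variables (F : fieldType) (D : F -> F).
Hypothesis dD : derivation D.

Lemma rlift_derivation : derivation (rlift D).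
Proof. exact/der_frac_derivation/map_poly_derivation. Qed.

Lemma rlift_poly (P : {poly F}) : rlift D P%:F = (map_poly D P)%:F.
Proof. exact/der_frac_tofrac/map_poly_derivation. Qed.

Lemma rlift_const (c : F) : rlift D (rconst c) = rconst (D c).
Proof. by rewrite /rconst rlift_poly map_poly_derC. Qed.

Lemma rlift_var : rlift D (rvar F) = 0.
Proof.
by rewrite /rvar rlift_poly map_poly_derX // tofrac0.
Qed.

End RLift.

HB.instance Definition _ (F : fieldType) :=
  GRing.RMorphism.copy (@rconst F) (@FracField.tofrac {poly F} \o polyC).

(** F(v) is generated by F and v as a field: this is the induction principle
    by which morphisms and derivations of F(v) are compared. *)
Lemma ratfun_gen (F : fieldType) (S : set (ratfun F)) :
  subfield S -> (forall c, S (rconst c)) -> S (rvar F) -> forall f, S f.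
Proof.
move=> sS Sc Sx f.
have SP (P : {poly F}) : S P%:F.
  rewrite -[P]coefK poly_def rmorph_sum; apply: subfield_sum => // i _.
  rewrite -mul_polyC rmorphM rmorphXn; apply: subfieldM => //; first exact: Sc.
  exact: subfieldX.
by have [a [b [_ ->]]] := fracP f; apply: subfield_div.
Qed.

Lemma ratfun_rmorph_eq (F E : fieldType) (g h : {rmorphism ratfun F -> E}) :
  (forall c, g (rconst c) = h (rconst c)) -> g (rvar F) = h (rvar F) -> g =1 h.
Proof.
by move=> gc gx; apply: ratfun_gen => //; exact: subfield_equalizer.
Qed.

Lemma ratfun_der_eq (F E : fieldType) (D : ratfun F -> ratfun F) (D' : E -> E)
    (h : {rmorphism ratfun F -> E}) :
  derivation D -> derivation D' ->
  (forall c, D' (h (rconst c)) = h (D (rconst c))) ->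
  D' (h (rvar F)) = h (D (rvar F)) -> forall f, D' (h f) = h (D f).
Proof. by move=> dD dD' Hc Hx; apply: ratfun_gen => //; exact: subfield_der_equalizer. Qed.

Section RMap.
Variables (F E : fieldType) (h : {rmorphism F -> E}).

Lemma rmap_frac (a b : {poly F}) :
  b != 0 -> rmap h (a%:F / b%:F) = (map_poly h a)%:F / (map_poly h b)%:F.
Proof. by move=> b0; apply: map_fracE => //; exact: map_poly_inj. Qed.

Lemma rmap_poly (a : {poly F}) : rmap h a%:F = (map_poly h a)%:F.
Proof.
by rewrite -[a%:F]divr1 -tofrac1 rmap_frac ?oner_neq0 // rmorph1 tofrac1 divr1.
Qed.

Lemma rmap_lift : exists G : {rmorphism ratfun F -> ratfun E}, rmap h =1 G.
Proof.
have inj : injective (@FracField.tofrac {poly E} \o map_poly h).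
  by move=> a b /eqP; rewrite /= tofrac_eq => /eqP /map_poly_inj.
have [G GE] := frac_lift inj.
exists G => f; have [a [b [b0 ->]]] := fracP f.
by rewrite rmap_frac // fmorph_div; congr (_ / _); rewrite GE.
Qed.

Lemma rmap_is_zmod_morphism : zmod_morphism (rmap h).
Proof. by have [G GE] := rmap_lift; move=> a b; rewrite !GE rmorphB. Qed.

Lemma rmap_is_monoid_morphism : monoid_morphism (rmap h).
Proof.
have [G GE] := rmap_lift.
by split=> [|a b]; rewrite !GE ?rmorph1 // rmorphM.
Qed.

HB.instance Definition _ :=
  GRing.isZmodMorphism.Build (ratfun F) (ratfun E) (rmap h) rmap_is_zmod_morphism.
HB.instance Definition _ :=
  GRing.isMonoidMorphism.Build (ratfun F) (ratfun E) (rmap h) rmap_is_monoid_morphism.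

Lemma rmap_const (c : F) : rmap h (rconst c) = rconst (h c).
Proof. by rewrite /rconst rmap_poly map_polyC. Qed.

Lemma rmap_var : rmap h (rvar F) = rvar E.
Proof. by rewrite /rvar rmap_poly map_polyX. Qed.

End RMap.

HB.instance Definition _ (F E : fieldType) (h : {rmorphism F -> E}) :=
  GRing.RMorphism.copy (r2map h) (rmap (rmap h)).
HB.instance Definition _ (F : fieldType) :=
  GRing.RMorphism.copy (@r2const F) (@rconst (ratfun F) \o @rconst F).

Definition transcendental (F E : fieldType) (h : F -> E) (v : E) : Prop :=
  forall P : {poly F}, (map_poly h P).[v] = 0 -> P = 0.

Lemma ratfun_eval (F E : fieldType) (h : {rmorphism F -> E}) (v : E) :
  transcendental h v ->
  exists G : {rmorphism ratfun F -> E},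
    [/\ forall P : {poly F}, G P%:F = (map_poly h P).[v],
        forall c, G (rconst c) = h c & G (rvar F) = v].
Proof.
move=> tv; pose g := horner_eval v \o map_poly h.
have gI : injective g.
  by move=> a b /eqP; rewrite -subr_eq0 -rmorphB => /eqP /tv /eqP; rewrite subr_eq0 => /eqP.
have [G GE] := frac_lift gI; exists G; split=> [P|c|]; rewrite GE //= /horner_eval.
  by rewrite map_polyC hornerC.
by rewrite map_polyX hornerX.
Qed.

(** A derivation that kills F but not v forbids any algebraic relation: a
    relation of least degree could be differentiated. *)
Lemma transcendental_der (F E : fieldType) (h : {rmorphism F -> E})
    (d : E -> E) (v : E) :
  derivation d -> (forall a, d (h a) = 0) -> d v != 0 -> char0 E ->
  transcendental h v.
Proof.
move=> dd dh dv c0 P; have [n] := ubnP (size P); elim: n P => // n IH P ltPn Pv.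
have dP (Q : {poly F}) : d (map_poly h Q).[v] = (map_poly h Q^`()).[v] * d v.
  elim/poly_ind: Q => [|Q c IHQ].
    by rewrite deriv0 !rmorph0 !horner0 (der0 dd) mul0r.
  rewrite !(rmorphD, rmorphM) /= map_polyX map_polyC hornerD hornerM hornerX hornerC.
  rewrite (derD dd) (derM dd) dh IHQ addr0 derivMXaddC.
  by rewrite rmorphD rmorphM /= map_polyX hornerD hornerM hornerX; ring.
have [sP|sP] := leqP (size P) 1.
  move: Pv; rewrite (size1_polyC sP) map_polyC hornerC => /eqP.
  by rewrite fmorph_eq0 => /eqP ->; rewrite polyC0.
have P'0 : P^`() = 0.
  apply: IH; first by rewrite (leq_trans (lt_size_deriv _)) // -size_poly_gt0 (ltn_trans _ sP).
  by apply/eqP; have /eqP := dP P; rewrite Pv (der0 dd) eq_sym mulf_eq0 (negbTE dv) orbF.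
have := congr1 (fun Q : {poly F} => Q`_(size P).-2) P'0.
rewrite coef_deriv coef0 -subn2 -[size P]prednK ?(ltn_trans _ sP) // subSS subn1 prednK; last by rewrite -subn1 subn_gt0.
rewrite -mulr_natl => /eqP; rewrite mulf_eq0; case/orP.
  rewrite -(fmorph_eq0 h) rmorph_nat -[X in X%:R]prednK ?(negbTE (c0 _)) //.
  by rewrite -subn1 subn_gt0.
by rewrite -/(lead_coef P) lead_coef_eq0 => /eqP.
Qed.

(** * Primitives and constants of F(v) *)

Lemma frac_coprime (F : fieldType) (f : ratfun F) :
  exists a b : {poly F}, [/\ b \is monic, coprimep a b & f = a%:F / b%:F].
Proof.
have [a [b [b0 ->]]] := fracP f.
set g := gcdp a b; have g0 : g != 0 by rewrite gcdp_eq0 negb_and b0 orbT.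
have eb : b = (b %/ g) * g by rewrite divpK // dvdp_gcdr.
have ea : a = (a %/ g) * g by rewrite divpK // dvdp_gcdl.
set a' := a %/ g in ea; set b' := b %/ g in eb.
have b'0 : b' != 0 by apply: contraNneq b0 => b'0; rewrite eb b'0 mul0r.
have l0 : lead_coef b' != 0 by rewrite lead_coef_eq0.
exists ((lead_coef b')^-1 *: a'), ((lead_coef b')^-1 *: b'); split.
- by rewrite monicE lead_coefZ mulVf.
- rewrite coprimepZl ?invr_eq0 // coprimepZr ?invr_eq0 //.
  by apply: coprimep_div_gcd; rewrite b0 orbT.
- apply/eqP; rewrite eqr_div ?tofrac_eq0 // ?scaler_eq0 ?negb_or ?invr_eq0 ?l0 //.
  by rewrite -!tofracM tofrac_eq ea eb -!mul_polyC; apply/eqP; ring.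
Qed.

(* Identities between fractions are stated over an abstract field, where the
   normalization of field expressions is cheap, and then specialized. *)
Lemma quotient_rule_clear (K : fieldType) (x y a b g : K) :
  y != 0 -> x / y - a * b / y ^+ 2 = g -> x * y - a * b = g * y ^+ 2.
Proof. by move=> y0 <-; field. Qed.

Lemma derivation0 (A : comNzRingType) : derivation (fun _ : A => 0).
Proof. by split=> a b; rewrite ?addr0 // mul0r mulr0 addr0. Qed.

Lemma derivation_comb (A : comNzRingType) (D D' : A -> A) (r s : A) :
  derivation D -> derivation D' -> derivation (fun a => r * D a + s * D' a).
Proof.
by move=> dD dD'; split=> a b; rewrite ?(derD dD) ?(derD dD') ?(derM dD) ?(derM dD'); ring.
Qed.

Lemma derivation_comm (A : comNzRingType) (D D' : A -> A) :
  derivation D -> derivation D' -> derivation (fun a => D (D' a) - D' (D a)).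
Proof.
move=> dD dD'; split=> a b.
  by rewrite (derD dD) (derD dD') (derD dD) (derD dD'); ring.
rewrite (derM dD) (derM dD') (derD dD) (derD dD') !(derM dD) !(derM dD').
by ring.
Qed.

(** The derivation of F(v) that extends [D] and sends [v] to [b]. *)
Definition der_ext (F : fieldType) (D : F -> F) (b : F) (f : ratfun F) : ratfun F :=
  rlift D f + rconst b * rderiv f.

Section DerExt.
Variables (F : fieldType) (D : F -> F) (b : F).
Hypothesis dD : derivation D.
Hypothesis F0 : char0 F.

Let Dp (P : {poly F}) := map_poly D P + b *: P^`().

Lemma der_ext_derivation : derivation (der_ext D b).
Proof.
have := derivation_comb 1 (rconst b) (rlift_derivation dD) (@rderiv_derivation F).
by case=> H1 H2; split=> f g; [move: (H1 f g)|move: (H2 f g)]; rewrite !mul1r.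
Qed.

Lemma der_ext_const (c : F) : der_ext D b (rconst c) = rconst (D c).
Proof. by rewrite /der_ext rlift_const // rderiv_const mulr0 addr0. Qed.

Lemma der_ext_var : der_ext D b (rvar F) = rconst b.
Proof. by rewrite /der_ext rlift_var // rderiv_var mulr1 add0r. Qed.

Lemma der_ext_poly (P : {poly F}) : der_ext D b P%:F = (Dp P)%:F.
Proof. by rewrite /der_ext rlift_poly // rderiv_poly tofracD -mul_polyC tofracM. Qed.

Lemma coef_der_poly (P : {poly F}) i :
  (Dp P)`_i = D P`_i + b * (P`_i.+1 *+ i.+1).
Proof. by rewrite coefD coefZ coef_deriv coef_map_id0 // (der0 dD). Qed.

Hypothesis b_prim : forall a, D a <> b.

(** The coefficient below the leading one would provide a primitive of [b]. *)
Lemma der_poly_small (P : {poly F}) n :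
  size P = n.+2 -> (Dp P)`_n.+1 = 0 -> (Dp P)`_n = 0 -> False.
Proof.
move=> sP; rewrite !coef_der_poly [P`_n.+2]nth_default ?sP // mul0rn mulr0 addr0.
move=> Dl /eqP; rewrite addr_eq0 => /eqP e.
have l0 : P`_n.+1 != 0 by rewrite -[n.+1]/(n.+2.-1) -sP -/(lead_coef P) lead_coef_eq0 -size_poly_eq0 sP.
apply: (b_prim (a := - (P`_n / (n.+1%:R * P`_n.+1)))).
rewrite (derN dD) (der_div dD) (derM dD) Dl (der_nat dD) e -mulr_natr.
by field; rewrite l0 nat1r F0.
Qed.

(** If P / Q is reduced and Q monic, then Q divides its own derivative, which is
    of smaller degree and hence zero. By [der_poly_small], this excludes a
    positive degree of Q, and then a degree of P greater than 1. *)
Lemma der_ext_primitive (f : ratfun F) (g : F) :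
  der_ext D b f = rconst g ->
  exists p0 p1, D p1 = 0 /\ f = rconst p0 + rconst p1 * rvar F.
Proof.
have [P [Q [mQ cPQ ->]]] := frac_coprime f.
have Q0 : Q != 0 by exact: monic_neq0.
have Q0' : Q%:F != 0 by rewrite tofrac_eq0.
rewrite (der_div der_ext_derivation) !der_ext_poly => e.
have {}e : Dp P * Q - P * Dp Q = g *: Q ^+ 2.
  apply/eqP; rewrite -tofrac_eq -mul_polyC !(tofracB, tofracM, tofracXn).
  by rewrite (quotient_rule_clear Q0' e).
have sDQ : (size (Dp Q) < size Q)%N.
  rewrite -[size Q]prednK ?size_poly_gt0 // ltnS; apply/leq_sizeP => j.
  rewrite leq_eqVlt => /predU1P[<-|sj]; rewrite coef_der_poly.
    rewrite -/(lead_coef Q) (monicP mQ) (der1 dD) add0r nth_default ?mul0rn ?mulr0 //.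
    by rewrite prednK ?size_poly_gt0.
  have {}sj : (size Q <= j)%N by rewrite -[size Q]prednK ?size_poly_gt0.
  by rewrite !nth_default ?(der0 dD) ?mul0rn ?mulr0 ?addr0 // (leq_trans sj).
have dQ : Q %| Dp Q.
  have : Q %| P * Dp Q.
    have -> : P * Dp Q = (Dp P - g *: Q) * Q.
      by rewrite mulrBl -scalerAl -expr2 -e opprB addrC subrK.
    exact: dvdp_mull.
  by rewrite Gauss_dvdpr // coprimep_sym.
have DQ0 : Dp Q = 0 by apply: contraTeq sDQ => DQ0; rewrite -leqNgt dvdp_leq.
have Q1 : Q = 1.
  have : (size Q <= 1)%N.
    rewrite leqNgt; apply/negP=> sQ.
    case eS: (size Q) sQ => [|[|n]] // _.
    by apply: (der_poly_small eS); rewrite DQ0 coef0.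
  by move/size1_polyC => eQ; move: mQ; rewrite eQ monicE lead_coefC => /eqP ->.
move: e; rewrite {}Q1 in DQ0 *; rewrite {}DQ0 mulr1 mulr0 subr0 expr1n alg_polyC => e.
have sP : (size P <= 2)%N.
  rewrite leqNgt; apply/negP=> sP.
  case eS: (size P) sP => [|[|[|n]]] // _.
  by apply: (der_poly_small eS); rewrite e coefC.
exists P`_0, P`_1; split.
  by have := congr1 (fun R : {poly F} => R`_1) e; rewrite /= coef_der_poly coefC /= [P`_2]nth_default // mul0rn mulr0 addr0.
rewrite tofrac1 divr1 /rconst /rvar -tofracM -tofracD; congr (_%:F).
apply/polyP=> i; rewrite coefD coefC coefCM coefX.
by case: i => [|[|i]]; rewrite /= ?mulr0 ?mulr1 ?addr0 ?add0r // nth_default // (leq_trans sP).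
Qed.

Lemma der_ext_no_new_constant (f : ratfun F) :
  der_ext D b f = 0 -> exists2 p, D p = 0 & f = rconst p.
Proof.
move=> Df; have : der_ext D b f = rconst 0 by rewrite Df rmorph0.
move=> /der_ext_primitive[p0 [p1 [Dp1 ef]]].
move: Df; rewrite {f}ef (derD der_ext_derivation) (derM der_ext_derivation).
rewrite !der_ext_const der_ext_var Dp1 rmorph0 mul0r add0r -rmorphM -rmorphD => /eqP.
rewrite fmorph_eq0 addr_eq0 => /eqP e.
have [p10|p10] := eqVneq p1 0.
  by exists p0; [rewrite e p10 mul0r oppr0|rewrite p10 rmorph0 mul0r addr0].
case: (b_prim (a := - (p0 / p1))).
by rewrite (derN dD) (der_div dD) Dp1 e; field.
Qed.

End DerExt.

Lemma rlift0 (F : fieldType) (f : ratfun F) : rlift (fun _ : F => 0) f = 0.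
Proof.
have d0 := derivation0 F; apply: (ratfun_gen (S := [set f | rlift (fun=> 0) f = 0])).
- exact/deriv_const_subfield/rlift_derivation.
- by move=> c /=; rewrite rlift_const // rmorph0.
- by rewrite /= rlift_var.
Qed.

(* C(v) with d / dv is the extension of the zero derivation by a primitive
   of 1. *)
Lemma rderiv_eq0 (F : fieldType) (f : ratfun F) :
  char0 F -> rderiv f = 0 -> exists c, f = rconst c.
Proof.
move=> F0 f0; have d0 := derivation0 F.
have b1 (a : F) : 0 <> 1 :> F by move/eqP; rewrite eq_sym oner_eq0.
have f0' : der_ext (fun=> 0) 1 f = 0 by rewrite /der_ext rlift0 f0 mulr0 addr0.
by have [c _ ->] := der_ext_no_new_constant d0 F0 b1 f0'; exists c.
Qed.

Lemma ratfun_char0 (F : fieldType) : char0 F -> char0 (ratfun F).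
Proof. exact: (char0_morph (@rconst F)). Qed.

(** * Adjoining a root to a differential field *)

(** The irreducible factor supplies a field in which the polynomial has a
    root. *)
Lemma irreducible_factor (F : fieldType) (p : {poly F}) :
  (1 < size p)%N -> exists2 r : {poly F}, irreducible_poly r & r %| p.
Proof.
have [n] := ubnP (size p); elim: n p => // n IH p ltpn p1.
have [irr|nirr] := pselect (irreducible_poly p); first by exists p.
have [q [q1 qp nqp]] : exists q : {poly F}, [/\ size q != 1, q %| p & ~~ (q %= p)].
  apply: contrapT => H; apply: nirr; split=> // q q1 qp.
  by apply: contrapT => /negP nqp; apply: H; exists q.
have p0 : p != 0 by rewrite -size_poly_gt0 (ltn_trans _ p1).
have q0 : q != 0 by apply: contraNneq p0 => q0; rewrite q0 dvd0p in qp.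
have q_gt1 : (1 < size q)%N by rewrite ltn_neqAle eq_sym q1 size_poly_gt0.
have sqp : (size q < size p)%N.
  by rewrite ltn_neqAle dvdp_leq // andbT dvdp_size_eqp.
have [||r irr rq] := IH q => //; first by rewrite (leq_trans sqp).
by exists r => //; apply: dvdp_trans qp.
Qed.

Lemma map_poly_range (F E : fieldType) (h : {rmorphism F -> E}) (p : {poly E}) :
  (forall i, exists a, p`_i = h a) -> exists q, p = map_poly h q.
Proof.
move=> H; have [f fE] := choice H.
exists (\poly_(i < size p) f i); apply/polyP=> i; rewrite coef_map coef_poly.
case: ltnP => [_|si]; first exact: fE.
by rewrite nth_default // raddf0.
Qed.

Lemma root_closed (C : closedFieldType) (E : fieldType) (h : {rmorphism C -> E})
    (q : {poly C}) (u : E) :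
  q != 0 -> root (map_poly h q) u -> exists c, u = h c.
Proof.
move=> q0; have [r ->] := closed_field_poly_normal q.
rewrite map_polyZ rootZ ?fmorph_eq0 ?lead_coef_eq0 // rmorph_prod /=.
rewrite (eq_bigr (fun z => 'X - (h z)%:P)) => [|z _]; last first.
  by rewrite rmorphB /= map_polyX map_polyC.
rewrite -(big_map h xpredT (fun z => 'X - z%:P)) root_prod_XsubC.
by case/mapP=> c _ ->; exists c.
Qed.

(** The constants do not grow: the minimal polynomial of a new constant has
    constant coefficients, since differentiating it gives a polynomial of
    smaller degree that vanishes at the same point. *)
Lemma adjoin_root (C : closedFieldType) (F : fieldType) (D : F -> F)
    (k : {rmorphism C -> F}) (p : {poly F}) :
  derivation D -> char0 F -> (forall c, D (k c) = 0) ->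
  (forall a, D a = 0 -> exists c, a = k c) -> (1 < size p)%N ->
  exists (M : fieldType) (DM : M -> M) (i : {rmorphism F -> M}),
    [/\ derivation DM, forall a, DM (i a) = i (D a),
        forall u, DM u = 0 -> exists c, u = i (k c),
        exists z, root (map_poly i p) z
      & exists n (e : 'I_n -> M), forall u, exists c : 'I_n -> F,
          u = \sum_j i (c j) * e j].
Proof.
move=> dD F0 Dk kP /irreducible_factor[r irr_r rp].
have [L _ [z rz0 Lz]] := irredp_FAdjoin irr_r.
have r0 : r != 0 by case: irr_r => r1 _; rewrite -size_poly_gt0 (ltn_trans _ r1).
pose h P := (map_poly (in_alg L) P).[z].
have hD P Q : h (P + Q) = h P + h Q by rewrite /h rmorphD hornerD.
have hB P Q : h (P - Q) = h P - h Q by rewrite /h rmorphB hornerD hornerN.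
have hM P Q : h (P * Q) = h P * h Q by rewrite /h rmorphM hornerM.
have hC a : h a%:P = in_alg L a by rewrite /h map_polyC hornerC.
have surj u : exists P, h P = u.
  have : u \in <<1; z>>%VS by rewrite Lz memvf.
  by case/Fadjoin_polyP=> P /polyOver1P[Q ->] ->; exists Q.
have hr : h r = 0 by exact/rootP.
have ker P : h P = 0 -> r %| P.
  move=> hP; apply: contrapT => /negP nrP.
  have /Bezout_eq1_coprimepP[[u v] /= e] : coprimep r P.
    case: irr_r => r1 irr; rewrite /coprimep; apply: contraNT nrP => g1.
    by rewrite -(eqp_dvdl _ (irr _ g1 (dvdp_gcdl _ _))) dvdp_gcdr.
  have := congr1 h e; rewrite hD !hM hr hP !mulr0 addr0 -polyC1 hC rmorph1.
  by move/esym/eqP; rewrite oner_eq0.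
have r'0 : r^`() != 0.
  case: irr_r => r1 _; apply/eqP=> /polyP /(_ (size r).-2).
  have r2 : (0 < (size r).-1)%N by rewrite -subn1 subn_gt0.
  rewrite coef0 coef_deriv prednK // -/(lead_coef r) -mulr_natl => /eqP.
  by rewrite mulf_eq0 lead_coef_eq0 (negbTE r0) orbF -[X in X%:R]prednK // (negbTE (F0 _)).
have hr' : h r^`() != 0.
  by apply/eqP=> /ker /(dvdp_leq r'0); rewrite leqNgt lt_size_deriv.
have dmD := map_poly_derivation dD.
pose z' := - h (map_poly D r) / h r^`().
pose Dh P := h (map_poly D P) + h P^`() * z'.
have DhD P Q : Dh (P + Q) = Dh P + Dh Q.
  by rewrite /Dh (derD dmD) derivD !hD; ring.
have DhM P Q : Dh (P * Q) = Dh P * h Q + h P * Dh Q.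
  by rewrite /Dh (derM dmD) derivM !hD !hM; ring.
have Dhr : Dh r = 0 by rewrite /Dh /z'; field.
have Dh_eq P Q : h P = h Q -> Dh P = Dh Q.
  move/eqP; rewrite -subr_eq0 -hB => /eqP /ker /dvdpP[S e].
  have -> : P = Q + S * r by rewrite -e addrC subrK.
  by rewrite DhD DhM Dhr hr !mulr0 !addr0.
have [g gE] := choice surj.
pose DM u := Dh (g u).
have DMh P : DM (h P) = Dh P by apply: Dh_eq; rewrite gE.
have dDM : derivation DM.
  split=> u v; rewrite -[u]gE -[v]gE; first by rewrite -hD !DMh DhD.
  by rewrite -hM !DMh DhM.
have DMi a : DM (in_alg L a) = in_alg L (D a).
  by rewrite -hC DMh /Dh map_poly_derC // derivC hC -polyC0 hC rmorph0 mul0r addr0.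
have DM_horner P u : DM (map_poly (in_alg L) P).[u] =
    (map_poly (in_alg L) (map_poly D P)).[u] + (map_poly (in_alg L) P^`()).[u] * DM u.
  elim/poly_ind: P => [|P a IH].
    by rewrite (der0 dmD) deriv0 !rmorph0 !horner0 (der0 dDM) mul0r addr0.
  rewrite (derD dmD) (derM dmD) derivMXaddC map_poly_derC //=.
  rewrite map_poly_derX // mulr0 addr0 !(rmorphD, rmorphM) /= !map_polyX !map_polyC.
  rewrite !(hornerD, hornerM) !hornerX !hornerC (derD dDM) (derM dDM) IH DMi.
  by ring.
exists L, DM, (in_alg L); split => //.
- move=> u Du; have /polyOver1P[q eq] := minPolyOver 1%AS u.
  have mq : q \is monic by rewrite -(map_monic (in_alg L)) -eq monic_minPoly.
  have q0 : q != 0 by exact: monic_neq0.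
  have qu : (map_poly (in_alg L) q).[u] = 0 by rewrite -eq; exact/rootP/root_minPoly.
  have Dq0 : map_poly D q = 0.
    have : q %| map_poly D q.
      rewrite -(dvdp_map (in_alg L)) -eq; apply: minPoly_dvdp.
        by apply/polyOver1P; exists (map_poly D q).
      by apply/rootP; have := DM_horner q u; rewrite qu (der0 dDM) Du mulr0 addr0.
    apply: contraTeq => Dq0; apply/negP=> /(dvdp_leq Dq0).
    apply/negP; rewrite -ltnNge -[size q]prednK ?size_poly_gt0 // ltnS; apply/leq_sizeP => j.
    rewrite leq_eqVlt => /predU1P[<-|sj]; rewrite coef_map_id0 ?(der0 dD) //.
      by rewrite -/(lead_coef q) (monicP mq) (der1 dD).
    by rewrite nth_default ?(der0 dD) // -[size q]prednK // size_poly_gt0.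
  have [|qc eqc] := @map_poly_range _ _ k q.
    move=> j; apply: kP; have := congr1 (fun P : {poly F} => P`_j) Dq0.
    by rewrite /= coef_map_id0 ?(der0 dD) // coef0.
  have qc0 : qc != 0 by apply: contraNneq q0 => qc0; rewrite eqc qc0 rmorph0.
  have [|c ->] := @root_closed C L (in_alg L \o k) qc u qc0; last by exists c.
  by rewrite map_poly_comp -eqc; exact/rootP.
- exists z; have /dvdpP[s ->] := rp; rewrite rmorphM rootM; apply/orP; right; exact/rootP.
- exists (size r), (fun j => z ^+ j) => u; have [P <-] := surj u.
  exists (fun j => (P %% r)`_j); rewrite {1}(divp_eq P r) hD hM hr mulr0 add0r.
  rewrite /h (horner_coef_wide (n := size r)); last first.
    by rewrite size_map_poly ltnW // ltn_modp.
  by apply: eq_bigr => j _; rewrite coef_map.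
Qed.

(** * Schwarz maps *)

Section Schwarz.
Variables (E : fieldType) (D : E -> E).
Hypothesis dD : derivation D.
Hypothesis E0 : char0 E.

Definition dlog (a : E) : E := D a / a.

Lemma dlogM a b : a != 0 -> b != 0 -> dlog (a * b) = dlog a + dlog b.
Proof. by move=> a0 b0; rewrite /dlog (derM dD); field; rewrite a0 b0. Qed.

Lemma dlogV a : dlog a^-1 = - dlog a.
Proof.
have [->|a0] := eqVneq a 0; first by rewrite /dlog invr0 (der0 dD) !mul0r oppr0.
by rewrite /dlog (derV dD) invrK; field.
Qed.

Lemma dlogN a : dlog (- a) = dlog a.
Proof. by rewrite /dlog (derN dD) invrN mulrNN. Qed.

Lemma dlogX a n : dlog (a ^+ n) = n%:R * dlog a.
Proof.
have [->|a0] := eqVneq a 0.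
  by rewrite /dlog (derX dD) (der0 dD) !(mulr0, mul0r).
rewrite /dlog (derX dD); case: n => [|n]; first by rewrite !mul0r.
by rewrite exprS /=; field; rewrite a0 expf_neq0.
Qed.

Lemma dlog_const a c : D c = 0 -> c != 0 -> dlog (c * a) = dlog a.
Proof.
move=> Dc c0; have [->|a0] := eqVneq a 0; first by rewrite mulr0.
by rewrite dlogM // {1}/dlog Dc mul0r add0r.
Qed.

Lemma dlogE a : a != 0 -> D a = a * dlog a.
Proof. by move=> a0; rewrite /dlog; field. Qed.

(** The squared exponent difference 1 / m at a singular point enters the
    potential through this number. *)
Definition angle (m : nat) : E := 1 - (m%:R ^+ 2)^-1.

(** Half the logarithmic derivative of the derivative of [- x1 / x3]. *)
Definition half_log (m n k : nat) (x1 x2 x3 : E) : E :=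
  2%:R^-1 * ((1 - m%:R^-1) * dlog x1 + (1 - n%:R^-1) * dlog x2
             + (1 - k%:R^-1) * dlog x3) - dlog x3.

(** Three functions with zero sum whose quotients are Schwarz triangle maps
    with angles pi / m, pi / n, pi / k: [r] is the common value of the
    Wronskians of pairs divided by the product of the three, and the last field
    is the Schwarzian equation for [- x1 / x3] in homogeneous form. Unlike that
    equation, the record is symmetric under permutations of the three
    functions. *)
Record schwarz_triple (m n k : nat) (x1 x2 x3 r : E) : Prop := SchwarzTriple {
  st_sum : x1 + x2 + x3 = 0;
  st_neq0 : [/\ x1 != 0, x2 != 0, x3 != 0 & r != 0];
  st_wronskian : [/\ dlog x1 - dlog x3 = r * x2, dlog x2 - dlog x1 = r * x3
                   & dlog x3 - dlog x2 = r * x1];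
  st_scale : dlog r = - (dlog x1 / m%:R + dlog x2 / n%:R + dlog x3 / k%:R);
  st_schwarzian :
    D (half_log m n k x1 x2 x3) - half_log m n k x1 x2 x3 ^+ 2
    = r ^+ 2 / 4%:R * (angle m * (x2 * x3) + angle n * (x1 * x3)
                      + angle k * (x1 * x2)) }.

Lemma schwarz_triple_swap m n k x1 x2 x3 r :
  schwarz_triple m n k x1 x2 x3 r -> schwarz_triple n m k x2 x1 x3 (- r).
Proof.
have hl : half_log n m k x2 x1 x3 = half_log m n k x1 x2 x3.
  by rewrite /half_log; ring.
case=> s [x10 x20 x30 r0] [w1 w2 w3] sc sch; split.
- by rewrite [x2 + _]addrC.
- by rewrite oppr_eq0.
- by rewrite !mulNr -w1 -w2 -w3 !opprB.
- by rewrite dlogN sc; ring.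
- by rewrite hl sch sqrrN; ring.
Qed.

(** The three Schwarz maps differ by Moebius transformations, which leave the
    Schwarzian derivative unchanged. *)
Lemma schwarz_triple_rot m n k x1 x2 x3 r :
  schwarz_triple m n k x1 x2 x3 r -> schwarz_triple n k m x2 x3 x1 r.
Proof.
case=> s [x10 x20 x30 r0] [w1 w2 w3] sc sch; split=> //.
- by rewrite -s; ring.
- by rewrite sc; ring.
set h := half_log m n k x1 x2 x3 in sch.
have -> : half_log n k m x2 x3 x1 = h - r * x2.
  by rewrite -w1 /h /half_log; ring.
have e : 2%:R * h = dlog r + dlog x1 + dlog x2 - dlog x3.
  rewrite sc /h /half_log; move: m%:R^-1 n%:R^-1 k%:R^-1 => mi ni ki; field.
  exact: (E0 1).
have -> : angle n * (x3 * x1) + angle k * (x2 * x1) + angle m * (x2 * x3) =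
  angle m * (x2 * x3) + angle n * (x1 * x3) + angle k * (x1 * x2) by ring.
rewrite -sch (derB dD) (derM dD) (dlogE r0) (dlogE x20).
suff : r * x2 * (2%:R * h - (dlog r + dlog x2) - r * x2) = 0.
  move=> e0; rewrite -[RHS]addr0 -e0; ring.
by rewrite e -w1; ring.
Qed.

(** The last equation says that the square root [w] of the derivative of [f]
    satisfies [w'' = ...] in the variable of [f]: its left-hand side is the
    Riccati expression of half the logarithmic derivative of [g]. *)
Lemma schwarz_equation m n k x1 x2 x3 r (f := - (x1 / x3)) (g := D f) A B C :
  schwarz_triple m n k x1 x2 x3 r ->
  A = angle m -> C = angle n -> A + B + C = angle k ->
  [/\ f != 0, f - 1 != 0, g != 0, g * x3 ^+ 2 = - (r * x1 * x2 * x3)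
   & D (2%:R^-1 * dlog g) - (2%:R^-1 * dlog g) ^+ 2
     = - (4%:R^-1 * (A / f ^+ 2 + B / (f * (f - 1)) + C / (f - 1) ^+ 2)) * g ^+ 2].
Proof.
case=> s [x10 x20 x30 r0] [w1 w2 w3] sc sch eA eC eABC.
have s3 : x3 = - x1 - x2 by apply/eqP; rewrite -subr_eq0 -s; apply/eqP; ring.
have ef : f - 1 = x2 / x3.
  by rewrite /f; apply: (mulIf x30); rewrite mulrBl mulNr !divfK // mul1r s3; ring.
have eg : g = - (r * x1 * x2 / x3).
  rewrite /g /f (derN dD) (der_div dD) (dlogE x10) (dlogE x30).
  transitivity (- (x1 * (dlog x1 - dlog x3) / x3)); first by field.
  by rewrite w1; field.
have f0 : f != 0 by rewrite /f oppr_eq0 mulf_neq0 // invr_eq0.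
have f10 : f - 1 != 0 by rewrite ef mulf_neq0 // invr_eq0.
have g0 : g != 0 by rewrite eg oppr_eq0 !mulf_neq0 // invr_eq0.
have lg : 2%:R^-1 * dlog g = half_log m n k x1 x2 x3.
  rewrite eg dlogN !dlogM ?mulf_neq0 ?invr_eq0 // dlogV sc /half_log.
  by move: m%:R^-1 n%:R^-1 k%:R^-1 => mi ni ki; field; exact: (E0 1).
split=> //; first by rewrite eg; field.
have -> : B = angle k - angle m - angle n by rewrite -eABC eA eC; ring.
rewrite lg sch ef /f eg eA eC {g eg g0 lg f0 f10 f ef}.
set a := angle m; set b := angle n; set c := angle k.
rewrite s3 in x30 *; field.
by rewrite (E0 3) x20 oppr_eq0 x10 x30.
Qed.

(* Here [g] stands for the logarithmic derivative of Z, [e1], [e2], [e3], [er]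
   for those of [x1], [x2], [x3], [r], and [h] for the quotient of Z'' by Z. *)
Lemma schwarz_numerics (g r x1 x2 p h : E) (x3 := - x1 - x2)
    (e1 := p * g + r * x2) (e2 := p * g - r * x1) (e3 := p * g)
    (er := - (e1 / 2%:R + e2 / 3%:R + e3 / p)) : p != 0 ->
  12%:R * h * p ^+ 2 = (6%:R + p) * (p ^+ 2 * g ^+ 2 + r ^+ 2 * x1 * x2) ->
  (p - 6%:R) / 12%:R * (h - g ^+ 2) + r * x2 * (er + e2) / 4%:R
    - r * x1 * (er + e1) / 3%:R
  - ((p - 6%:R) / 12%:R * g + r * x2 / 4%:R - r * x1 / 3%:R) ^+ 2
  = r ^+ 2 / 4%:R * ((1 - (2%:R ^+ 2)^-1) * (x2 * x3)
       + (1 - (3%:R ^+ 2)^-1) * (x1 * x3) + (1 - (p ^+ 2)^-1) * (x1 * x2)).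
Proof.
move=> p0 eh.
have n12 : 12%:R != 0 :> E by exact: (E0 11).
have -> : h = (6%:R + p) * (p ^+ 2 * g ^+ 2 + r ^+ 2 * x1 * x2) / (12%:R * p ^+ 2).
  by rewrite -eh; field; rewrite n12 p0.
rewrite /er /e1 /e2 /e3 /x3; field.
by rewrite p0 (E0 8) (E0 3) (E0 2) (E0 11) (E0 1).
Qed.

(** Klein's forms X, Y, Z of indices 2, 3, p: besides their syzygy and their
    functional determinant, the Hessian of Z, which is a multiple of Y, pins
    down the Schwarzian. *)
Lemma schwarz_triple_forms (p : nat) (X Y Z Z1 cX cY cZ kap eta : E) :
  (0 < p)%N -> [/\ X != 0, Y != 0 & Z != 0] ->
  [/\ cX != 0, cY != 0, cZ != 0 & kap != 0] ->
  [/\ D cX = 0, D cY = 0, D cZ = 0 & D kap = 0] ->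
  D Z = Z1 ->
  cX * X ^+ 2 + cY * Y ^+ 3 + cZ * Z ^+ p = 0 ->
  2%:R * D X * Z - p%:R * X * Z1 = kap * cY * Y ^+ 2 ->
  12%:R * Z * D Z1 - (6 + p)%:R * Z1 ^+ 2 = eta * Y ->
  eta * p%:R ^+ 2 = kap ^+ 2 * cX * cY * (6 + p)%:R ->
  schwarz_triple 2 3 p (cX * X ^+ 2) (cY * Y ^+ 3) (cZ * Z ^+ p) (kap / (X * Y * Z)).
Proof.
move=> p_gt0 [X0 Y0 Z0] [cX0 cY0 cZ0 k0] [DX DY DZ Dk] eZ1 s eW eH en.
set x1 := cX * X ^+ 2 in s *; set x2 := cY * Y ^+ 3 in s *; set x3 := cZ * Z ^+ p in s *.
set r := kap / _.
have p0 : p%:R != 0 :> E by rewrite -(prednK p_gt0); exact: E0.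
have x10 : x1 != 0 by rewrite mulf_neq0 ?expf_neq0.
have x20 : x2 != 0 by rewrite mulf_neq0 ?expf_neq0.
have x30 : x3 != 0 by rewrite mulf_neq0 ?expf_neq0.
have r0 : r != 0 by rewrite mulf_neq0 // invr_eq0 !mulf_neq0.
have d1 : dlog x1 = 2%:R * dlog X by rewrite /x1 dlog_const // dlogX.
have d2 : dlog x2 = 3%:R * dlog Y by rewrite /x2 dlog_const // dlogX.
have d3 : dlog x3 = p%:R * dlog Z by rewrite /x3 dlog_const // dlogX.
have dr : dlog r = - (dlog X + dlog Y + dlog Z).
  by rewrite /r dlog_const // dlogV !dlogM // mulf_neq0.
have w1 : dlog x1 - dlog x3 = r * x2.
  rewrite d1 d3 /dlog eZ1 /r /x2.
  transitivity ((2%:R * D X * Z - p%:R * X * Z1) / (X * Z)).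
    by field; rewrite X0 Z0.
  by rewrite eW; field; rewrite X0 Y0 Z0.
have s3 : x3 = - x1 - x2 by apply/eqP; rewrite -subr_eq0 -s; apply/eqP; ring.
have sd : x1 * dlog x1 + x2 * dlog x2 + x3 * dlog x3 = 0.
  by rewrite -(dlogE x10) -(dlogE x20) -(dlogE x30) -!(derD dD) s (der0 dD).
have w2 : dlog x2 - dlog x1 = r * x3.
  apply: (mulfI x20); transitivity (x3 * (dlog x1 - dlog x3)).
    apply/eqP; rewrite -subr_eq0 -sd s3; apply/eqP; ring.
  by rewrite w1; ring.
have w3 : dlog x3 - dlog x2 = r * x1.
  transitivity (- (dlog x1 - dlog x3) - (dlog x2 - dlog x1)); first by ring.
  by rewrite w1 w2 s3; ring.
have sc : dlog r = - (dlog x1 / 2%:R + dlog x2 / 3%:R + dlog x3 / p%:R).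
  by rewrite dr d1 d2 d3; field; rewrite p0 (E0 1) (E0 2).
split=> //.
set g := dlog Z.
have e3 : dlog x3 = p%:R * g by [].
have e1 : dlog x1 = p%:R * g + r * x2 by rewrite -w1 e3; ring.
have e2 : dlog x2 = p%:R * g - r * x1 by rewrite -w3 e3; ring.
have n12 : 12%:R != 0 :> E by exact: (E0 11).
have hl : half_log 2 3 p x1 x2 x3 =
    (p%:R - 6%:R) / 12%:R * g + r * x2 / 4%:R - r * x1 / 3%:R.
  rewrite /half_log e1 e2 e3; field.
  by rewrite p0 (E0 3) (E0 2) (E0 11) (E0 1).
rewrite hl.
have Dn n a : D (a / n%:R) = D a / n%:R.
  by rewrite (der_div dD) (der_nat dD) mulr0 mul0r subr0.
have Dg : D g = D Z1 / Z - g ^+ 2.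
  by rewrite /g /dlog (der_div dD) eZ1; field.
rewrite (derB dD) (derD dD) (derM dD) !Dn (derB dD) !(der_nat dD) subrr !mul0r add0r.
rewrite Dg (derM dD r x2) (derM dD r x1) (dlogE r0) (dlogE x10) (dlogE x20).
have -> : r * dlog r * x2 + r * (x2 * dlog x2) = r * x2 * (dlog r + dlog x2) by ring.
have -> : r * dlog r * x1 + r * (x1 * dlog x1) = r * x1 * (dlog r + dlog x1) by ring.
rewrite sc e1 e2 e3 s3; apply: schwarz_numerics => //.
rewrite -natrD; apply: (mulIf (expf_neq0 2 Z0)).
transitivity (p%:R ^+ 2 * ((12%:R * Z * D Z1 - (6 + p)%:R * Z1 ^+ 2) + (6 + p)%:R * Z1 ^+ 2)).
  by field.
rewrite eH mulrDr; have -> : p%:R ^+ 2 * (eta * Y) = eta * p%:R ^+ 2 * Y by ring.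
rewrite en /g /dlog eZ1 /r /x1 /x2; field.
by rewrite X0 Y0 Z0.
Qed.

End Schwarz.

(** * Klein's forms *)

Section Forms.
Variable R : comNzRingType.

(** The forms of degrees N / p, N / 3 and N / 2 in dehomogenized form, for the
    tetrahedron, the octahedron and the icosahedron. The tetrahedron is placed
    with a vertex at infinity, which gives rational coefficients. *)
Definition klein_Z (p : nat) (t : R) : R :=
  match p with
  | 3 => t ^+ 4 + 8%:R * t
  | 4 => t ^+ 5 - t
  | _ => t ^+ 11 + 11%:R * t ^+ 6 - t
  end.

Definition klein_Y (p : nat) (t : R) : R :=
  match p with
  | 3 => t ^+ 3 - 1
  | 4 => t ^+ 8 + 14%:R * t ^+ 4 + 1
  | _ => - t ^+ 20 + 228%:R * t ^+ 15 - 494%:R * t ^+ 10 - 228%:R * t ^+ 5 - 1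
  end.

Definition klein_X (p : nat) (t : R) : R :=
  match p with
  | 3 => t ^+ 6 - 20%:R * t ^+ 3 - 8%:R
  | 4 => t ^+ 12 - 33%:R * t ^+ 8 - 33%:R * t ^+ 4 + 1
  | _ => t ^+ 30 + 522%:R * t ^+ 25 - 15%:R * 667%:R * (t ^+ 20 + t ^+ 10)
         - 522%:R * t ^+ 5 + 1
  end.

(** The coefficients of the syzygy, and the factors in the expressions of the
    functional determinant and of the Hessian. *)
Definition klein_cX (p : nat) : R := match p with 3 => -1 | _ => 1 end.
Definition klein_cY (p : nat) : R :=
  match p with 3 => - 64%:R | 4 => -1 | _ => 1 end.
Definition klein_cZ (p : nat) : R :=
  match p with 3 => 1 | 4 => 108%:R | _ => - 1728%:R end.
Definition klein_kappa (p : nat) : R :=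
  match p with 3 => - 3%:R | 4 => - 4%:R | _ => 5%:R end.
Definition klein_eta (p : nat) : R :=
  match p with 3 => 576%:R | 4 => - 10%:R | _ => 11%:R end.

Definition platonic (p : nat) : bool := p \in [:: 3; 4; 5]%N.

Lemma klein_syzygy p t :
  platonic p -> klein_cX p * klein_X p t ^+ 2 + klein_cY p * klein_Y p t ^+ 3
    + klein_cZ p * klein_Z p t ^+ p = 0.
Proof. by rewrite /platonic !inE => /or3P[] /eqP -> /=; ring. Qed.

Lemma klein_eta_kappa p : platonic p ->
  klein_eta p * p%:R ^+ 2
  = klein_kappa p ^+ 2 * klein_cX p * klein_cY p * (6 + p)%:R.
Proof. by rewrite /platonic !inE => /or3P[] /eqP -> /=; ring. Qed.

Section FormsDerivation.
Variables (D : R -> R) (t : R).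
Hypotheses (dD : derivation D) (Dt : D t = 1).

Let derE := (derB dD, derD dD, derN dD, derM dD, derX dD, der_nat dD, der1 dD, Dt).

Definition klein_Z' (p : nat) : R :=
  match p with
  | 3 => 4%:R * t ^+ 3 + 8%:R
  | 4 => 5%:R * t ^+ 4 - 1
  | _ => 11%:R * t ^+ 10 + 66%:R * t ^+ 5 - 1
  end.

Lemma klein_Z'E p : platonic p -> D (klein_Z p t) = klein_Z' p.
Proof. by rewrite /platonic !inE => /or3P[] /eqP -> /=; rewrite !derE /=; ring. Qed.

(** Klein's definition of X and Y: up to factors, Y is the Hessian of Z and X
    is the functional determinant of Y and Z. The determinant of X and Z used
    here is a multiple of Y^2 by the syzygy. *)
Lemma klein_jacobian p : platonic p ->
  2%:R * D (klein_X p t) * klein_Z p t - p%:R * klein_X p t * klein_Z' p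
  = klein_kappa p * klein_cY p * klein_Y p t ^+ 2.
Proof. by rewrite /platonic !inE => /or3P[] /eqP -> /=; rewrite !derE /=; ring. Qed.

Lemma klein_hessian p : platonic p ->
  12%:R * klein_Z p t * D (klein_Z' p) - (6 + p)%:R * klein_Z' p ^+ 2
  = klein_eta p * klein_Y p t.
Proof. by rewrite /platonic !inE => /or3P[] /eqP -> /=; rewrite !derE /=; ring. Qed.

End FormsDerivation.
End Forms.

Arguments platonic p : clear implicits.

Lemma klein_const_neq0 (F : fieldType) p : char0 F -> platonic p ->
  [/\ klein_cX F p != 0, klein_cY F p != 0, klein_cZ F p != 0
    & klein_kappa F p != 0].
Proof.
move=> F0; rewrite /platonic !inE => /or3P[] /eqP -> /=;
by split; rewrite ?oppr_eq0 ?oner_neq0 ?(F0 2) ?(F0 3) ?(F0 4) ?(F0 63) ?(F0 107) ?(F0 1727).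
Qed.

Section FormsMorphism.
Variables (R S : comNzRingType) (h : {rmorphism R -> S}).
Let hE := (rmorphB h, rmorphD h, rmorphN h, rmorphM h, rmorphXn h, rmorph_nat h,
           rmorph1 h).
Lemma rmorph_klein_X p t : h (klein_X p t) = klein_X p (h t).
Proof. by case: p => [|[|[|[|[|p]]]]]; rewrite /= !hE. Qed.
Lemma rmorph_klein_Y p t : h (klein_Y p t) = klein_Y p (h t).
Proof. by case: p => [|[|[|[|[|p]]]]]; rewrite /= !hE. Qed.
Lemma rmorph_klein_Z p t : h (klein_Z p t) = klein_Z p (h t).
Proof. by case: p => [|[|[|[|[|p]]]]]; rewrite /= !hE. Qed.
Lemma rmorph_klein_cX p : h (klein_cX R p) = klein_cX S p.
Proof. by case: p => [|[|[|[|[|p]]]]]; rewrite /= ?rmorphN ?rmorph_nat ?rmorph1. Qed.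
Lemma rmorph_klein_cY p : h (klein_cY R p) = klein_cY S p.
Proof. by case: p => [|[|[|[|[|p]]]]]; rewrite /= ?rmorphN ?rmorph_nat ?rmorph1. Qed.
Lemma rmorph_klein_cZ p : h (klein_cZ R p) = klein_cZ S p.
Proof. by case: p => [|[|[|[|[|p]]]]]; rewrite /= ?rmorphN ?rmorph_nat ?rmorph1. Qed.
Lemma rmorph_klein_kappa p : h (klein_kappa R p) = klein_kappa S p.
Proof. by case: p => [|[|[|[|[|p]]]]]; rewrite /= ?rmorphN ?rmorph_nat ?rmorph1. Qed.
End FormsMorphism.

Lemma der_klein_const (R : comNzRingType) (D : R -> R) p : derivation D ->
  [/\ D (klein_cX R p) = 0, D (klein_cY R p) = 0, D (klein_cZ R p) = 0
    & D (klein_kappa R p) = 0].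
Proof.
move=> dD; case: p => [|[|[|[|[|p]]]]] /=;
by split; rewrite ?(derN dD) ?(der1 dD) ?(der_nat dD) ?oppr0.
Qed.

Lemma klein_YZ_disjoint (F : fieldType) p (t : F) : char0 F -> platonic p ->
  klein_Y p t = 0 -> klein_Z p t != 0.
Proof.
move=> F0; rewrite /platonic !inE => /or3P[] /eqP -> /= Y0; apply/eqP=> Z0.
- have t3 : t ^+ 3 = 1 by apply/eqP; rewrite -subr_eq0 Y0.
  have : 9%:R * t = 0 by rewrite -Z0 exprS t3; ring.
  move/eqP; rewrite mulf_eq0 (negbTE (F0 8)) => /eqP t0.
  by move: t3 => /eqP; rewrite t0 expr0n /= eq_sym oner_eq0.
- have : t * (t ^+ 4 - 1) = 0 by rewrite -Z0; ring.
  move/eqP; rewrite mulf_eq0 => /orP[/eqP t0|/eqP t4].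
    by move: Y0 => /eqP; rewrite t0 !expr0n /= mulr0 !add0r oner_eq0.
  have : 16%:R = 0 :> F.
    by rewrite -Y0; move/eqP: t4; rewrite subr_eq0 => /eqP t4; rewrite (exprM t 4 2) t4; ring.
  by move/eqP; rewrite (negbTE (F0 15)).
- have : t * (t ^+ 10 + 11%:R * t ^+ 5 - 1) = 0 by rewrite -Z0; ring.
  move/eqP; rewrite mulf_eq0 => /orP[/eqP t0|/eqP].
    by move: Y0 => /eqP; rewrite t0 !expr0n /= !mulr0 oppr0 !(subr0, addr0, sub0r) oppr_eq0 oner_eq0.
  move=> e; set u := t ^+ 5.
  have u2 : u ^+ 2 + 11%:R * u - 1 = 0 by rewrite -e /u; ring.
  have : 5%:R ^+ 5 * (11%:R * u - 1) = 0.
    have -> : 5%:R ^+ 5 * (11%:R * u - 1) = klein_Y 5 t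
        - (- u ^+ 2 + 239%:R * u - 3124%:R) * (u ^+ 2 + 11%:R * u - 1).
      by rewrite /u /=; ring.
    by rewrite u2 [klein_Y _ _]Y0 mulr0 subr0.
  move/eqP; rewrite mulf_eq0 expf_eq0 (negbTE (F0 4)) /= subr_eq0 => /eqP u11.
  move: u2 => /eqP; rewrite u11 addrK expf_eq0 /= => /eqP u0.
  by move: u11 => /eqP; rewrite u0 mulr0 eq_sym oner_eq0.
Qed.

(** * Matrices of size two *)

Lemma det_mx2 (R : comNzRingType) (M : 'M[R]_2) :
  \det M = M 0 0 * M 1 1 - M 0 1 * M 1 0.
Proof.
rewrite (expand_det_row _ 0) !big_ord_recl big_ord0 addr0 /cofactor !det_mx11 !mxE /=.
have -> : lift 0 0 = 1 :> 'I_2 by exact: val_inj.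
have -> : lift 1 0 = 0 :> 'I_2 by exact: val_inj.
by rewrite /= expr0 expr1; ring.
Qed.

Lemma tr_mx2 (R : nzRingType) (M : 'M[R]_2) : \tr M = M 0 0 + M 1 1.
Proof.
rewrite /mxtrace !big_ord_recl big_ord0 addr0.
by have -> : lift 0 0 = 1 :> 'I_2 by exact: val_inj.
Qed.

Lemma mul_mx2 (R : nzRingType) m n (M : 'M[R]_(m, 2)) (N : 'M[R]_(2, n)) i j :
  (M *m N) i j = M i 0 * N 0 j + M i 1 * N 1 j.
Proof.
rewrite mxE !big_ord_recl big_ord0 addr0.
by have -> : lift 0 0 = 1 :> 'I_2 by exact: val_inj.
Qed.

Lemma eq_mx2 (R : Type) (M N : 'M[R]_2) :
  M 0 0 = N 0 0 -> M 0 1 = N 0 1 -> M 1 0 = N 1 0 -> M 1 1 = N 1 1 -> M = N.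
Proof.
move=> h00 h01 h10 h11; apply/matrixP=> i j.
have ord2 (a : 'I_2) : a = 0 \/ a = 1.
  by case: a => [[|[|a]] Ha] //; [left|right]; exact: val_inj.
by case: (ord2 i) => ->; case: (ord2 j) => ->.
Qed.

Lemma eq_rv2 (R : Type) (u v : 'rV[R]_2) : u 0 0 = v 0 0 -> u 0 1 = v 0 1 -> u = v.
Proof.
move=> h0 h1; apply/matrixP=> i j; rewrite (ord1 i).
have ord2 (a : 'I_2) : a = 0 \/ a = 1.
  by case: a => [[|[|a]] Ha] //; [left|right]; exact: val_inj.
by case: (ord2 j) => ->.
Qed.

Definition mx2 (R : Type) (a b c d : R) : 'M[R]_2 :=
  \matrix_(i, j) (if i == 0 then if j == 0 then a else b
                  else if j == 0 then c else d).

Lemma mx2E (R : Type) (a b c d : R) :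
  (mx2 a b c d 0 0 = a) * (mx2 a b c d 0 1 = b) *
  (mx2 a b c d 1 0 = c) * (mx2 a b c d 1 1 = d).
Proof. by rewrite !mxE. Qed.

(** * The symmetries of Klein's forms *)

(** A matrix [M] sends the pair of solutions [(w, t w)] to [(w, t w) M], hence
    [t] to the following fraction. *)
Definition moebius (C E : fieldType) (k : C -> E) (M : 'M[C]_2) (t : E) : E :=
  (k (M 0 1) + k (M 1 1) * t) / (k (M 0 0) + k (M 1 0) * t).

(** P is a form of degree d that [M] multiplies by [chi]; the condition is
    tested on points, so that products and powers are immediate. *)
Definition covariant (C : fieldType) (d : nat) (P : {poly C}) (M : 'M[C]_2)
    (chi : C) : Prop :=
  forall (E : fieldType) (k : {rmorphism C -> E}) (t : E),
    let j := k (M 0 0) + k (M 1 0) * t in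
    j != 0 -> (map_poly k P).[moebius k M t] * j ^+ d = k chi * (map_poly k P).[t].

Lemma covariantM (C : fieldType) d1 d2 (P1 P2 : {poly C}) M c1 c2 :
  covariant d1 P1 M c1 -> covariant d2 P2 M c2 ->
  covariant (d1 + d2) (P1 * P2) M (c1 * c2).
Proof.
move=> h1 h2 E k t j j0; rewrite !rmorphM !hornerM exprD.
by rewrite mulrACA h1 // h2 // mulrACA.
Qed.

Lemma covariantX (C : fieldType) d (P : {poly C}) M c n :
  covariant d P M c -> covariant (n * d) (P ^+ n) M (c ^+ n).
Proof.
move=> h; elim: n => [|n IH]; last by rewrite mulSn !exprS; exact: covariantM.
by move=> E k t j j0; rewrite mul0n !expr0 !rmorph1 !hornerE.
Qed.

Lemma covariantZ (C : fieldType) d (P : {poly C}) M c a :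
  covariant d P M c -> covariant d (a *: P) M c.
Proof.
by move=> h E k t j j0; rewrite map_polyZ !hornerZ -mulrA h // mulrCA.
Qed.

Lemma covariantN3 (C : fieldType) d (P Q R : {poly C}) M c : P + Q + R = 0 ->
  covariant d Q M c -> covariant d R M c -> covariant d P M c.
Proof.
move=> /eqP; rewrite -addrA addr_eq0 => /eqP -> hQ hR E k t j j0.
by rewrite rmorphN !hornerN rmorphD !hornerD mulNr mulrDl hQ // hR // -mulrDr mulrN.
Qed.

(** [F] stands for a formula in the ring operations, which commutes with the
    morphism of evaluation at [t]. *)
Lemma horner_map_rmorph (C E : fieldType) (k : {rmorphism C -> E}) (t : E)
    (F : forall R : comNzRingType, R -> R) :
  (forall (R S : comNzRingType) (h : {rmorphism R -> S}) x, h (F R x) = F S (h x)) ->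
  (map_poly k (F {poly C} 'X)).[t] = F E t.
Proof.
move=> Fh; have := Fh _ _ (horner_eval t \o map_poly k) 'X.
by rewrite /= /horner_eval map_polyX hornerX.
Qed.

Definition platonic_order (p : nat) : nat :=
  match p with 3 => 12 | 4 => 24 | _ => 60 end.

Section Homogenized.
Variables (E : fieldType).

(** The forms in two variables, restoring the denominator [j] of [t]. *)
Definition hom_Z (p : nat) (n j : E) : E :=
  match p with
  | 3 => n ^+ 4 + 8%:R * n * j ^+ 3
  | 4 => n ^+ 5 * j - n * j ^+ 5
  | _ => n ^+ 11 * j + 11%:R * n ^+ 6 * j ^+ 6 - n * j ^+ 11
  end.

Definition hom_Y (p : nat) (n j : E) : E :=
  match p with
  | 3 => n ^+ 3 * j - j ^+ 4
  | 4 => n ^+ 8 + 14%:R * n ^+ 4 * j ^+ 4 + j ^+ 8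
  | _ => - n ^+ 20 + 228%:R * n ^+ 15 * j ^+ 5 - 494%:R * n ^+ 10 * j ^+ 10
         - 228%:R * n ^+ 5 * j ^+ 15 - j ^+ 20
  end.

Lemma hom_ZE p n j : platonic p -> j != 0 ->
  klein_Z p (n / j) * j ^+ (platonic_order p %/ p) = hom_Z p n j.
Proof. by rewrite /platonic !inE => /or3P[] /eqP -> /= j0; rewrite /divn /=; field. Qed.

Lemma hom_YE p n j : platonic p -> j != 0 ->
  klein_Y p (n / j) * j ^+ (platonic_order p %/ 3) = hom_Y p n j.
Proof. by rewrite /platonic !inE => /or3P[] /eqP -> /= j0; rewrite /divn /=; field. Qed.

End Homogenized.

(** The trace of a matrix of SL(2) whose image in PGL(2) is a rotation of
    order p is a root of this equation, for one choice of the sign. *)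
Definition trace_eq (R : nzRingType) (p : nat) (tau : R) : Prop :=
  match p with 3 => tau = 1 | 4 => tau ^+ 2 = 2%:R | _ => tau ^+ 2 = tau + 1 end.

Section Symmetries.
Variables (E : fieldType) (p : nat) (tau z t : E).
Hypothesis hp : platonic p.
Hypothesis ht : trace_eq p tau.
Hypothesis hz : z ^+ 2 = tau * z - 1.

(* The root z of the characteristic polynomial is an eigenvalue of the rotation
   of order p. *)
Lemma trace_root_exp : z ^+ p = -1.
Proof.
move: hp ht; rewrite /platonic !inE => /or3P[] /eqP -> /= e.
- by rewrite exprS hz e mul1r mulrBr mulr1 -expr2 hz e; ring.
- have e0 : tau * z = z ^+ 2 + 1 by rewrite hz; ring.
  have e1 : (z ^+ 2 + 1) ^+ 2 = 2%:R * z ^+ 2 by rewrite -e0 exprMn e.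
  by apply/eqP; rewrite -subr_eq0; apply/eqP; transitivity ((z ^+ 2 + 1) ^+ 2 - 2%:R * z ^+ 2); [ring|rewrite e1 subrr].
- have e0 : tau * z = z ^+ 2 + 1 by rewrite hz; ring.
  have e1 : (z ^+ 2 + 1) ^+ 2 = z * (z ^+ 2 + 1) + z ^+ 2.
    by rewrite -e0 exprMn e; ring.
  apply/eqP; rewrite -subr_eq0; apply/eqP.
  transitivity ((z + 1) * ((z ^+ 2 + 1) ^+ 2 - (z * (z ^+ 2 + 1) + z ^+ 2))); first by ring.
  by rewrite e1 subrr mulr0.
Qed.

Lemma hom_Z_rot : hom_Z p (- z ^+ p.-1 * t) z = (if p == 3 then z ^+ 2 else if p == 4 then -1 else 1) * klein_Z p t.
Proof.
have := trace_root_exp; move: hp; rewrite /platonic !inE => /or3P[] /eqP -> /= e.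
- by ring: e.
- by ring: e.
- by ring: e.
Qed.

Lemma hom_Y_rot : hom_Y p (- z ^+ p.-1 * t) z = (if p == 3 then z ^+ 4 else 1) * klein_Y p t.
Proof.
have := trace_root_exp; move: hp; rewrite /platonic !inE => /or3P[] /eqP -> /= e.
- by ring: e.
- by ring: e.
- by ring: e.
Qed.

(** The entries, up to scaling, of a half turn that permutes the zeros of
    Klein's forms and is not a power of the rotation about the origin. *)
Definition flip_l : E := if p == 5 then - tau else 1.
Definition flip_e : E := if p == 3 then 2%:R else 1.

Lemma hom_Z_flip : hom_Z p (flip_e + flip_l * t) (- flip_l + t)
  = (if p == 3 then 9%:R else if p == 4 then 8%:R else (tau + 2%:R) ^+ 6) * klein_Z p t.
Proof.
rewrite /flip_e /flip_l.
move: hp ht; rewrite /platonic !inE => /or3P[] /eqP -> /= e.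
- by ring.
- by ring.
- by ring: e.
Qed.

Lemma hom_Y_flip : hom_Y p (flip_e + flip_l * t) (- flip_l + t)
  = (if p == 3 then 9%:R else if p == 4 then 16%:R else (tau + 2%:R) ^+ 10) * klein_Y p t.
Proof.
rewrite /flip_e /flip_l.
move: hp ht; rewrite /platonic !inE => /or3P[] /eqP -> /= e.
- by ring.
- by ring.
- by ring: e.
Qed.

End Symmetries.

Section KleinPolynomials.
Variables (C : closedFieldType) (p : nat).
Hypothesis C0 : char0 C.
Hypothesis hp : platonic p.

Definition xi1 : {poly C} := klein_cX C p *: klein_X p 'X ^+ 2.
Definition xi2 : {poly C} := klein_cY C p *: klein_Y p 'X ^+ 3.
Definition xi3 : {poly C} := klein_cZ C p *: klein_Z p 'X ^+ p.

Let N := platonic_order p.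

Lemma xi_sum : xi1 + xi2 + xi3 = 0.
Proof.
rewrite /xi1 /xi2 /xi3 -!mul_polyC.
rewrite (rmorph_klein_cX polyC) (rmorph_klein_cY polyC) (rmorph_klein_cZ polyC).
exact: klein_syzygy.
Qed.

(** The rotation [t -> t / z^2] of order p, and a half turn. The half turn is
    normalized by [s] to have determinant 1; its product with the rotation has
    order 3. *)
Lemma klein_symmetries tau : trace_eq p tau ->
  exists a c : 'M[C]_2,
    [/\ \det a = 1, \det c = 1, \tr a = 0, \tr c = tau & \tr (a *m c) = -1] /\
    forall M, M = a \/ M = c -> exists2 chi, chi != 0 &
      [/\ covariant N xi1 M chi, covariant N xi2 M chi & covariant N xi3 M chi].
Proof.
move=> ht.
have [z hz] : exists z : C, z ^+ 2 = tau * z - 1.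
  have [|z ez] := solve_monicpoly (n := 2) (fun i => if i == 0%N then -1 else tau : C); first by [].
  by exists z; rewrite ez !big_ord_recl big_ord0 /= expr0 expr1; ring.
have zp : z ^+ p = -1 by exact: (trace_root_exp hp ht hz).
have z0 : z != 0.
  apply/eqP=> z0; move: hz => /eqP; rewrite z0 expr0n mulr0 sub0r /= eq_sym oppr_eq0.
  by rewrite oner_eq0.
set zi := tau - z.
have zzi : z * zi = 1 by rewrite /zi mulrBr -expr2 hz; ring.
have ezi : zi = - z ^+ p.-1.
  apply: (mulfI z0); rewrite zzi mulrN -exprS prednK ?zp ?opprK //.
  by move: hp; rewrite /platonic !inE => /or3P[] /eqP ->.
set l := flip_l p tau; set e := flip_e C p; set s := l * (z - zi).
have es : s ^+ 2 = if p == 3 then - 3%:R else if p == 4 then - 2%:R else - (tau + 2%:R).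
  have -> : s ^+ 2 = l ^+ 2 * (tau ^+ 2 - 4%:R).
    have -> : tau = z + zi by rewrite /zi addrC subrK.
    have -> : 4%:R = 4%:R * (z * zi) by rewrite zzi mulr1.
    by rewrite /s; ring.
  rewrite /l /flip_l; move: hp ht; rewrite /platonic !inE => /or3P[] /eqP -> /= h.
  - by rewrite h; ring.
  - by rewrite h; ring.
  - by ring: h.
have tau2 : p = 5 -> tau + 2%:R != 0.
  move=> p5; move: ht; rewrite p5 /= => h; apply/eqP=> h2.
  have : 5%:R = 0 :> C.
    transitivity (tau ^+ 2 - (tau + 1)); last by rewrite h subrr.
    have -> : tau = - 2%:R by apply/eqP; rewrite -addr_eq0 h2.
    by ring.
  by move/eqP; rewrite (negbTE (C0 4)).
have s0 : s != 0.
  have : s ^+ 2 != 0; last by rewrite expf_eq0.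
  rewrite es.
  move: hp; rewrite /platonic !inE => /or3P[] /eqP pE; rewrite pE /= oppr_eq0 ?(C0 2) ?(C0 1) //.
  exact: tau2.
have e_l : l ^+ 2 + e = - s ^+ 2.
  rewrite es /e /l /flip_l /flip_e.
  by move: hp ht; rewrite /platonic !inE => /or3P[] /eqP -> /= h; ring: h.
exists (mx2 (- l / s) (e / s) (1 / s) (l / s)), (mx2 z 0 0 zi); split.
  rewrite !det_mx2 !tr_mx2 !mul_mx2 !mx2E; split.
  - transitivity (- (l ^+ 2 + e) / s ^+ 2); first by field.
    by rewrite e_l opprK divff ?expf_neq0.
  - by rewrite zzi; ring.
  - by field.
  - by rewrite /zi addrC subrK.
  - transitivity (- (l * (z - zi)) / s); first by field.
    by rewrite -/s; field.
have covX M chi : covariant N xi2 M chi -> covariant N xi3 M chi ->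
    [/\ covariant N xi1 M chi, covariant N xi2 M chi & covariant N xi3 M chi].
  by move=> h2 h3; split=> //; apply: covariantN3 h2 h3; exact: xi_sum.
have cov M cy cz : cz ^+ p = cy ^+ 3 -> cy != 0 ->
    covariant (N %/ 3) (klein_Y p 'X) M cy -> covariant (N %/ p) (klein_Z p 'X) M cz ->
    exists2 chi, chi != 0 &
      [/\ covariant N xi1 M chi, covariant N xi2 M chi & covariant N xi3 M chi].
  move=> ezy cy0 hY hZ; exists (cy ^+ 3); first by rewrite expf_neq0.
  have N3 : N = (3 * (N %/ 3))%N.
    by rewrite /N; move: hp; rewrite /platonic !inE => /or3P[] /eqP ->.
  have Np : N = (p * (N %/ p))%N.
    by rewrite /N; move: hp; rewrite /platonic !inE => /or3P[] /eqP ->.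
  apply: covX; apply: covariantZ.
    by rewrite N3; exact: covariantX.
  by rewrite Np -ezy; exact: covariantX.
have kY (E : fieldType) (k : {rmorphism C -> E}) t :
    (map_poly k (klein_Y p 'X)).[t] = klein_Y p t.
  apply: (horner_map_rmorph k t (F := fun R => @klein_Y R p)) => R S h x.
  exact: rmorph_klein_Y.
have kZ (E : fieldType) (k : {rmorphism C -> E}) t :
    (map_poly k (klein_Z p 'X)).[t] = klein_Z p t.
  apply: (horner_map_rmorph k t (F := fun R => @klein_Z R p)) => R S h x.
  exact: rmorph_klein_Z.
have kt (E : fieldType) (k : {rmorphism C -> E}) : trace_eq p (k tau).
  move: hp ht; rewrite /platonic !inE => /or3P[] /eqP -> /= h.
  - by rewrite h rmorph1.
  - by rewrite -rmorphXn h rmorph_nat.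
  - by rewrite -rmorphXn h rmorphD rmorph1.
have kz (E : fieldType) (k : {rmorphism C -> E}) : k z ^+ 2 = k tau * k z - 1.
  by rewrite -rmorphXn hz rmorphB rmorphM rmorph1.
move=> M [] ->.
  pose a := mx2 (- l / s) (e / s) (1 / s) (l / s).
  have aE (E : fieldType) (k : {rmorphism C -> E}) t
      (j := k (a 0 0) + k (a 1 0) * t) : j != 0 ->
      [/\ - flip_l p (k tau) + t != 0, j = (- flip_l p (k tau) + t) / k s &
       moebius k a t = (flip_e E p + flip_l p (k tau) * t) / (- flip_l p (k tau) + t)].
    have kl : k l = flip_l p (k tau).
      by rewrite /l /flip_l; case: ifP => _; rewrite ?rmorphN ?rmorph1.
    have ke : k e = flip_e E p.
      by rewrite /e /flip_e; case: ifP => _; rewrite ?rmorph_nat ?rmorph1.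
    have ks0 : k s != 0 by rewrite fmorph_eq0.
    have ej : j = (- k l + t) / k s.
      rewrite /j /a !mx2E !fmorph_div rmorphN rmorph1; field.
      by [].
    move=> j0; rewrite -kl -ke; have j'0 : - k l + t != 0.
      by apply: contraNneq j0 => j'0; rewrite ej j'0 mul0r.
    split=> //; rewrite /moebius -/j ej /a !mx2E !fmorph_div; field.
    by rewrite j'0.
  have flipped d (P : {poly C}) (K : C) :
      (forall (E : fieldType) (k : {rmorphism C -> E}) t,
        - flip_l p (k tau) + t != 0 ->
        (map_poly k P).[(flip_e E p + flip_l p (k tau) * t) / (- flip_l p (k tau) + t)]
          * (- flip_l p (k tau) + t) ^+ d = k K * (map_poly k P).[t]) ->
      covariant d P a (K / s ^+ d).
    move=> h E k t j /aE[j'0 ej ->]; rewrite /j ej expr_div_n mulrA h //.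
    by rewrite fmorph_div rmorphXn mulrAC.
  have sX n : s ^+ (2 * n) = (if p == 3 then - 3%:R else if p == 4 then - 2%:R else - (tau + 2%:R)) ^+ n.
    by rewrite exprM es.
  apply: (cov _ ((if p == 3 then 9%:R else if p == 4 then 16%:R else (tau + 2%:R) ^+ 10) / s ^+ (N %/ 3))
     ((if p == 3 then 9%:R else if p == 4 then 8%:R else (tau + 2%:R) ^+ 6) / s ^+ (N %/ p))).
  - move: sX tau2; rewrite /N; move: hp; rewrite /platonic !inE => /or3P[] /eqP -> /= sX tau2.
    + by rewrite (sX 2).
    + rewrite -[(24 %/ 4)%N]/(2 * 3)%N -[(24 %/ 3)%N]/(2 * 4)%N !sX.
      have -> : (- 2%:R) ^+ 3 = - 8%:R :> C by ring.
      have -> : (- 2%:R) ^+ 4 = 16%:R :> C by ring.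
      by rewrite invrN mulrN !divff ?(C0 7) ?(C0 15) // expr1n; ring.
    + rewrite -[(60 %/ 5)%N]/(2 * 6)%N -[(60 %/ 3)%N]/(2 * 10)%N !sX.
      move: (tau2 erefl); move: (tau + 2%:R) => u u0.
      have -> : (- u) ^+ 6 = u ^+ 6 by ring.
      have -> : (- u) ^+ 10 = u ^+ 10 by ring.
      by rewrite !divff ?expf_neq0 // !expr1n.
  - rewrite mulf_neq0 ?invr_eq0 ?expf_neq0 //.
    move: tau2; move: hp; rewrite /platonic !inE => /or3P[] /eqP -> /= tau2.
    + exact: (C0 8).
    + exact: (C0 15).
    + by rewrite expf_neq0 ?tau2.
  - apply: flipped => E k t j0; rewrite !kY hom_YE // (hom_Y_flip t hp (kt E k)).
    congr (_ * _); case: ifP => _; first by rewrite rmorph_nat.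
    by case: ifP => _; rewrite ?rmorph_nat // rmorphXn rmorphD rmorph_nat.
  - apply: flipped => E k t j0; rewrite !kZ hom_ZE // (hom_Z_flip t hp (kt E k)).
    congr (_ * _); case: ifP => _; first by rewrite rmorph_nat.
    by case: ifP => _; rewrite ?rmorph_nat // rmorphXn rmorphD rmorph_nat.
apply: (cov _ (if p == 3 then z ^+ 4 else 1)
   (if p == 3 then z ^+ 2 else if p == 4 then -1 else 1)).
- move: hp zp; rewrite /platonic !inE => /or3P[] /eqP -> /= h.
  + by ring: h.
  + by ring.
  + by ring.
- by case: ifP; rewrite ?oner_neq0 // expf_neq0.
- move=> E k t j j0; rewrite !kY.
  have ej : j = k z by rewrite /j !mx2E rmorph0 mul0r addr0.
  have -> : moebius k (mx2 z 0 0 zi) t = (- k z ^+ p.-1 * t) / k z.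
    by rewrite /moebius -/j ej !mx2E rmorph0 add0r ezi rmorphN rmorphXn.
  rewrite ej hom_YE // -?ej // ej (hom_Y_rot t hp (kt E k) (kz E k)).
  by congr (_ * _); case: ifP => _; rewrite ?rmorphXn ?rmorph1.
- move=> E k t j j0; rewrite !kZ.
  have ej : j = k z by rewrite /j !mx2E rmorph0 mul0r addr0.
  have -> : moebius k (mx2 z 0 0 zi) t = (- k z ^+ p.-1 * t) / k z.
    by rewrite /moebius -/j ej !mx2E rmorph0 add0r ezi rmorphN rmorphXn.
  rewrite ej hom_ZE // -?ej // ej (hom_Z_rot t hp (kt E k) (kz E k)).
  congr (_ * _); case: ifP => _; first by rewrite rmorphXn.
  by case: ifP => _; rewrite ?rmorphN ?rmorph1.
Qed.

End KleinPolynomials.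

Section Sizes.
Variable R : comNzRingType.
Lemma size_leD n (P Q : {poly R}) :
  (size P <= n)%N -> (size Q <= n)%N -> (size (P + Q)%R <= n)%N.
Proof. by move=> hP hQ; rewrite (leq_trans (size_polyD _ _)) // geq_max hP. Qed.
Lemma size_leN n (P : {poly R}) : (size P <= n)%N -> (size (- P)%R <= n)%N.
Proof. by rewrite size_polyN. Qed.
Lemma size_leXn n k : (k < n)%N -> (size ('X^k : {poly R}) <= n)%N.
Proof. by rewrite size_polyXn. Qed.
Lemma size_leX n : (1 < n)%N -> (size ('X : {poly R}) <= n)%N.
Proof. by rewrite size_polyX. Qed.
Lemma size_leMn n k (P : {poly R}) : (size P <= n)%N -> (size (k%:R * P)%R <= n)%N.
Proof. by move=> hP; rewrite -polyC_natr mul_polyC (leq_trans (size_scale_leq _ _)). Qed.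
Lemma size_le_nat n k : (0 < n)%N -> (size (k%:R : {poly R}) <= n)%N.
Proof.
by move=> n0; rewrite -polyC_natr (leq_trans (size_polyC_leq1 _)).
Qed.
Lemma coef_monic_split n (P : {poly R}) :
  (size P <= n)%N -> ('X^n + P)`_n = 1.
Proof. by move=> hP; rewrite coefD coefXn eqxx nth_default // addr0. Qed.
End Sizes.

Section KleinPolynomials2.
Variables (C : closedFieldType) (p : nat).
Hypothesis C0 : char0 C.
Hypothesis hp : platonic p.

Let N := platonic_order p.
Let X := klein_X p ('X : {poly C}).
Let Y := klein_Y p ('X : {poly C}).
Let Z := klein_Z p ('X : {poly C}).

(** The degrees are those of the orbits; the bounds are not always attained,
    since a zero may lie at infinity. *)
Lemma size_klein :
  [/\ (size X <= (N %/ 2).+1)%N, (size Y <= (N %/ 3).+1)%N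
    & (size Z <= (N %/ p).+1)%N].
Proof.
rewrite /N /X /Y /Z; move: hp; rewrite /platonic !inE => /or3P[] /eqP -> /=;
rewrite -?mulrA; split; do ?[by [] | apply: size_leD | apply: size_leN | apply: size_leMn
  | apply: size_leXn | apply: size_leX | apply: (@size_le_nat C _ 1)
  | apply: size_le_nat].
Qed.

Lemma coef_klein_X : X`_(N %/ 2) = 1.
Proof.
rewrite /N /X; move: hp; rewrite /platonic !inE => /or3P[] /eqP -> /=;
rewrite -?mulrA -!addrA; apply: coef_monic_split;
do ?[by [] | apply: size_leD | apply: size_leN | apply: size_leMn
  | apply: size_leXn | apply: size_leX | apply: (@size_le_nat C _ 1)
  | apply: size_le_nat].
Qed.

Lemma klein_neq0 : [/\ X != 0, Y != 0 & Z != 0].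
Proof.
have X0 : X != 0.
  by apply/eqP=> h; move: coef_klein_X => /eqP; rewrite h coef0 eq_sym oner_eq0.
have hor (F : forall R : comNzRingType, R -> R) (c : C) :
  (forall (R S : comNzRingType) (h : {rmorphism R -> S}) x, h (F R x) = F S (h x)) ->
  (F {poly C} 'X).[c] = F C c.
  move=> hF; have := horner_map_rmorph idfun c hF.
  by rewrite map_poly_id.
have Y0 : Y != 0.
  have : Y.[0] != 0.
    rewrite (hor (fun R => @klein_Y R p) 0 (fun R S h x => rmorph_klein_Y h p x)).
    move: hp; rewrite /platonic !inE => /or3P[] /eqP -> /=;
    by rewrite !expr0n /= ?mulr0 ?oppr0 ?(subr0, addr0, sub0r, add0r) ?oppr_eq0 oner_eq0.
  by apply: contraNneq => ->; rewrite horner0.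
split=> //; apply: contraTneq isT => Z0.
have := klein_jacobian (@deriv_derivation C) (derivX C) hp.
rewrite -/X -/Y -/Z Z0 mulr0 sub0r.
have -> : klein_Z' ('X : {poly C}) p = 0.
  by rewrite -(klein_Z'E (@deriv_derivation C) (derivX C) hp) -/Z Z0 deriv0.
rewrite mulr0 oppr0 => /esym /eqP.
have [_ cY0 _ k0] := klein_const_neq0 (p := p) C0 hp.
rewrite -(rmorph_klein_kappa (polyC : {rmorphism C -> {poly C}})).
rewrite -(rmorph_klein_cY (polyC : {rmorphism C -> {poly C}})).
by rewrite !mulf_eq0 !polyC_eq0 (negbTE k0) (negbTE cY0) (negbTE Y0).
Qed.

Lemma size_xi (P : {poly C}) :
  P \in [:: xi1 C p; xi2 C p; xi3 C p] -> (size P <= N.+1)%N.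
Proof.
have [sX sY sZ] := size_klein.
have sz (Q : {poly C}) (a : C) d n : (size Q <= d.+1)%N -> (d * n)%N = N ->
    (size (a *: Q ^+ n) <= N.+1)%N.
  move=> sQ e; rewrite (leq_trans (size_scale_leq _ _)) //.
  rewrite (leq_trans (size_poly_exp_leq _ _)) // ltnS -e leq_mul2r.
  by rewrite -ltnS -/(_ < _)%N; apply/orP; right; move: sQ; case: (size Q).
rewrite !inE => /or3P[] /eqP ->; apply: (sz _ _ _ _ _ _); try eassumption.
- by rewrite /N; move: hp; rewrite /platonic !inE => /or3P[] /eqP ->.
- by rewrite /N; move: hp; rewrite /platonic !inE => /or3P[] /eqP ->.
- by rewrite /N; move: hp; rewrite /platonic !inE => /or3P[] /eqP ->.
Qed.

Lemma coef_xi1 : (xi1 C p)`_N != 0.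
Proof.
have [sX _ _] := size_klein; have [cX0 _ _ _] := klein_const_neq0 (p := p) C0 hp.
have sX' : size X = (N %/ 2).+1.
  apply/eqP; rewrite eqn_leq sX /= ltnNge; apply/negP=> h.
  by move: coef_klein_X => /eqP; rewrite nth_default // eq_sym oner_eq0.
have mX : lead_coef X = 1 by rewrite lead_coefE sX' coef_klein_X.
have N2 : N = (N %/ 2 * 2)%N.
  by rewrite /N; move: hp; rewrite /platonic !inE => /or3P[] /eqP ->.
rewrite /xi1 coefZ mulf_neq0 // -/X.
have -> : (X ^+ 2)`_N = lead_coef (X ^+ 2) by rewrite lead_coefE size_exp sX' -N2.
by rewrite lead_coef_exp mX expr1n oner_neq0.
Qed.

Lemma klein_horner (c : C) :
  [/\ X.[c] = klein_X p c, Y.[c] = klein_Y p c & Z.[c] = klein_Z p c].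
Proof.
have hor (F : forall R : comNzRingType, R -> R) :
  (forall (R S : comNzRingType) (h : {rmorphism R -> S}) x, h (F R x) = F S (h x)) ->
  (F {poly C} 'X).[c] = F C c.
  move=> hF; have := horner_map_rmorph idfun c hF.
  by rewrite map_poly_id.
split; [apply: (hor (fun R => @klein_X R p)) | apply: (hor (fun R => @klein_Y R p))
       | apply: (hor (fun R => @klein_Z R p))] => R S h x.
- exact: rmorph_klein_X.
- exact: rmorph_klein_Y.
- exact: rmorph_klein_Z.
Qed.

Lemma xi_disjoint c : root (xi2 C p) c -> root (xi3 C p) c -> False.
Proof.
have [_ cY0 cZ0 _] := klein_const_neq0 (p := p) C0 hp.
rewrite !rootZ // !rootE !horner_exp !expf_eq0 => /andP[_ /eqP Y0] /andP[_ /eqP Z0].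
have [_ eY eZ] := klein_horner c; move: Y0 Z0; rewrite eY eZ => Y0 /eqP.
exact/negP/klein_YZ_disjoint.
Qed.

(** A root of X is simple, and is not a root of Y or Z, so its multiplicity in
    the right-hand side is odd. *)
Lemma klein_nonsquare (a : C) (s : ratfun C) : a != 0 ->
  s ^+ 2 <> (a *: (X * Y ^+ 2 * Z ^+ p.-1))%:F.
Proof.
move=> a0; have [X0 Y0 Z0] := klein_neq0.
have [cX0 cY0 cZ0 k0] := klein_const_neq0 (p := p) C0 hp.
have [c Xc] : exists c, root X c.
  apply/closed_rootP; apply/negP=> /eqP sX.
  have : X`_(N %/ 2) = 0.
    apply: nth_default; rewrite sX /N.
    by move: hp; rewrite /platonic !inE => /or3P[] /eqP ->.
  by rewrite coef_klein_X => /eqP; rewrite oner_eq0.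
have [eX eY eZ] := klein_horner c.
have Xc0 : klein_X p c = 0 by rewrite -eX; exact/rootP.
have Yc : ~~ root Y c.
  apply/negP=> /rootP Yc; have : klein_Z p c != 0 by apply: klein_YZ_disjoint; rewrite // -eY.
  have := klein_syzygy c hp; rewrite Xc0 -eY Yc !expr0n /= !mulr0 !add0r => /eqP.
  by rewrite mulf_eq0 expf_eq0 (negbTE cZ0) /= => /andP[_ ->].
have Zc : ~~ root Z c.
  apply/negP=> /rootP Zc; have := klein_syzygy c hp.
  rewrite Xc0 -eZ Zc [0 ^+ p]expr0n; have -> : (p == 0%N) = false.
    by move: hp; rewrite /platonic !inE => /or3P[] /eqP ->.
  rewrite expr0n /= !mulr0 add0r addr0 => /eqP.
  by rewrite mulf_eq0 expf_eq0 (negbTE cY0) /= => /eqP h; move: Yc; rewrite rootE eY h eqxx.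
have muX : mup c X = 1%N.
  apply/eqP; rewrite eqn_leq -XsubC_dvd // -root_factor_theorem Xc andbT.
  rewrite leqNgt; apply/negP; rewrite mup_geq // => /dvdpP[q eq].
  have X'c : X^`().[c] = 0.
    rewrite eq derivM (derX (@deriv_derivation C)) hornerD !hornerM horner_exp.
    by rewrite hornerXsubC subrr expr0n /= !(mulr0, mul0r) addr0.
  have := congr1 (fun P => P.[c]) (klein_jacobian (@deriv_derivation C) (derivX C) hp).
  rewrite -/X -/Y -/Z !(hornerD, hornerN, hornerM) X'c eX Xc0 !(mulr0, mul0r) oppr0 addr0.
  rewrite -(rmorph_klein_kappa (polyC : {rmorphism C -> {poly C}})).
  rewrite -(rmorph_klein_cY (polyC : {rmorphism C -> {poly C}})) !hornerC.
  move/esym/eqP; rewrite !mulf_eq0 (negbTE cY0) (negbTE k0) /= orbb => Yc0.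
  by move: Yc; rewrite rootE Yc0.
have [u [v [v0 ->]]] := fracP s.
rewrite expr_div_n => e.
have {}e : u ^+ 2 = a *: (X * Y ^+ 2 * Z ^+ p.-1) * v ^+ 2.
  apply/eqP; rewrite -tofrac_eq tofracXn [X in _ == X]rmorphM /= (tofracXn 2 v) -e divfK //.
  by rewrite expf_neq0 // tofrac_eq0.
have u0 : u != 0.
  apply/eqP=> u0; move: e => /esym/eqP; rewrite u0 expr0n /= mulf_eq0 scaler_eq0 !mulf_eq0.
  by rewrite (negbTE a0) (negbTE X0) (negbTE Y0) expf_eq0 (negbTE Z0) (negbTE v0) !andbF.
set K := a%:P * Y ^+ 2 * Z ^+ p.-1.
have {}e : u * u = X * (K * (v * v)) by rewrite -expr2 e -mul_polyC /K; ring.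
have Kc : ~~ root K c.
  rewrite /K rootE !hornerM hornerC !mulf_eq0 (negbTE a0) /= orbb horner_exp expf_eq0.
  by rewrite -!rootE (negbTE Yc) (negbTE Zc) andbF.
have K0 : K != 0 by apply: contraNneq Kc => ->; rewrite root0.
have := congr1 (fun P => odd (mup c P)) e.
have W0 : K * (v * v) != 0 by apply: mulf_neq0 => //; exact: mulf_neq0.
rewrite /= (mupM c u0 u0) (mupM c X0 W0) muX.
by rewrite (mupMr _ Kc) (mupM c v0 v0) !addnn oddD !odd_double.
Qed.

End KleinPolynomials2.

(** * Schwarz maps for every arrangement of the indices *)

(** All that the sequel uses of Klein's forms, in a shape that is stable under
    permutations of the three indices. The fields [sd_lead] and [sd_disjoint]
    say that the three forms have no common zero, at infinity and elsewhere. The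
    condition [sd_nonsquare] says that the derivative of the Schwarz map is not
    a square, so that [w] is not a rational function of [t]. *)
Record schwarz_data (C : closedFieldType) (N : nat) (tq : C -> Prop)
    (m n k : nat) (P1 P2 P3 : {poly C}) (r : ratfun C) : Prop := SchwarzData {
  sd_triple : schwarz_triple (@rderiv C) m n k P1%:F P2%:F P3%:F r;
  sd_nonsquare : forall s, s ^+ 2 <> r * P1%:F * P2%:F * P3%:F
                        /\ s ^+ 2 <> - (r * P1%:F * P2%:F * P3%:F);
  sd_sum : P1 + P2 + P3 = 0;
  sd_size : [/\ (size P1 <= N.+1)%N, (size P2 <= N.+1)%N & (size P3 <= N.+1)%N];
  sd_lead : ~ [/\ P1`_N = 0, P2`_N = 0 & P3`_N = 0];
  sd_disjoint : forall c, ~ [/\ root P1 c, root P2 c & root P3 c];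
  sd_symmetries : forall tau, tq tau -> exists a c : 'M[C]_2,
    [/\ \det a = 1, \det c = 1, \tr a = 0, \tr c = tau & \tr (a *m c) = -1] /\
    forall M, M = a \/ M = c -> exists2 chi, chi != 0 &
      [/\ covariant N P1 M chi, covariant N P2 M chi & covariant N P3 M chi] }.

Section Permutations.
Variables (C : closedFieldType) (N : nat) (tq : C -> Prop).
Hypothesis C0 : char0 C.

(* Exchanging two forms changes the sign of the Wronskians, hence of [r]. *)
Lemma schwarz_data_swap m n k P1 P2 P3 r :
  schwarz_data N tq m n k P1 P2 P3 r -> schwarz_data N tq n m k P2 P1 P3 (- r).
Proof.
case=> tr sq sm [s1 s2 s3] ld dj sy; split=> //.
- exact: (schwarz_triple_swap (@rderiv_derivation C) tr).
- move=> s; have -> : - r * P2%:F * P1%:F * P3%:F = - (r * P1%:F * P2%:F * P3%:F) by ring.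
  by rewrite opprK; have [] := sq s.
- by rewrite (addrC P2).
- by case=> h1 h2 h3; apply: ld.
- by move=> c [h1 h2 h3]; apply: (dj c).
- move=> tau /sy[a [c [h hM]]]; exists a, c; split=> // M /hM[chi c0 [h1 h2 h3]].
  by exists chi.
Qed.

Lemma schwarz_data_rot m n k P1 P2 P3 r :
  schwarz_data N tq m n k P1 P2 P3 r -> schwarz_data N tq n k m P2 P3 P1 r.
Proof.
case=> tr sq sm [s1 s2 s3] ld dj sy; split=> //.
- apply: schwarz_triple_rot => //; first exact: rderiv_derivation.
  exact: ratfun_char0.
- move=> s; have -> : r * P2%:F * P3%:F * P1%:F = r * P1%:F * P2%:F * P3%:F by ring.
  exact: sq.
- by rewrite addrC addrA.
- by case=> h1 h2 h3; apply: ld.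
- by move=> c [h1 h2 h3]; apply: (dj c).
- move=> tau /sy[a [c [h hM]]]; exists a, c; split=> // M /hM[chi c0 [h1 h2 h3]].
  by exists chi.
Qed.

End Permutations.

Lemma klein_schwarz_data (C : closedFieldType) p : char0 C -> platonic p ->
  exists P1 P2 P3 r,
    schwarz_data (C := C) (platonic_order p) (trace_eq p) 2 3 p P1 P2 P3 r.
Proof.
move=> C0 hp.
set X := klein_X p (rvar C); set Y := klein_Y p (rvar C); set Z := klein_Z p (rvar C).
have tofX : (klein_X p ('X : {poly C}))%:F = X.
  exact: (rmorph_klein_X (@FracField.tofrac {poly C})).
have tofY : (klein_Y p ('X : {poly C}))%:F = Y.
  exact: (rmorph_klein_Y (@FracField.tofrac {poly C})).
have tofZ : (klein_Z p ('X : {poly C}))%:F = Z.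
  exact: (rmorph_klein_Z (@FracField.tofrac {poly C})).
pose K := klein_kappa C p; pose r := rconst K / (X * Y * Z).
exists (xi1 C p), (xi2 C p), (xi3 C p), r.
have [X0 Y0 Z0] := klein_neq0 C0 hp.
have X0' : X != 0 by rewrite -tofX tofrac_eq0.
have Y0' : Y != 0 by rewrite -tofY tofrac_eq0.
have Z0' : Z != 0 by rewrite -tofZ tofrac_eq0.
have [cX0 cY0 cZ0 k0] := klein_const_neq0 (p := p) C0 hp.
have eP (c : C) (P : {poly C}) : (c *: P)%:F = rconst c * P%:F.
  by rewrite -mul_polyC tofracM.
have e1 : (xi1 C p)%:F = klein_cX _ p * X ^+ 2.
  by rewrite eP tofracXn tofX (rmorph_klein_cX (@rconst C)).
have e2 : (xi2 C p)%:F = klein_cY _ p * Y ^+ 3.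
  by rewrite eP tofracXn tofY (rmorph_klein_cY (@rconst C)).
have e3 : (xi3 C p)%:F = klein_cZ _ p * Z ^+ p.
  by rewrite eP tofracXn tofZ (rmorph_klein_cZ (@rconst C)).
have p0 : (0 < p)%N by move: hp; rewrite /platonic !inE => /or3P[] /eqP ->.
have dD := @rderiv_derivation C; have Dx := rderiv_var C.
have E0 := ratfun_char0 C0.
have prod : r * (xi1 C p)%:F * (xi2 C p)%:F * (xi3 C p)%:F =
  ((K * klein_cX C p * klein_cY C p * klein_cZ C p) *:
    (klein_X p 'X * klein_Y p 'X ^+ 2 * klein_Z p 'X ^+ p.-1))%:F.
  have aux (F : fieldType) (k a b c x y z : F) (q : nat) : (0 < q)%N -> x != 0 -> y != 0 -> z != 0 ->
     k / (x * y * z) * (a * x ^+ 2) * (b * y ^+ 3) * (c * z ^+ q) =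
     k * a * b * c * (x * y ^+ 2 * z ^+ q.-1).
    by case: q => // q _ x0 y0 z0; rewrite (exprS z) /=; field; rewrite x0 y0 z0.
  rewrite e1 e2 e3 /r (aux _ _ _ _ _ _ _ _ _ p0 X0' Y0' Z0') eP; congr (_ * _).
    rewrite -(rmorph_klein_cX (@rconst C)) -(rmorph_klein_cY (@rconst C)).
    by rewrite -(rmorph_klein_cZ (@rconst C)) -!rmorphM.
  by rewrite -tofX -tofY -tofZ -!tofracXn -!tofracM.
have a0 : K * klein_cX C p * klein_cY C p * klein_cZ C p != 0.
  by rewrite !mulf_neq0.
split.
- rewrite e1 e2 e3 /r /K (rmorph_klein_kappa (@rconst C)).
  have [d1 d2 d3 d4] := der_klein_const p dD.
  have Z'E := klein_Z'E dD Dx hp; have jac := klein_jacobian dD Dx hp.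
  have hes := klein_hessian dD Dx hp; have syz := klein_syzygy (rvar C) hp.
  exact: (schwarz_triple_forms dD E0 p0 (And3 X0' Y0' Z0')
    (klein_const_neq0 E0 hp) (And4 d1 d2 d3 d4) Z'E syz jac hes (klein_eta_kappa _ hp)).
- move=> s; rewrite prod; split; first exact: klein_nonsquare.
  rewrite -tofracN -scaleNr; apply: klein_nonsquare => //.
  by rewrite oppr_eq0.
- exact: xi_sum.
- by split; apply: size_xi => //; rewrite !inE eqxx ?orbT.
- by case=> /eqP; rewrite (negbTE (coef_xi1 C0 hp)).
- by move=> c [_ h2 h3]; exact: (xi_disjoint C0 hp h2 h3).
- exact: klein_symmetries.
Qed.

Lemma perm_schwarz_data (C : closedFieldType) p m n k : char0 C -> platonic p ->
  perm_eq [:: m; n; k] [:: 2; 3; p]%N ->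
  exists P1 P2 P3 r,
    schwarz_data (C := C) (platonic_order p) (trace_eq p) m n k P1 P2 P3 r.
Proof.
move=> C0 hp hperm.
pose T m n k := exists P1 P2 P3 r,
  schwarz_data (C := C) (platonic_order p) (trace_eq p) m n k P1 P2 P3 r.
have rot m' n' k' : T m' n' k' -> T n' k' m'.
  by case=> P1 [P2 [P3 [r h]]]; exists P2, P3, P1, r; exact: schwarz_data_rot.
have swap m' n' k' : T m' n' k' -> T n' m' k'.
  by case=> P1 [P2 [P3 [r h]]]; exists P2, P1, P3, (- r); exact: schwarz_data_swap.
have t1 : T 2 3 p by exact: klein_schwarz_data.
have t2 := rot _ _ _ t1; have t3 := rot _ _ _ t2.
have t4 := swap _ _ _ t1; have t5 := swap _ _ _ t2; have t6 := swap _ _ _ t3.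
move: hperm; rewrite -mem_permutations -/(T m n k).
move: hp t1 t2 t3 t4 t5 t6; rewrite /platonic !inE => /or3P[] /eqP -> t1 t2 t3 t4 t5 t6;
rewrite /permutations /= !inE; do ?case/orP; by case/eqP=> -> -> ->.
Qed.

(** * Generators of the three rotation groups *)

Section Words.
Variables (gT : finGroupType) (a b : gT).
Local Open Scope group_scope.

Definition word (s : seq bool) : gT :=
  foldr (fun (c : bool) g => (if c then a else b) * g) 1 s.

Lemma word_in (A : {group gT}) s : a \in A -> b \in A -> word s \in A.
Proof.
move=> aA bA; elim: s => [|c s IH] /=; first exact: group1.
by rewrite groupM //; case: c.
Qed.

End Words.

Section PermWords.
Variable n : nat.
Local Notation sT := {perm 'I_n.+1}.

(* The permutation is computed on tables of values, since permutations do not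
   compute. *)
Definition table_word (la lb : seq nat) (s : seq bool) : seq nat :=
  [seq foldl (fun j (c : bool) => nth 0 (if c then la else lb) j) i s | i <- iota 0 n.+1]%N.

Lemma perm_of_table (la : seq nat) :
  size la = n.+1 -> uniq la -> all (fun i => i < n.+1)%N la ->
  exists s : sT, forall i, val (s i) = nth 0%N la i.
Proof.
move=> sz un al; pose f (i : 'I_n.+1) : 'I_n.+1 := inord (nth 0%N la i).
have fE i : val (f i) = nth 0%N la i.
  by rewrite /f /= inordK //; apply: (allP al); rewrite mem_nth // sz.
have fI : injective f.
  move=> i j /(congr1 val)/eqP; rewrite !fE nth_uniq ?sz // => /eqP.
  exact: val_inj.
by exists (perm fI) => i; rewrite permE.
Qed.

Variables (la lb : seq nat) (a b : sT).
Hypotheses (ha : forall i, val (a i) = nth 0%N la i)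
           (hb : forall i, val (b i) = nth 0%N lb i).

Lemma word_table s i :
  val (word a b s i) = nth 0%N (table_word la lb s) (val i).
Proof.
rewrite /table_word (nth_map 0%N) ?size_iota ?ltn_ord // nth_iota ?ltn_ord // add0n.
elim: s i => [|c s IH] i /=; first by rewrite perm1.
by rewrite permM IH; case: c; rewrite ?ha ?hb.
Qed.

Lemma word_eq1 s : (word a b s == 1%g) = (table_word la lb s == iota 0 n.+1).
Proof.
apply/eqP/eqP=> [h|h].
  apply: (@eq_from_nth _ 0%N); rewrite ?size_map ?size_iota // => i hi.
  by rewrite -(word_table s (Ordinal hi)) h perm1 nth_iota.
by apply/permP=> i; apply: val_inj; rewrite word_table h perm1 nth_iota ?ltn_ord.
Qed.

(* One step of the enumeration of a group by words in the generators: words of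
   the same value as an earlier word are dropped. *)
Definition grow (ws : seq (seq bool)) : seq (seq bool) :=
  foldl (fun acc w => if table_word la lb w \in map (table_word la lb) acc then acc
                      else rcons acc w)
    [::] (ws ++ map (cons true) ws ++ map (cons false) ws).

Definition all_words (d : nat) : seq (seq bool) := iter d grow [:: [::]].

Lemma words_cover (A : {group sT}) (d : nat) :
  a \in A -> b \in A -> uniq (map (table_word la lb) (all_words d)) ->
  size (all_words d) = #|A| -> forall g, g \in A -> exists s, g = word a b s.
Proof.
move=> aA bA un sz g gA; pose ws := map (word a b) (all_words d).
have uws : uniq ws.
  have : uniq (map (fun g : sT => map (fun i => val (g i)) (enum 'I_n.+1)) ws).
    rewrite -map_comp; congr uniq: un; apply: eq_map => s /=.
    have sz1 : size (table_word la lb s) = n.+1 by rewrite size_map size_iota.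
    apply: (@eq_from_nth _ 0%N); rewrite sz1; first by rewrite [RHS]size_map size_enum_ord.
    move=> i hi; have e : val (nth ord0 (enum 'I_n.+1) i) = i := nth_enum_ord ord0 hi.
    by rewrite (nth_map ord0) ?size_enum_ord // word_table e.
  exact: map_uniq.
have sub : {subset ws <= A} by move=> _ /mapP[s _ ->]; exact: word_in.
have : g \in ws.
  have := uniq_min_size (s1 := ws) (s2 := enum A) uws.
  case.
  - by move=> x /sub; rewrite mem_enum.
  - by rewrite size_map sz cardE.
  - by move=> _ ->; rewrite mem_enum.
by case/mapP=> s _ ->; exists s.
Qed.

End PermWords.

(** Generators of a group with the presentation of a (2, 3, p) triangle
    group; [N] is the order of the group. *)
Record triangle_generators (gT : finGroupType) (A : {group gT}) (p N : nat)
    (a b : gT) : Prop := TriangleGenerators {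
  tg_in : a \in A /\ b \in A;
  tg_neq1 : [/\ a != 1, b != 1 & a * b != 1]%g;
  tg_pow : [/\ a ^+ 2 = 1, b ^+ 3 = 1 & (a * b) ^+ p = 1]%g;
  tg_pow4 : p = 4 -> ((a * b) ^+ 2 != 1)%g;
  tg_gen : forall g, g \in A -> exists s, g = word a b s;
  tg_card : #|A| = N }.

Section Generators.
Local Open Scope group_scope.

Lemma triangle_from_table n (A : {group {perm 'I_n.+1}}) p N d (la lb : seq nat)
    (a b : {perm 'I_n.+1}) :
  (forall i, val (a i) = nth 0%N la i) -> (forall i, val (b i) = nth 0%N lb i) ->
  a \in A -> b \in A ->
  let T s := table_word n la lb s == iota 0 n.+1 in
  [&& ~~ T [:: true], ~~ T [:: false], ~~ T [:: true; false],
      T [:: true; true], T [:: false; false; false],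
      T (flatten (nseq p [:: true; false]))
    & (p == 4) ==> ~~ T [:: true; false; true; false]] ->
  uniq (map (table_word n la lb) (all_words n la lb d)) ->
  #|A| = N -> size (all_words n la lb d) = N ->
  triangle_generators A p N a b.
Proof.
move=> ha hb aA bA T; rewrite /T -!(word_eq1 ha hb) /= !mulg1.
case/and5P=> h1 h2 h3 /eqP h4 /and3P[/eqP h5 /eqP h6 h7] un cA sz; split=> //.
- split; [by rewrite expgS expg1 | by rewrite !expgS expg0 mulg1 |].
  rewrite -[RHS]h6; elim: (p) => [|q IH] /=; first by rewrite expg0.
  by rewrite expgS IH mulgA.
- by move=> p4; move: h7; rewrite p4 /= mulgA expgS expg1 -mulgA.
- by apply: (words_cover ha hb aA bA un); rewrite sz cA.
Qed.

(* Puts the generator of order 3 in the alternating group. *)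
Lemma odd_perm_cube (T : finType) (s : {perm T}) : s ^+ 3 = 1 -> ~~ odd_perm s.
Proof.
by move/(congr1 (@odd_perm T)); rewrite !expgS expg0 mulg1 !odd_permM odd_perm1; case: (odd_perm s).
Qed.

Lemma alt4_generators : exists a b,
  triangle_generators 'Alt_('I_4)%G 3 12 a b.
Proof.
have [a ha] := @perm_of_table 3 [:: 1; 0; 3; 2]%N erefl erefl erefl.
have [b hb] := @perm_of_table 3 [:: 1; 2; 0; 3]%N erefl erefl erefl.
have [c hc] := @perm_of_table 3 [:: 2; 3; 1; 0]%N erefl erefl erefl.
have cA : #|'Alt_('I_4)%G| = 12.
  by apply/eqP; rewrite -(eqn_pmul2l (m := 2)) // card_Alt ?card_ord.
have aA : a \in 'Alt_('I_4)%G.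
  have -> : a = c * c.
    apply/permP=> i; apply: val_inj; rewrite permM ha !hc.
    by case: i => [[|[|[|[|i]]]] hi].
  by rewrite Alt_even odd_permM addbb.
have bA : b \in 'Alt_('I_4)%G.
  rewrite Alt_even; apply: odd_perm_cube; have /eqP : word b b [:: true; true; true] == 1.
    by rewrite (word_eq1 hb hb).
  by rewrite /= !expgS expg0 mulg1.
exists a, b; apply: (@triangle_from_table 3 _ 3 _ 12 _ _ a b ha hb aA bA) => //;
by rewrite ?inE //; vm_compute.
Qed.

Lemma sym4_generators : exists a b,
  triangle_generators 'Sym_('I_4)%G 4 24 a b.
Proof.
have [a ha] := @perm_of_table 3 [:: 1; 0; 2; 3]%N erefl erefl erefl.
have [b hb] := @perm_of_table 3 [:: 0; 2; 3; 1]%N erefl erefl erefl.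
have cA : #|'Sym_('I_4)%G| = 24 by rewrite card_Sym card_ord.
exists a, b; apply: (@triangle_from_table 3 _ 4 _ 12 _ _ a b ha hb) => //;
by rewrite ?inE //; vm_compute.
Qed.

Lemma alt5_generators : exists a b,
  triangle_generators 'Alt_('I_5)%G 5 60 a b.
Proof.
have [a ha] := @perm_of_table 4 [:: 1; 0; 3; 2; 4]%N erefl erefl erefl.
have [b hb] := @perm_of_table 4 [:: 2; 1; 4; 3; 0]%N erefl erefl erefl.
have [c hc] := @perm_of_table 4 [:: 2; 3; 1; 0; 4]%N erefl erefl erefl.
have cA : #|'Alt_('I_5)%G| = 60.
  by apply/eqP; rewrite -(eqn_pmul2l (m := 2)) // card_Alt ?card_ord.
have aA : a \in 'Alt_('I_5)%G.
  have -> : a = c * c.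
    apply/permP=> i; apply: val_inj; rewrite permM ha !hc.
    by case: i => [[|[|[|[|[|i]]]]] hi].
  by rewrite Alt_even odd_permM addbb.
have bA : b \in 'Alt_('I_5)%G.
  rewrite Alt_even; apply: odd_perm_cube; have /eqP : word b b [:: true; true; true] == 1.
    by rewrite (word_eq1 hb hb).
  by rewrite /= !expgS expg0 mulg1.
exists a, b; apply: (@triangle_from_table 4 _ 5 _ 14 _ _ a b ha hb aA bA) => //;
by rewrite ?inE //; vm_compute.
Qed.

End Generators.

(** * Platonic subgroups of SL(2) *)

Section SL2.
Variable C : fieldType.
Hypothesis C0 : char0 C.
Local Notation M2 := 'M[C]_2.

Lemma mx2_cayley_hamilton (M : M2) : M *m M = \tr M *: M - (\det M)%:M.
Proof.
apply: eq_mx2; rewrite mul_mx2 det_mx2 tr_mx2 !mxE /=; ring.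
Qed.

Lemma det_scalar2 (c : C) : \det (c%:M : M2) = c ^+ 2.
Proof. exact: det_scalar. Qed.

Lemma detN2 (M : M2) : \det (- M) = \det M.
Proof. by rewrite -scaleN1r detZ sqrrN expr1n mul1r. Qed.

Lemma scalar_mx2N (c : C) : ((- c)%:M : M2) = - c%:M.
Proof. exact: raddfN. Qed.
Lemma scalar_mx2D (c d : C) : ((c + d)%:M : M2) = c%:M + d%:M.
Proof. exact: raddfD. Qed.
Lemma scalar_mx2B (c d : C) : ((c - d)%:M : M2) = c%:M - d%:M.
Proof. exact: raddfB. Qed.

Lemma scalar_mx20 : (0%:M : M2) = 0.
Proof. exact: raddf0. Qed.

Lemma scalar_mx2_eq (c d : C) : (c%:M : M2) = d%:M -> c = d.
Proof. by move/matrixP/(_ 0 0); rewrite !mxE. Qed.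

Lemma scalar_of_comb (u v : C) (M : M2) :
  u != 0 -> u *: M = v%:M -> M = (v / u)%:M.
Proof.
move=> u0 e; rewrite -[M]scale1r -(mulVf u0) -scalerA e scale_scalar_mx.
by rewrite mulrC.
Qed.

Lemma det1_scalar (c : C) : \det (c%:M : M2) = 1 -> (c%:M : M2) = 1%:M \/ (c%:M : M2) = - 1%:M.
Proof.
rewrite det_scalar2 => /eqP; rewrite sqrf_eq1 => /orP[] /eqP ->; first by left.
by right; rewrite -scalar_mx2N.
Qed.

(** The only involution of SL(2) is -1. Hence -1 is carried to itself by every
    isomorphism between subgroups of SL(2) that contain it. *)
Lemma mx2_involution (M : M2) : \det M = 1 -> M *m M = 1%:M -> M = 1%:M \/ M = - 1%:M.
Proof.
move=> dM; rewrite mx2_cayley_hamilton dM => /eqP; rewrite subr_eq => /eqP e.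
have e2 : \tr M *: M = 2%:R%:M by rewrite e -scalar_mx2D.
have t0 : \tr M != 0.
  apply/eqP=> t0; move: e2; rewrite t0 scale0r -scalar_mx20.
  by move/scalar_mx2_eq/esym/eqP; rewrite (negbTE (C0 1)).
have eM := scalar_of_comb t0 e2; rewrite eM in dM *.
exact: det1_scalar.
Qed.

Section Cover.
Variables (gT : finGroupType) (A : {group gT}) (G : set M2).

(** What is used of an isomorphism between G and the preimage of A: a
    surjective morphism from G to A with kernel {1, -1}. *)
Record cover_map (f : M2 -> gT) : Prop := CoverMap {
  cm_in : forall M, G M -> f M \in A;
  cm_mul : forall M N, G M -> G N -> f (M *m N) = (f M * f N)%g;
  cm_surj : forall g, g \in A -> exists2 M, G M & f M = g;
  cm_ker : forall M, G M -> f M = 1%g -> M = 1%:M \/ M = - 1%:M;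
  cm_N1 : G (- 1%:M) /\ f (- 1%:M) = 1%g }.

Lemma proj_eq_sym (M N : M2) : proj_eq M N -> proj_eq N M.
Proof.
case=> c c0 ->; exists c^-1; first by rewrite invr_eq0.
by rewrite scalerA mulVf // scale1r.
Qed.

Lemma proj_eq_trans (M N P : M2) : proj_eq M N -> proj_eq N P -> proj_eq M P.
Proof.
case=> c c0 -> [d d0 ->]; exists (c * d); first by rewrite mulf_neq0.
by rewrite scalerA.
Qed.

Lemma proj_eqM (M N P Q : M2) :
  proj_eq M N -> proj_eq P Q -> proj_eq (M *m P) (N *m Q).
Proof.
case=> c c0 -> [d d0 ->]; exists (c * d); first by rewrite mulf_neq0.
by rewrite -scalemxAl -scalemxAr scalerA.
Qed.

Hypothesis sqrtC : forall c : C, exists s, s ^+ 2 = c.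

(** Every class of PGL(2) is represented in SL(2) since the base field has
    square roots. *)
Lemma cover_map_exists : SL2_subgroup G -> isog_SL2_cover A G ->
  exists f, cover_map f.
Proof.
move=> [G1 GM GV Gdet] [r [rU rM rI] [h hbij hM]].
set H := SL2_preimage A r in hbij.
have r_inj g1 g2 : g1 \in A -> g2 \in A -> proj_eq (r g1) (r g2) -> g1 = g2.
  move=> g1A g2A e; have xA : (g1 * g2^-1)%g \in A by rewrite groupM ?groupV.
  suff : (g1 * g2^-1)%g = 1%g by move/eqP; rewrite -eq_mulgV1 => /eqP.
  apply: rI => //; have := rM _ _ xA g2A; rewrite mulgKV => e2.
  have [c c0 e3] : proj_eq (r (g1 * g2^-1)%g *m r g2) (r g2).
    exact: proj_eq_trans (proj_eq_sym e2) e.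
  exists c => //; rewrite -[LHS]mulmx1 -(mulmxV (rU _ g2A)) mulmxA e3.
  by rewrite -scalemxAl mulmxV ?rU // .
have r1 : proj_eq (r 1%g) 1%:M.
  have := rM _ _ (group1 A) (group1 A); rewrite mulg1 => -[c c0 e].
  apply: proj_eq_sym; exists c => //.
  rewrite -(mulmxV (rU _ (group1 A))) [X in X *m _]e -scalemxAl -mulmxA mulmxV ?rU ?group1 //.
  by rewrite mulmx1.
have [q qP] : exists q : M2 -> gT, forall M, H M -> q M \in A /\ proj_eq M (r (q M)).
  have /choice[q qP] : forall M, exists g, H M -> g \in A /\ proj_eq M (r g).
    move=> M; have [[_ [g gA e]]|nH] := pselect (H M); last by exists 1%g.
    by exists g.
  by exists q.
have [hfun hinj hsurj] := hbij.
have q_eq M g : H M -> g \in A -> proj_eq M (r g) -> q M = g.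
  move=> HM gA e; have [qA qe] := qP _ HM; apply: r_inj => //.
  exact: proj_eq_trans (proj_eq_sym qe) e.
have HhM M : G M -> H (h M) by move=> GM'; apply: hfun.
have h1 : h 1%:M = 1%:M.
  have e := hM _ _ G1 G1; rewrite mulmx1 in e.
  have [d1 _] := HhM _ G1.
  have u : h 1%:M \in unitmx by rewrite unitmxE d1 unitr1.
  by rewrite -[LHS]mulmx1 -[X in _ *m X](mulmxV u) mulmxA -e mulmxV.
have HN1 : H (- 1%:M).
  split; first by rewrite detN2 det1.
  exists 1%g; first exact: group1.
  apply: proj_eq_trans (proj_eq_sym r1); exists (-1); first by rewrite oppr_eq0 oner_neq0.
  by rewrite scaleN1r.
have hinj' M N : G M -> G N -> h M = h N -> M = N.
  by move=> gM gN; apply: hinj; rewrite inE.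
have [GN1 hN1] : G (- 1%:M) /\ h (- 1%:M) = - 1%:M.
  have [M GM' eM] := hsurj _ HN1.
  have M2 : M *m M = 1%:M.
    apply: hinj' => //; first exact: GM.
    by rewrite hM // eM h1 mulNmx mulmxN opprK mulmx1.
  have [eM1|eM1] := mx2_involution (Gdet _ GM') M2; last by split; [rewrite -eM1|rewrite -{1}eM1].
  move: eM; rewrite eM1 h1 -scalar_mx2N => /scalar_mx2_eq /eqP.
  by rewrite -subr_eq0 opprK -[1 + 1]/(2%:R) (negbTE (C0 1)).
exists (fun M => q (h M)); split.
- by move=> M /HhM /qP[].
- move=> M N gM gN; rewrite hM //.
  have [qM eM] := qP _ (HhM _ gM); have [qN eN] := qP _ (HhM _ gN).
  apply: q_eq; rewrite ?groupM //.
    by rewrite -hM //; apply/HhM/GM.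
  apply: proj_eq_trans (proj_eq_sym (rM _ _ qM qN)); exact: proj_eqM.
- move=> g gA; have [s es] := sqrtC (\det (r g)).
  have d0 : \det (r g) != 0 by rewrite -unitfE -unitmxE rU.
  have s0 : s != 0 by apply: contraNneq d0 => s0; rewrite -es s0 expr0n.
  pose X := s^-1 *: r g.
  have HX : H X.
    split; first by rewrite detZ -es exprVn mulVf // expf_neq0.
    by exists g => //; exists s^-1 => //; rewrite invr_eq0.
  have [M GM' eM] := hsurj _ HX; exists M => //; rewrite eM.
  by apply: q_eq => //; exists s^-1; rewrite ?invr_eq0.
- move=> M gM; have [_ e] := qP _ (HhM _ gM) => q1; rewrite q1 in e.
  have [c c0 ec] := proj_eq_trans e r1.
  have [d1 _] := HhM _ gM.
  move: ec; rewrite scalemx1 => ec; rewrite ec in d1.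
  have [e1|e1] := det1_scalar d1.
    by left; apply: hinj' => //; rewrite ec e1 h1.
  by right; apply: hinj' => //; rewrite ec e1 hN1.
- split=> //; rewrite hN1; apply: q_eq => //.
  apply: proj_eq_trans (proj_eq_sym r1); exists (-1); rewrite ?oppr_eq0 ?oner_neq0 //.
  by rewrite scaleN1r.
Qed.

Section Lifts.
Variable f : M2 -> gT.
Hypothesis GS : SL2_subgroup G.
Hypothesis fP : cover_map f.

Let Gdet : forall M, G M -> \det M = 1. Proof. by case: GS. Qed.
Let GM : forall M N, G M -> G N -> G (M *m N). Proof. by case: GS. Qed.

Lemma cover_1 : f 1%:M = 1%g.
Proof.
have [G1 _ _ _] := GS; have := cm_mul fP G1 G1; rewrite mulmx1 => e.
by apply: (mulgI (f 1%:M)); rewrite mulg1 -e.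
Qed.

Lemma cover_opp M : G M -> G (- M) /\ f (- M) = f M.
Proof.
move=> gM; have [gN fN] := cm_N1 fP.
have -> : - M = - 1%:M *m M by rewrite mulNmx mul1mx.
by split; [exact: GM | rewrite (cm_mul fP) // fN mul1g].
Qed.

Lemma cover_eq M N : G M -> G N -> f M = f N -> M = N \/ M = - N.
Proof.
move=> gM gN e; have [G1 _ GV _] := GS.
have uN : N \in unitmx by rewrite unitmxE (Gdet gN) unitr1.
have gV : G (invmx N) by exact: GV.
have k : f (M *m invmx N) = 1%g.
  by rewrite (cm_mul fP) // e -(cm_mul fP) // mulmxV // cover_1.
have [h|h] := cm_ker fP (GM gM gV) k; [left|right].
  by rewrite -[M]mulmx1 -(mulVmx uN) mulmxA h mul1mx.
by rewrite -[M]mulmx1 -(mulVmx uN) mulmxA h mulNmx mul1mx.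
Qed.

Lemma cover_scalar M c : G M -> M = c%:M -> f M = 1%g.
Proof.
move=> gM e; have := Gdet gM; rewrite e => /det1_scalar[] ->; first exact: cover_1.
by case: (cm_N1 fP).
Qed.

Lemma cover_comb M u v : G M -> f M != 1%g -> u *: M = v%:M -> u = 0.
Proof.
move=> gM fM e; apply/eqP; apply: contraNT fM => u0.
by apply/eqP/(cover_scalar gM)/(scalar_of_comb u0 e).
Qed.

Definition mxpow (M : M2) (n : nat) : M2 := iter n (mulmx M) 1%:M.

Lemma mxpow_in M n : G M -> G (mxpow M n).
Proof. by move=> gM; elim: n => [|n IH]; [case: GS|exact: GM]. Qed.

Lemma cover_mxpow M n : G M -> f (mxpow M n) = (f M ^+ n)%g.
Proof.
move=> gM; elim: n => [|n IH]; first by rewrite expg0 cover_1.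
by rewrite expgS -IH -(cm_mul fP) //; exact: mxpow_in.
Qed.

(** By Cayley-Hamilton; the coefficients are Chebyshev polynomials of the
    trace. *)
Lemma mxpow_cheb M n : \det M = 1 -> (n <= 5)%N ->
  exists v, mxpow M n = (nth 0 [:: 0; 1; \tr M; \tr M ^+ 2 - 1; \tr M ^+ 3 - 2%:R * \tr M;
    \tr M ^+ 4 - 3%:R * \tr M ^+ 2 + 1] n) *: M + v%:M.
Proof.
move=> dM.
have step u v : M *m (u *: M + v%:M) = (\tr M * u + v) *: M + (- u)%:M.
  rewrite mulmxDr -scalemxAr mx2_cayley_hamilton dM scalerBr scalerA mul_mx_scalar.
  by rewrite scalerDl scalemx1 scalar_mx2N (mulrC u) addrAC.
have h0 : mxpow M 0 = 0 *: M + 1%:M by rewrite scale0r add0r.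
have h1 : mxpow M 1 = (\tr M * 0 + 1) *: M + (- 0)%:M by rewrite -step -h0.
have h2 := step (\tr M * 0 + 1) (- 0); rewrite -h1 in h2.
have h3 := step (\tr M * (\tr M * 0 + 1) + - 0) (- (\tr M * 0 + 1)); rewrite -h2 in h3.
have h4 := step (\tr M * (\tr M * (\tr M * 0 + 1) + - 0) + - (\tr M * 0 + 1)) (- (\tr M * (\tr M * 0 + 1) + - 0)); rewrite -h3 in h4.
have h5 := step (\tr M * (\tr M * (\tr M * (\tr M * 0 + 1) + - 0) + - (\tr M * 0 + 1)) + - (\tr M * (\tr M * 0 + 1) + - 0)) (- (\tr M * (\tr M * (\tr M * 0 + 1) + - 0) + - (\tr M * 0 + 1))); rewrite -h4 in h5.
case: n => [|[|[|[|[|[|n]]]]]] //= _.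
- by exists 1.
- by exists 0; rewrite [LHS]h1; congr (_ *: M + _%:M); ring.
- by eexists; rewrite [LHS]h2; congr (_ *: M + _); ring.
- by eexists; rewrite [LHS]h3; congr (_ *: M + _); ring.
- by eexists; rewrite [LHS]h4; congr (_ *: M + _); ring.
- by eexists; rewrite [LHS]h5; congr (_ *: M + _); ring.
Qed.

(** A relation [g ^ n = 1] in the quotient becomes an equation for the trace of
    a lift. *)
Lemma cover_trace_pow M n : G M -> (n <= 5)%N -> f M != 1%g -> (f M ^+ n = 1)%g ->
  (nth 0 [:: 0; 1; \tr M; \tr M ^+ 2 - 1; \tr M ^+ 3 - 2%:R * \tr M;
    \tr M ^+ 4 - 3%:R * \tr M ^+ 2 + 1] n) = 0.
Proof.
move=> gM n5 fM; rewrite -cover_mxpow // => /(cm_ker fP (mxpow_in n gM)) h.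
have [v e] := mxpow_cheb (Gdet gM) n5.
have [c ec] : exists c, mxpow M n = c%:M.
  by case: h => ->; [exists 1|exists (-1); rewrite scalar_mx2N].
apply: (cover_comb gM fM (v := c - v)); apply/eqP.
by rewrite scalar_mx2B -ec e addrK.
Qed.

(** The lifts are defined up to sign; the signs are chosen to obtain trace 1 for
    the generator of order 3 and a root of the given equation for the
    product. *)
Lemma cover_generators p N a b : platonic p -> triangle_generators A p N a b ->
  exists MA MB tau,
    [/\ G MA, G MB, f MA = a & f MB = b] /\
    [/\ trace_eq p tau, \tr MA = 0, \tr MB = 1 & \tr (MA *m MB) = tau].
Proof.
move=> hp [[aA bA] [a1 b1 ab1] [ea eb eab] e4 _ _].
have [M1 g1 f1] := cm_surj fP aA; have [M2' g2 f2] := cm_surj fP bA.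
have t1 : \tr M1 = 0.
  by apply: (cover_trace_pow (n := 2) g1); rewrite // f1.
have [MB [gB fB tB]] : exists MB, [/\ G MB, f MB = b & \tr MB = 1].
  have : \tr M2' ^+ 2 - 1 = 0 by apply: (cover_trace_pow (n := 3) g2); rewrite // f2.
  move/eqP; rewrite subr_eq0 sqrf_eq1 => /orP[] /eqP tM; first by exists M2'.
  have [gN fN] := cover_opp g2; exists (- M2'); split=> //; first by rewrite fN.
  by rewrite raddfN /= tM opprK.
set tau := \tr (M1 *m MB).
have gab : G (M1 *m MB) by exact: GM.
have fab : f (M1 *m MB) = (a * b)%g by rewrite (cm_mul fP) // f1 fB.
have p5 : (p <= 5)%N by move: hp; rewrite /platonic !inE => /or3P[] /eqP ->.
have := cover_trace_pow gab p5; rewrite fab -/tau => /(_ ab1 eab) et.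
have [ht|ht] : trace_eq p tau \/ trace_eq p (- tau).
  move: hp et e4; rewrite /platonic !inE => /or3P[] /eqP -> /= et e4.
  - move/eqP: et; rewrite subr_eq0 sqrf_eq1 => /orP[] /eqP ->; first by left.
    by right; rewrite opprK.
  - left; have : tau * (tau ^+ 2 - 2%:R) = 0 by rewrite -et; ring.
    move/eqP; rewrite mulf_eq0 subr_eq0 => /orP[/eqP t0|/eqP //].
    have : (f (M1 *m MB) ^+ 2 = 1)%g.
      rewrite -cover_mxpow //= /mxpow /= mulmx1 mx2_cayley_hamilton -/tau t0 scale0r sub0r.
      by rewrite (Gdet gab); case: (cm_N1 fP).
    by rewrite fab => h; move: (e4 erefl); rewrite h eqxx.
  - have : (tau ^+ 2 - (tau + 1)) * (tau ^+ 2 - (- tau + 1)) = 0 by rewrite -et; ring.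
    move/eqP; rewrite mulf_eq0 !subr_eq0 => /orP[] /eqP h; first by left.
    by right; rewrite sqrrN.
  by exists M1, MB, tau.
have [gN fN] := cover_opp g1; exists (- M1), MB, (- tau); split; first by rewrite fN.
by split=> //; rewrite ?mulNmx raddfN /= ?t1 ?oppr0.
Qed.

End Lifts.
End Cover.
End SL2.

Section TracePairs.
Variable C : fieldType.
Local Notation M2 := 'M[C]_2.

(** Fricke's polynomial: it is the trace of the commutator increased by 2, and
    it takes the value 4 exactly on reducible pairs. *)
Definition fricke (s r t : C) : C := s ^+ 2 + r ^+ 2 + t ^+ 2 - s * r * t.

Lemma common_eigenvector (a b : M2) (e : 'rV[C]_2) (alpha beta : C) :
  \det a = 1 -> \det b = 1 -> e != 0 -> e *m a = alpha *: e -> e *m b = beta *: e ->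
  fricke (\tr a) (\tr b) (\tr (a *m b)) = 4%:R.
Proof.
move=> da db e0 ea eb.
have root2 (M : M2) (c : C) : \det M = 1 -> e *m M = c *: e -> c ^+ 2 + 1 = \tr M * c.
  move=> dM eM; have : (c ^+ 2 + 1 - \tr M * c) *: e = 0.
    have := congr1 (mulmx e) (mx2_cayley_hamilton M).
    rewrite dM mulmxBr mulmx1 mulmxA eM -scalemxAl eM -scalemxAr eM !scalerA => h.
    rewrite scalerBl scalerDl scale1r -[X in _ - X]scalerA -eM.
    rewrite eM scalerA expr2 h; apply/eqP; rewrite subr_eq0 subrK //.
  by move/eqP; rewrite scaler_eq0 (negbTE e0) orbF subr_eq0 => /eqP.
have eab : e *m (a *m b) = (alpha * beta) *: e.
  by rewrite mulmxA ea -scalemxAl eb scalerA.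
have dab : \det (a *m b) = 1 by rewrite det_mulmx da db mulr1.
have ha := root2 _ _ da ea; have hb := root2 _ _ db eb; have hab := root2 _ _ dab eab.
have nz c (s : C) : c ^+ 2 + 1 = s * c -> c != 0.
  by move=> h; apply/eqP=> c0; move: h => /eqP; rewrite c0 expr0n mulr0 add0r oner_eq0.
have a0 := nz _ _ ha; have b0 := nz _ _ hb.
have es : \tr a = (alpha ^+ 2 + 1) / alpha by rewrite ha mulfK.
have er : \tr b = (beta ^+ 2 + 1) / beta by rewrite hb mulfK.
have et : \tr (a *m b) = ((alpha * beta) ^+ 2 + 1) / (alpha * beta).
  by rewrite hab mulfK // mulf_neq0.
by rewrite /fricke es er et; field; rewrite a0 b0.
Qed.

(** In the basis [(e, e a)], for an eigenvector [e] of [b], both matrices are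
    determined by the traces and the eigenvalue. *)
Lemma trace_normal_form (a b : M2) (l : C) (s := \tr a) (r := \tr b)
    (t := \tr (a *m b)) :
  \det a = 1 -> \det b = 1 -> l ^+ 2 + 1 = r * l -> fricke s r t != 4%:R ->
  exists2 Q : M2, Q \in unitmx &
    Q *m a = mx2 0 1 (-1) s *m Q /\
    Q *m b = mx2 l 0 (t - s * (r - l)) (r - l) *m Q.
Proof.
move=> da db hl hf.
have /det0P[e e0] : \det (b - l%:M) == 0.
  have -> : \det (b - l%:M) = \det b - \tr b * l + l ^+ 2.
    by rewrite !det_mx2 tr_mx2 !mxE /=; ring.
  by rewrite db -/r -hl; apply/eqP; ring.
rewrite mulmxBr mul_mx_scalar => /eqP; rewrite subr_eq0 => /eqP eb.
pose Q : M2 := \matrix_(i, j) (if i == 0 then e 0 j else (e *m a) 0 j).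
have row0 : row 0 Q = e by apply/rowP=> j; rewrite !mxE.
have row1 : row 1 Q = e *m a by apply/rowP=> j; rewrite [LHS]mxE [LHS]mxE.
have row_eq (M N : M2) : row 0 M = row 0 N -> row 1 M = row 1 N -> M = N.
  move=> /rowP h0 /rowP h1; apply: eq_mx2.
  - by have := h0 0; rewrite !mxE.
  - by have := h0 1; rewrite !mxE.
  - by have := h1 0; rewrite !mxE.
  - by have := h1 1; rewrite !mxE.
have row_comb (M N : M2) i : row i (M *m N) = M i 0 *: row 0 N + M i 1 *: row 1 N.
  by apply/rowP=> j; rewrite [LHS]mxE mul_mx2 !mxE.
have uQ : Q \in unitmx.
  rewrite unitmxE unitfE; apply/negP=> /det0P[v v0 vQ].
  have : v 0 0 *: e + v 0 1 *: (e *m a) = 0.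
    by rewrite -row1 -{1}row0 -vQ; apply/rowP=> j; rewrite mul_mx2 !mxE.
  move=> h; have v1 : v 0 1 != 0.
    apply: contraNneq v0 => v1; move: h => /eqP; rewrite v1 scale0r addr0 scaler_eq0 (negbTE e0) orbF.
    move=> /eqP v00; apply/eqP/rowP=> j; rewrite mxE.
    by case: j => [[|[|j]] hj] //; [rewrite -[RHS]v00|rewrite -[RHS]v1]; congr (v _ _); apply: val_inj.
  have ea : e *m a = (- (v 0 0 / v 0 1)) *: e.
    apply: (scalerI v1); rewrite scalerA mulrN mulrC divfK // scaleNr.
    by apply/eqP; rewrite -addr_eq0 addrC h.
  by move: hf; rewrite /s /r /t (common_eigenvector da db e0 ea eb) eqxx.
exists Q => //.
have Qa : Q *m a = mx2 0 1 (-1) s *m Q.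
  apply: row_eq; rewrite [RHS]row_comb !mx2E row_mul row0 row1.
    by rewrite scale0r add0r scale1r.
  rewrite -mulmxA mx2_cayley_hamilton da mulmxBr mulmx1 -scalemxAr.
  by rewrite scaleN1r addrC.
split=> //; set B := Q *m b *m invmx Q.
have eB : Q *m b = B *m Q by rewrite /B mulmxKV.
have B0 : row 0 B = l *: row 0 (1%:M : M2).
  by rewrite /B -mulmxA row_mul row0 mulmxA eb -scalemxAl -row0 -row_mul mulmxV.
have B00 : B 0 0 = l by have /rowP/(_ 0) := B0; rewrite !mxE /= mulr1.
have B01 : B 0 1 = 0 by have /rowP/(_ 1) := B0; rewrite !mxE /= mulr0.
have trB : \tr B = r by rewrite /B mxtrace_mulC mulmxA mulVmx // mul1mx.
have trAB : \tr (mx2 0 1 (-1) s *m B) = t.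
  rewrite /B !mulmxA -Qa mxtrace_mulC !mulmxA mulVmx // mul1mx //.
rewrite eB; congr (_ *m _); clearbody B; move: trB trAB; rewrite !tr_mx2 !mul_mx2 !mx2E B00 B01 => h1 h2.
have B11 : B 1 1 = r - l by rewrite -h1 addrAC subrr add0r.
by apply: eq_mx2; rewrite !mx2E // -h2 B11; ring.
Qed.

Lemma trace_pair_conjugate (a b a' b' : M2) :
  (forall r : C, exists l, l ^+ 2 + 1 = r * l) ->
  \det a = 1 -> \det b = 1 -> \det a' = 1 -> \det b' = 1 ->
  \tr a' = \tr a -> \tr b' = \tr b -> \tr (a' *m b') = \tr (a *m b) ->
  fricke (\tr a) (\tr b) (\tr (a *m b)) != 4%:R ->
  exists2 P, P \in unitmx & P *m a = a' *m P /\ P *m b = b' *m P.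
Proof.
move=> ex da db da' db' ta tb tab hf; have [l hl] := ex (\tr b).
have [Q uQ [Qa Qb]] := trace_normal_form da db hl hf.
rewrite -ta -tb -tab in hl hf Qa Qb.
have [Q' uQ' [Qa' Qb']] := trace_normal_form da' db' hl hf.
exists (invmx Q' *m Q); first by rewrite unitmx_mul unitmx_inv uQ'.
have conj (X Y : M2) : Q' *m X = Y *m Q' -> X *m invmx Q' = invmx Q' *m Y.
  move=> e; have -> : X = invmx Q' *m Y *m Q' by rewrite -mulmxA -e mulKmx.
  by rewrite mulmxK.
by split; [rewrite -mulmxA Qa !mulmxA (conj _ _ Qa')|rewrite -mulmxA Qb !mulmxA (conj _ _ Qb')].
Qed.

End TracePairs.

(** * The equation z'' + q z = 1 has no rational solution *)

Section NoRationalSolution.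
Variable C : closedFieldType.
Hypothesis C0 : char0 C.

Lemma char0_inj (m n : nat) : m%:R = n%:R :> C -> m = n.
Proof.
wlog le_mn : m n / (m <= n)%N.
  by move=> H; case: (leqP m n) => [|/ltnW] h e; [apply: H|apply/esym/H].
move=> e; have : (n - m)%:R = 0 :> C by rewrite natrB // e subrr.
move/eqP; case e' : (n - m)%N => [|d]; last by rewrite (negbTE (C0 _)).
by move=> _; apply/eqP; rewrite eqn_leq le_mn -subn_eq0 e' eqxx.
Qed.

(** The exponents at a singular point are (1 + 1 / m) / 2 and (1 - 1 / m) / 2,
    which are not integers. *)
Lemma no_exponent (m i j : nat) : (1 < m)%N ->
  4%:R * ((i%:R - j%:R) * (i%:R - j%:R - 1)) + angle C m <> 0.
Proof.
move=> m1 h; have m0 : m%:R != 0 :> C by rewrite -(prednK (ltnW m1)); exact: C0.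
have m_dvd1 k l : (m * k)%:R = (m * l + 1)%:R :> C -> False.
  move/char0_inj => e; have : (m %| 1)%N.
    by rewrite -(dvdn_addr 1 (dvdn_mulr l (dvdnn m))) -e dvdn_mulr.
  by rewrite dvdn1 => /eqP m_1; rewrite m_1 in m1.
have : (m%:R * (2%:R * (i%:R - j%:R) - 1)) ^+ 2 = 1 :> C.
  transitivity (m%:R ^+ 2 * (4%:R * ((i%:R - j%:R) * (i%:R - j%:R - 1)) + angle C m) + 1).
    by rewrite /angle; field.
  by rewrite h mulr0 add0r.
move/eqP; rewrite sqrf_eq1 => /orP[] /eqP e.
  apply: (m_dvd1 (2 * i)%N (2 * j + 1)%N).
  by rewrite (natrD _ (m * _)) -[1%:R]e !(natrM, natrD); ring.
apply: (m_dvd1 (2 * j + 1)%N (2 * i)%N).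
have {}e : m%:R * (1 - 2%:R * (i%:R - j%:R)) = 1 :> C by rewrite -[RHS]opprK -e; ring.
by rewrite (natrD _ (m * _)) -[1%:R]e !(natrM, natrD); ring.
Qed.

Lemma polynomial_equation (K : fieldType) (x p p1 p2 q q1 q2 a b c : K) :
  q != 0 -> x != 0 -> x - 1 != 0 -> 4%:R != 0 :> K ->
  p2 / q - p1 * q1 / q ^+ 2 - ((p1 * q1 + p * q2) / q ^+ 2 - p * q1 * (2%:R * q * q1) / (q ^+ 2) ^+ 2)
  + 4%:R^-1 * (a / x ^+ 2 + b / (x * (x - 1)) + c / (x - 1) ^+ 2) * (p / q) = 1 ->
  4%:R * x ^+ 2 * (x - 1) ^+ 2 * (p2 * q ^+ 2 - 2%:R * p1 * q1 * q - p * q * q2 + 2%:R * p * q1 ^+ 2)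
  + (a * (x - 1) ^+ 2 + b * x * (x - 1) + c * x ^+ 2) * p * q ^+ 2
  = 4%:R * x ^+ 2 * (x - 1) ^+ 2 * q ^+ 3.
Proof.
move=> q0 x0 x1 f0 h; rewrite -[RHS]mulr1 -[X in _ = _ * X]h; field.
by rewrite q0 x0 x1 f0.
Qed.

Let wpoly (P Q : {poly C}) : {poly C} :=
  P^`()^`() * Q ^+ 2 - 2%:R * P^`() * Q^`() * Q - P * Q * Q^`()^`()
  + 2%:R * P * Q^`() ^+ 2.

Lemma deriv_XsubC_exp (c : C) i (p : {poly C}) (y := 'X - c%:P) :
  y * (y ^+ i * p)^`() = y ^+ i * (i%:R * p + y * p^`()) /\
  y ^+ 2 * (y ^+ i * p)^`()^`() =
    y ^+ i * (i%:R * (i%:R - 1) * p + 2%:R * i%:R * y * p^`() + y ^+ 2 * p^`()^`()).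
Proof.
have dy : y^`() = 1 by rewrite /y derivXsubC.
have key k (r : {poly C}) : y * (y ^+ k * r)^`() = y ^+ k * (k%:R * r + y * r^`()).
  rewrite derivM (derX (@deriv_derivation C)) dy; case: k => [|k] /=.
    by rewrite !expr0; ring.
  by rewrite exprS; ring.
split; first exact: key.
have := key i (i%:R * p + y * p^`()); rewrite -key derivM dy mul1r.
have -> : (i%:R * p + y * p^`())^`() = i%:R * p^`() + (p^`() + y * p^`()^`()).
  by rewrite derivD !derivM (der_nat (@deriv_derivation C)) dy; ring.
rewrite mulrDr key => e.
transitivity (y * (y * (y ^+ i * p)^`()^`())); first by ring.
by apply: (addrI (y ^+ i * (i%:R * p + y * p^`()))); rewrite e; ring.
Qed.

Lemma wronskian_scale (R : comNzRingType) (a b p p1 p2 r r1 r2 : R) :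
  a * p2 * (b * r) ^+ 2 - 2%:R * (a * p1) * (b * r1) * (b * r)
    - a * p * (b * r) * (b * r2) + 2%:R * (a * p) * (b * r1) ^+ 2
  = a * b * b * (p2 * r ^+ 2 - 2%:R * p1 * r1 * r - p * r * r2 + 2%:R * p * r1 ^+ 2).
Proof. by ring. Qed.

(** Leading terms at the point c: if z = P / Q has order i - j < 2 at c, then
    z'' + q z has a pole there, of order 2 - (i - j), unless i - j is an
    exponent. The polynomial T is what remains of the denominators
    at c. *)
Lemma local_exponent (c : C) (T g P Q : {poly C}) (i := mup c P) (j := mup c Q)
    (y := 'X - c%:P) :
  P != 0 -> Q != 0 -> T.[c] != 0 -> (i < j + 2)%N ->
  y ^+ 2 * T * wpoly P Q + g * P * Q ^+ 2 = y ^+ 2 * T * Q ^+ 3 ->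
  T.[c] * ((i%:R - j%:R) * (i%:R - j%:R - 1)) + g.[c] = 0.
Proof.
move=> P0 Q0 Tc ij.
have dec (R : {poly C}) : R != 0 -> exists2 r, r.[c] != 0 & R = y ^+ mup c R * r.
  move=> R0; have : y ^+ mup c R %| R by rewrite -mup_geq.
  case/dvdpP=> r er; exists r; last by rewrite mulrC.
  have r0 : r != 0 by apply: contraNneq R0 => r0; rewrite er r0 mul0r.
  apply/negP=> rc; have : y %| r by rewrite -root_factor_theorem rootE.
  case/dvdpP=> r' er'; have : y ^+ (mup c R).+1 %| R.
    by apply/dvdpP; exists r'; rewrite {1}er er' exprS mulrA.
  by rewrite -mup_geq // ltnn.
have [p pc eP] := dec _ P0; have [r rc eQ] := dec _ Q0.
rewrite -/i -/j in eP eQ => h.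
have y0 k : y ^+ k != 0 by rewrite expf_neq0 // polyXsubC_eq0.
have [dP ddP] := deriv_XsubC_exp c i p; have [dQ ddQ] := deriv_XsubC_exp c j r.
rewrite -/y -eP -?eQ in dP ddP dQ ddQ.
pose E := (i%:R * (i%:R - 1) * p + 2%:R * i%:R * y * p^`() + y ^+ 2 * p^`()^`()) * r ^+ 2
  - 2%:R * (i%:R * p + y * p^`()) * (j%:R * r + y * r^`()) * r
  - p * r * (j%:R * (j%:R - 1) * r + 2%:R * j%:R * y * r^`() + y ^+ 2 * r^`()^`())
  + 2%:R * p * (j%:R * r + y * r^`()) ^+ 2.
have eW : y ^+ 2 * wpoly P Q = y ^+ (i + j + j) * E.
  transitivity ((y ^+ 2 * P^`()^`()) * Q ^+ 2 - 2%:R * (y * P^`()) * (y * Q^`()) * Q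
     - P * Q * (y ^+ 2 * Q^`()^`()) + 2%:R * P * (y * Q^`()) ^+ 2).
    by rewrite /wpoly; move: P^`()^`() P^`() Q^`()^`() Q^`() (y) => *; ring.
  by rewrite ddP dP ddQ dQ eP eQ wronskian_scale /E !exprD.
have key : T * E + g * p * r ^+ 2 = T * y ^+ (j + 2 - i) * r ^+ 3.
  apply: (mulfI (y0 (i + j + j)%N)).
  transitivity (y ^+ 2 * T * wpoly P Q + g * P * Q ^+ 2).
    transitivity (T * (y ^+ 2 * wpoly P Q) + g * P * Q ^+ 2); last by ring.
    rewrite eW eP eQ !exprD; move: (E) (y ^+ i) (y ^+ j) => *; ring.
  rewrite h eQ; transitivity (T * r ^+ 3 * y ^+ (2 + (j + j + j))).
    by rewrite !exprD; move: (y ^+ j) (y ^+ 2) => *; ring.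
  have -> : (2 + (j + j + j) = (i + j + j) + (j + 2 - i))%N.
    by move: ij; move: (i) (j) => a b; lia.
  by rewrite exprD; move: (y ^+ (i + j + j)) (y ^+ (j + 2 - i)) => *; ring.
have yc : y.[c] = 0 by rewrite hornerXsubC subrr.
have hn n : (n%:R : {poly C}).[c] = n%:R by rewrite -polyC_natr hornerC.
have h1 : (1 : {poly C}).[c] = 1 by rewrite hornerC.
have Ec : E.[c] = (i%:R - j%:R) * (i%:R - j%:R - 1) * p.[c] * r.[c] ^+ 2.
  rewrite /E; move: p^`() p^`()^`() r^`() r^`()^`() => p1 p2 r1 r2.
  clearbody y; move: (i) (j) => a b.
  rewrite !(hornerD, hornerN, hornerM, horner_exp) !hn h1 yc; ring.
have := congr1 (fun f => f.[c]) key; clearbody E; clearbody y.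
rewrite /= !(hornerD, hornerM, horner_exp) yc Ec [0 ^+ (_ - _)]expr0n.
have -> : (j + 2 - i == 0)%N = false.
  by apply/negbTE; rewrite subn_eq0 -ltnNge.
rewrite mulr0 mul0r => e; apply: (mulIf (expf_neq0 2 rc)); apply: (mulIf pc).
by rewrite !mul0r -e; ring.
Qed.

(** At 0 and 1, a solution vanishes to order at least 2 since no integer is an
    exponent. It has no other poles, because the equation is regular elsewhere.
    So it is a polynomial of degree at least 4, and then the leading
    coefficient at infinity makes its degree an exponent there. *)
Lemma no_rational_solution (m n k : nat) (A B D : C) (z : ratfun C) :
  (1 < m)%N -> (1 < n)%N -> (1 < k)%N ->
  A = angle C m -> D = angle C n -> A + B + D = angle C k ->
  rderiv (rderiv z) + q_coef A B D * z <> 1.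
Proof.
move=> m1 n1 k1 eA eD eABD hz.
have [P [Q [mQ cPQ ez]]] := frac_coprime z.
have Q0 : Q != 0 by exact: monic_neq0.
have Q0' : Q%:F != 0 by rewrite tofrac_eq0.
have P0 : P != 0.
  apply/eqP=> P0; move: hz; rewrite ez P0 tofrac0 mul0r mulr0.
  have dr := @rderiv_derivation C.
  by rewrite !(der0 dr) addr0 => /esym/eqP; rewrite oner_eq0.
pose g : {poly C} := A%:P * ('X - 1) ^+ 2 + B%:P * 'X * ('X - 1) + D%:P * 'X ^+ 2.
have eqn : 4%:R * 'X ^+ 2 * ('X - 1) ^+ 2 * wpoly P Q + g * P * Q ^+ 2
    = 4%:R * 'X ^+ 2 * ('X - 1) ^+ 2 * Q ^+ 3.
  apply/eqP; rewrite -tofrac_eq; apply/eqP.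
  have dr := @rderiv_derivation C.
  have x0 : rvar C != 0 by rewrite tofrac_eq0 polyX_eq0.
  have x1 : rvar C - 1 != 0 by rewrite -tofrac1 -tofracB tofrac_eq0 -polyC1 polyXsubC_eq0.
  have := @polynomial_equation _ (rvar C) P%:F (P^`())%:F (P^`()^`())%:F
    Q%:F (Q^`())%:F (Q^`()^`())%:F (rconst A) (rconst B) (rconst D) Q0' x0 x1
    (ratfun_char0 C0 3).
  rewrite /wpoly /g /rvar /rconst.
  rewrite !(rmorph_nat (@FracField.tofrac {poly C}), tofracB, tofracD, tofracXn, tofracM, tofrac1).
  apply; rewrite -[RHS]hz ez /q_coef /rvar /rconst; congr (_ + _).
  rewrite (der_div dr P%:F Q%:F) !rderiv_poly (derB dr) (der_div dr (P^`())%:F Q%:F).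
  rewrite (der_div dr (P%:F * (Q^`())%:F) (Q%:F ^+ 2)) (derM dr) (derX dr) !rderiv_poly /=.
  by rewrite expr1.
have gc c : g.[c] = A * (c - 1) ^+ 2 + B * c * (c - 1) + D * c ^+ 2.
  by rewrite /g -polyC1 !(hornerD, hornerM, horner_exp, hornerN, hornerC, hornerX).
have nc k' (c : C) : (k'%:R : {poly C}).[c] = k'%:R by rewrite -polyC_natr hornerC.
have eg : g = (A + B + D)%:P * 'X ^+ 2 - (2%:R * A + B)%:P * 'X + A%:P.
  by rewrite /g !polyCD polyCM polyC_natr; ring.
clearbody g; move: eqn gc; set W := wpoly P Q => eqn gc.
have e0 : (mup 0 Q + 2 <= mup 0 P)%N.
  rewrite leqNgt; apply/negP=> lt0.
  have T0 : (4%:R * ('X - 1) ^+ 2 : {poly C}).[0] = 4%:R.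
    by rewrite hornerM horner_exp -[X in 'X - X]polyC1 hornerXsubC nc; ring.
  have T0n : (4%:R * ('X - 1) ^+ 2 : {poly C}).[0] != 0 by rewrite T0; exact: (C0 3).
  have := local_exponent (g := g) P0 Q0 T0n lt0.
  rewrite T0 gc => H; apply: (no_exponent (i := mup 0 P) (j := mup 0 Q) m1).
  rewrite -eA -[RHS]H; first by ring.
  rewrite polyC0 subr0 -/W; clearbody W.
  transitivity (4%:R * 'X ^+ 2 * ('X - 1) ^+ 2 * W + g * P * Q ^+ 2); first by ring.
  by rewrite eqn; ring.
have e1 : (mup 1 Q + 2 <= mup 1 P)%N.
  rewrite leqNgt; apply/negP=> lt0.
  have T0 : (4%:R * 'X ^+ 2 : {poly C}).[1] = 4%:R.
    by rewrite hornerM horner_exp hornerX nc; ring.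
  have T0n : (4%:R * 'X ^+ 2 : {poly C}).[1] != 0 by rewrite T0; exact: (C0 3).
  have := local_exponent (g := g) P0 Q0 T0n lt0.
  rewrite T0 gc => H; apply: (no_exponent (i := mup 1 P) (j := mup 1 Q) n1).
  rewrite -eD -[RHS]H; first by ring.
  rewrite polyC1 -/W; clearbody W.
  transitivity (4%:R * 'X ^+ 2 * ('X - 1) ^+ 2 * W + g * P * Q ^+ 2); first by ring.
  by rewrite eqn; ring.
have Qroot c : ~~ root Q c.
  apply/negP=> Qc; have nPc : ~~ root P c.
    apply/negP=> Pc; have : 'X - c%:P %| gcdp P Q.
      by rewrite dvdp_gcd -!root_factor_theorem Pc.
    move/dvdp_leq; rewrite gcdp_eq0 negb_and P0 => /(_ isT).
    by rewrite size_XsubC; move: cPQ; rewrite /coprimep => /eqP ->.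
  have iP : mup c P = 0%N by apply: mupNroot.
  have jQ : (0 < mup c Q)%N by rewrite -XsubC_dvd // -root_factor_theorem.
  have c0 : c != 0 by apply: contraTneq e0 => h; rewrite -h iP leqn0 addn2.
  have c1 : c - 1 != 0.
    by rewrite subr_eq0; apply: contraTneq e1 => h; rewrite -h iP leqn0 addn2.
  have Tn : (4%:R * 'X ^+ 2 * ('X - 1) ^+ 2 : {poly C}).[c] != 0.
    rewrite !(horner_exp, hornerM) hornerX -[X in 'X - X]polyC1 hornerXsubC nc.
    by rewrite !mulf_neq0 ?expf_neq0 //; exact: (C0 3).
  have lt0 : (mup c P < mup c Q + 2)%N by rewrite iP addn2.
  have := local_exponent (g := ('X - c%:P) ^+ 2 * g) P0 Q0 Tn lt0.
  have gn : (('X - c%:P) ^+ 2 * g).[c] = 0.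
    by rewrite hornerM horner_exp hornerXsubC subrr expr0n mul0r.
  rewrite -/W iP gn addr0 => H.
  have /eqP : (4%:R * 'X ^+ 2 * ('X - 1) ^+ 2 : {poly C}).[c]
     * ((0 - (mup c Q)%:R) * (0 - (mup c Q)%:R - 1)) = 0.
    apply: H; move: (('X - c%:P) ^+ 2) => y2.
    transitivity (y2 * (4%:R * 'X ^+ 2 * ('X - 1) ^+ 2 * W + g * P * Q ^+ 2)); first by ring.
    by rewrite eqn; ring.
  rewrite mulf_eq0 (negbTE Tn) /=.
  have -> : (0 - (mup c Q)%:R) * (0 - (mup c Q)%:R - 1) = (mup c Q * (mup c Q).+1)%:R :> C.
    by rewrite natrM -natr1; ring.
  by rewrite -[(_ * _)%N]prednK ?muln_gt0 ?jQ // (negbTE (C0 _)).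
have Q1 : Q = 1.
  have /eqP sQ : size Q == 1%N.
    by apply/negPn/negP=> /closed_rootP[c]; apply/negP/Qroot.
  have /size1_polyC eQ : (size Q <= 1)%N by rewrite sQ.
  by move: mQ; rewrite eQ monicE lead_coefC => /eqP ->.
have [d sP] : exists d, size P = d.+3.
  have : ('X - 0%:P) ^+ 2 %| P by rewrite -(mup_geq 0 2 P0) (leq_trans (leq_addl _ _) e0).
  by move/dvdp_leq => /(_ P0); rewrite size_exp_XsubC; case: (size P) => [|[|[|d]]] //; exists d.
have sP2 : (2 <= d)%N.
  have : ('X - 0%:P) ^+ 2 * ('X - 1%:P) ^+ 2 %| P.
    rewrite Gauss_dvdp; last first.
      by rewrite coprimep_expl // coprimep_expr // coprimep_XsubC rootE hornerXsubC subr_eq0 oner_eq0.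
    rewrite -(mup_geq 0 2 P0) -(mup_geq 1 2 P0) (leq_trans (leq_addl _ _) e0).
    exact: leq_trans (leq_addl _ _) e1.
  move/dvdp_leq => /(_ P0).
  by rewrite size_Mmonic ?monic_exp ?monicXsubC ?monic_neq0 ?monic_exp ?monicXsubC // !size_exp_XsubC sP.
have {}eqn : 4%:R *: ('X^4 * P^`()^`()) - 8%:R *: ('X^3 * P^`()^`())
    + 4%:R *: ('X^2 * P^`()^`()) + (A + B + D) *: ('X^2 * P)
    - (2%:R * A + B) *: ('X^1 * P) + A *: P
    = 4%:R *: 'X^4 - 8%:R *: 'X^3 + 4%:R *: 'X^2.
  rewrite -!mul_polyC !polyC_natr expr1; move: eqn; rewrite /W /wpoly eg Q1 !derivC.
  move: P^`()^`() P^`() (A + B + D)%:P (2%:R * A + B)%:P A%:P => P2 P1' a b c e.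
  transitivity (4%:R * 'X ^+ 2 * ('X - 1) ^+ 2 * 1 ^+ 3 : {poly C}); last by ring.
  by rewrite -e; ring.
have := congr1 (fun R : {poly C} => R`_(d + 4)) eqn.
rewrite /= !(coefD, coefN, coefZ) !coefXnM !coefXn !coef_deriv.
have -> : (d + 4 < 4)%N = false by lia.
have -> : (d + 4 < 3)%N = false by lia.
have -> : (d + 4 < 2)%N = false by lia.
have -> : (d + 4 < 1)%N = false by lia.
rewrite addnK.
have -> : (d + 4 - 3 = d.+1)%N by lia.
have -> : (d + 4 - 2 = d.+2)%N by lia.
have -> : (d + 4 - 1 = d.+3)%N by lia.
have -> : (d + 4 == 4)%N = false by lia.
have -> : (d + 4 == 3)%N = false by lia.
have -> : (d + 4 == 2)%N = false by lia.
rewrite /= ![P`_d.+3]nth_default ?sP // ![P`_d.+4]nth_default ?sP // [P`_(d + 4)]nth_default ?sP; last by lia.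
rewrite !(mul0rn, mulr0, subr0, addr0) eABD.
have l0 : P`_d.+2 != 0 by rewrite -[d.+2]/(d.+3.-1) -sP -lead_coefE lead_coef_eq0.
move=> h; apply: (no_exponent (i := d.+2) (j := 0) k1); apply: (mulfI l0).
have es : d.+2%:R = d%:R + 2%:R :> C by rewrite -addn2 natrD.
have es1 : d.+1%:R = d%:R + 1 :> C by rewrite -addn1 natrD.
rewrite mulr0 -[RHS]h.
have -> : P`_d.+2 *+ d.+2 *+ d.+1 = P`_d.+2 * d.+2%:R * d.+1%:R by rewrite !mulr_natr.
by rewrite es es1; ring.
Qed.

End NoRationalSolution.

(** * Solving the equation by a Schwarz map *)

Lemma derivation_scale (A : comNzRingType) (D : A -> A) (r : A) :
  derivation D -> derivation (fun a => r * D a).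
Proof. by move=> dD; split=> a b; rewrite ?(derD dD) ?(derM dD); ring. Qed.

Definition finite_span (F M : fieldType) (i : F -> M) : Prop :=
  exists (I : finType) (e : I -> M), forall u, exists c : I -> F,
    u = \sum_j i (c j) * e j.

Lemma finite_span_trans (F M L : fieldType) (i : {rmorphism F -> M})
    (h : {rmorphism M -> L}) :
  finite_span i -> finite_span h -> finite_span (h \o i).
Proof.
move=> [I [e eP]] [J [f fP]].
exists (I * J)%type, (fun p => h (e p.1) * f p.2) => u.
have [c ->] := fP u; have [d dP] := choice (fun j => eP (c j)).
exists (fun p => d p.2 p.1).
rewrite (eq_bigr (fun j => \sum_a h (i (d j a)) * (h (e a) * f j))) => [|j _]; last first.
  rewrite {1}dP rmorph_sum mulr_suml; apply: eq_bigr => a _.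
  by rewrite rmorphM mulrA.
by rewrite exchange_big pair_big.
Qed.

Definition ode_coef (E : fieldType) (a b c x : E) : E :=
  4%:R^-1 * (a / x ^+ 2 + b / (x * (x - 1)) + c / (x - 1) ^+ 2).

Lemma rmorph_ode_coef (E F : fieldType) (h : {rmorphism E -> F}) a b c x :
  h (ode_coef a b c x) = ode_coef (h a) (h b) (h c) (h x).
Proof.
by rewrite /ode_coef rmorphM fmorphV rmorph_nat !rmorphD !fmorph_div !rmorphXn rmorphM rmorphB rmorph1.
Qed.

Section SchwarzSolutions.
Variables (C : closedFieldType) (N : nat) (tq : C -> Prop) (m n k : nat).
Variables (P1 P2 P3 : {poly C}) (r : ratfun C) (A B D : C).
Hypothesis C0 : char0 C.
Hypothesis N_gt0 : (0 < N)%N.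
Hypothesis sd : schwarz_data N tq m n k P1 P2 P3 r.
Hypotheses (eA : A = angle C m) (eD : D = angle C n) (eABD : A + B + D = angle C k).

(** The Schwarz map, whose inverse function is a quotient of solutions. *)
Definition schwarz_fun : ratfun C := - (P1%:F / P3%:F).
Local Notation phi := schwarz_fun.
Local Notation psi := (rderiv schwarz_fun).

Lemma P3_neq0 : P3%:F != 0 :> ratfun C.
Proof. by have [_ [_ _ ? _] _ _ _] := sd_triple sd. Qed.

Lemma rmorph_angle (E F : fieldType) (h : {rmorphism E -> F}) d :
  h (angle E d) = angle F d.
Proof. by rewrite /angle rmorphB rmorph1 fmorphV rmorphXn rmorph_nat. Qed.

Lemma schwarz_fun_equation :
  [/\ phi != 0, phi - 1 != 0, psi != 0,
      psi * P3%:F ^+ 2 = - (r * P1%:F * P2%:F * P3%:F)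
    & rderiv (2%:R^-1 * dlog (@rderiv C) psi) - (2%:R^-1 * dlog (@rderiv C) psi) ^+ 2
      = - ode_coef (rconst A) (rconst B) (rconst D) phi * psi ^+ 2].
Proof.
have eA' : rconst A = angle (ratfun C) m by rewrite eA (rmorph_angle (@rconst C)).
have eD' : rconst D = angle (ratfun C) n by rewrite eD (rmorph_angle (@rconst C)).
have eABD' : rconst A + rconst B + rconst D = angle (ratfun C) k.
  by rewrite -!rmorphD eABD (rmorph_angle (@rconst C)).
exact: (schwarz_equation (@rderiv_derivation C) (ratfun_char0 C0) (sd_triple sd) eA' eD' eABD').
Qed.

Lemma psi_nonsquare s : s ^+ 2 <> psi.
Proof.
have [_ _ _ e _] := schwarz_fun_equation; move=> es.
have [_] := sd_nonsquare sd (s * P3%:F); apply.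
by rewrite exprMn es e.
Qed.

Lemma no_constant_root (E : fieldType) (kap : {rmorphism C -> E}) (d : E -> E) (x t : E) :
  derivation d -> (forall c, d (kap c) = 0) -> d x = 1 -> forall c, t = kap c ->
  (map_poly kap P1).[t] + x * (map_poly kap P3).[t] = 0 -> False.
Proof.
move=> dd dk dx c -> ; rewrite !horner_map /= => e.
have P3c : P3.[c] = 0.
  have := congr1 d e; rewrite (derD dd) (derM dd) !dk dx (der0 dd) mulr0 addr0 add0r mul1r.
  by move/eqP; rewrite fmorph_eq0 => /eqP.
move: e; rewrite P3c rmorph0 mulr0 addr0 => /eqP; rewrite fmorph_eq0 => /eqP P1c.
have P2c : P2.[c] = 0.
  have := congr1 (fun P => P.[c]) (sd_sum sd).
  by rewrite /= !hornerD P1c P3c horner0 add0r addr0.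
by apply: (sd_disjoint sd (c := c)); rewrite !rootE P1c P2c P3c !eqxx.
Qed.

(** The pair [(w, t w)] of solutions of the equation, where [t] is a solution
    of [phi t = x] and [w] is a square root of [dx / dt]. *)
Record schwarz_sol (E : fieldType) (d : E -> E) (kap : C -> E) (x t w : E) : Prop :=
  SchwarzSol {
    ss_neq0 : w != 0;
    ss_der : w ^+ 2 * d t = 1;
    ss_root : (map_poly kap P1).[t] + x * (map_poly kap P3).[t] = 0;
    ss_ode : d (d w) + ode_coef (kap A) (kap B) (kap D) x * w = 0 }.

Lemma root_eval (E : fieldType) (kap : {rmorphism C -> E}) (x t : E)
    (ev : {rmorphism ratfun C -> E}) :
  (forall P : {poly C}, ev P%:F = (map_poly kap P).[t]) ->
  (map_poly kap P1).[t] + x * (map_poly kap P3).[t] = 0 <-> ev phi = x.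
Proof.
move=> evP; have P30 := P3_neq0; rewrite -!evP /schwarz_fun rmorphN fmorph_div.
have ev30 : ev P3%:F != 0 by rewrite fmorph_eq0.
split=> [/eqP|<-]; last by rewrite mulNr divfK // subrr.
by rewrite addr_eq0 => /eqP ->; rewrite mulNr opprK mulfK.
Qed.

Lemma eval_derivative (E : fieldType) (kap : {rmorphism C -> E}) (d : E -> E) (t : E)
    (ev : {rmorphism ratfun C -> E}) :
  derivation d -> (forall c, d (kap c) = 0) -> d t != 0 ->
  (forall c, ev (rconst c) = kap c) -> ev (rvar C) = t ->
  forall f, d (ev f) = ev (rderiv f) * d t.
Proof.
move=> dd dk dt evc evt f; have dd' := derivation_scale (d t)^-1 dd.
have <- : (d t)^-1 * d (ev f) = ev (rderiv f).
  apply: (ratfun_der_eq (D' := fun a => (d t)^-1 * d a)) => // [|c|].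
  - exact: rderiv_derivation.
  - by rewrite evc dk mulr0 rderiv_const rmorph0.
  - by rewrite evt rderiv_var rmorph1 mulVf.
by rewrite mulrC mulVKf.
Qed.

(** The equation for [w] is the Schwarzian equation of [phi] transported by the
    change of variable from [t] to [x], with d / dx = w^-2 d / dt. *)
Lemma ode_from_root (E : fieldType) (kap : {rmorphism C -> E}) (d : E -> E) (x t w : E)
    (ev : {rmorphism ratfun C -> E}) :
  char0 E -> derivation d -> (forall c, d (kap c) = 0) -> d x = 1 -> d t != 0 ->
  (forall c, ev (rconst c) = kap c) -> ev (rvar C) = t -> ev phi = x ->
  w ^+ 2 = ev psi ->
  [/\ w != 0, w ^+ 2 * d t = 1 & d (d w) + ode_coef (kap A) (kap B) (kap D) x * w = 0].
Proof.
move=> E0 dd dk dx dt evc evt evphi ew.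
have [f0 f10 p0 _ sch] := schwarz_fun_equation.
have w0 : w != 0.
  apply/eqP=> w0; move: ew => /eqP; rewrite w0 expr0n eq_sym fmorph_eq0.
  by rewrite (negbTE p0).
have evD := eval_derivative dd dk dt evc evt.
have wt : w ^+ 2 * d t = 1 by rewrite ew -evD evphi.
have dtE : d t = (w ^+ 2)^-1 by rewrite -[RHS]mulr1 -wt mulKf // expf_neq0.
split=> //; set l := 2%:R^-1 * dlog _ psi in sch.
have dw : d w = ev l / w.
  have dw2 : 2%:R * w * d w = ev (rderiv psi) * d t.
    by rewrite -evD -ew (derX dd) expr1.
  apply: (mulfI (x := 2%:R * w)); first by rewrite mulf_neq0 // (E0 1).
  have -> : 2%:R * w * (ev l / w) = 2%:R * ev l by field.
  have -> : ev l = 2%:R^-1 * (ev (rderiv psi) / ev psi).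
    by rewrite /l /dlog rmorphM (fmorphV ev 2%:R) (rmorph_nat ev 2) fmorph_div.
  rewrite dw2 dtE ew [RHS]mulrA mulfV ?(E0 1) // mul1r //.
clearbody l.
have evq : ev (ode_coef (rconst A) (rconst B) (rconst D) phi) = ode_coef (kap A) (kap B) (kap D) x.
  by rewrite rmorph_ode_coef evphi !evc.
have dl : d (ev l) = (ev l ^+ 2 - ode_coef (kap A) (kap B) (kap D) x * (w ^+ 2) ^+ 2) / w ^+ 2.
  rewrite evD dtE; congr (_ / _).
  have -> : rderiv l = l ^+ 2 - ode_coef (rconst A) (rconst B) (rconst D) phi * psi ^+ 2.
    by rewrite -mulNr -sch addrC subrK.
  by rewrite rmorphB (rmorphXn ev 2 l) (rmorphM ev _ (psi ^+ 2)) (rmorphXn ev 2 psi) evq ew.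
rewrite dw (der_div dd) dw dl; field.
by [].
Qed.

Lemma root_evaluation (E : fieldType) (kap : {rmorphism C -> E}) (d : E -> E) (x t w : E) :
  char0 E -> derivation d -> (forall c, d (kap c) = 0) -> d x = 1 ->
  w ^+ 2 * d t = 1 -> (map_poly kap P1).[t] + x * (map_poly kap P3).[t] = 0 ->
  exists ev : {rmorphism ratfun C -> E},
    [/\ forall P : {poly C}, ev P%:F = (map_poly kap P).[t],
        forall c, ev (rconst c) = kap c, ev (rvar C) = t & ev phi = x] /\
    (w ^+ 2 = ev psi) /\ (forall f, d (ev f) = ev (rderiv f) * d t).
Proof.
move=> E0 dd dk dx wt rt.
have dt : d t != 0.
  by apply/eqP=> dt; move: wt => /eqP; rewrite dt mulr0 eq_sym oner_eq0.
have [ev [evP evc evt]] := ratfun_eval (transcendental_der dd dk dt E0).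
have evphi : ev phi = x by apply/(root_eval x evP).
have evD := eval_derivative dd dk dt evc evt.
exists ev; split=> //; split=> //.
by apply: (mulIf dt); rewrite wt -evD evphi.
Qed.

Lemma schwarz_sol_pair (E : fieldType) (kap : {rmorphism C -> E}) (d : E -> E) (x t w : E) :
  derivation d -> schwarz_sol d kap x t w ->
  d (d (t * w)) + ode_coef (kap A) (kap B) (kap D) x * (t * w) = 0 /\
  w * d (t * w) - d w * (t * w) = 1.
Proof.
move=> dd [w0 wt _ ode].
have dtE : d t = (w ^+ 2)^-1 by rewrite -[RHS]mulr1 -wt mulKf // expf_neq0.
have ddw : d (d w) = - (ode_coef (kap A) (kap B) (kap D) x * w).
  by apply/eqP; rewrite -addr_eq0 ode.
split; last by rewrite (derM dd) dtE; field.
rewrite (derM dd) (derD dd) !(derM dd) ddw dtE (derV dd) (derX dd) expr1; field.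
by [].
Qed.

(** Adjoin a root [t] of phi T = x, then a square root [w] of dx / dt. The
    constants remain C by [adjoin_root], and phi T = x has no constant root. *)
Lemma schwarz_extension (F : fieldType) (d : F -> F) (kap : {rmorphism C -> F}) (x : F) :
  derivation d -> char0 F -> (forall c, d (kap c) = 0) ->
  (forall a, d a = 0 -> exists c, a = kap c) -> d x = 1 ->
  exists (M : fieldType) (DM : M -> M) (i : {rmorphism F -> M}) (t w : M),
    [/\ derivation DM, forall a, DM (i a) = i (d a),
        forall u, DM u = 0 -> exists c, u = i (kap c),
        finite_span i & schwarz_sol DM (i \o kap) (i x) t w].
Proof.
move=> dd F0 dk kP dx.
pose p := map_poly kap P1 + x *: map_poly kap P3.
have xc c : x <> kap c by move=> e; move/eqP: dx; rewrite e dk eq_sym oner_eq0.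
have pN : p`_N != 0.
  rewrite coefD coefZ !coef_map /=; apply/eqP=> e.
  have P3N : P3`_N = 0.
    apply/eqP; apply: contrapT => /negP P3N; apply: (xc (- (P1`_N / P3`_N))).
    rewrite rmorphN fmorph_div; apply: (mulIf (x := kap P3`_N)); first by rewrite fmorph_eq0.
    by apply/eqP; rewrite mulNr divfK ?fmorph_eq0 // -addr_eq0 addrC e.
  move: e; rewrite P3N rmorph0 mulr0 addr0 => /eqP; rewrite fmorph_eq0 => /eqP P1N.
  apply: (sd_lead sd); split=> //.
  by have := congr1 (fun P : {poly C} => P`_N) (sd_sum sd); rewrite /= !coefD P1N P3N coef0 add0r addr0.
have p_gt1 : (1 < size p)%N.
  by rewrite ltnNge; apply/negP=> h; move: pN; rewrite nth_default ?eqxx // (leq_trans h).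
have [M1 [D1 [i1 [dD1 D1i c1 [t /rootP pt] [n1 [e1 sp1]]]]]] := adjoin_root dd F0 dk kP p_gt1.
have M10 : char0 M1 := char0_morph i1 F0.
have D1k c : D1 ((i1 \o kap) c) = 0 by rewrite /= D1i dk rmorph0.
have D1x : D1 (i1 x) = 1 by rewrite D1i dx rmorph1.
have rt : (map_poly (i1 \o kap) P1).[t] + i1 x * (map_poly (i1 \o kap) P3).[t] = 0.
  by rewrite !map_poly_comp -hornerZ -hornerD -map_polyZ -rmorphD.
have dt : D1 t != 0.
  apply/eqP=> /c1[c ec].
  exact: (no_constant_root (kap := i1 \o kap) dD1 D1k D1x ec rt).
have [ev [evP evc evt]] := ratfun_eval (transcendental_der (h := i1 \o kap) dD1 D1k dt M10).
have evphi : ev phi = i1 x by apply/(root_eval (i1 x) evP).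
pose p2 := 'X^2 - (ev psi)%:P.
have p2_gt1 : (1 < size p2)%N by rewrite /p2 size_XnsubC.
have c1' u : D1 u = 0 -> exists c, u = (i1 \o kap) c by move/c1.
have [M [DM [i2 [dDM DMi c2 [w /rootP pw] [n2 [e2 sp2]]]]]] := adjoin_root dD1 M10 D1k c1' p2_gt1.
have M0 : char0 M := char0_morph i2 M10.
have ew : w ^+ 2 = (i2 \o ev) psi.
  by apply/eqP; move: pw; rewrite /p2 rmorphB /= map_polyXn map_polyC hornerD hornerN hornerXn hornerC => /eqP; rewrite subr_eq0.
pose i := [the {rmorphism F -> M} of i2 \o i1].
have DMk c : DM ((i \o kap) c) = 0 by rewrite /= DMi D1i dk !rmorph0.
have DMx : DM (i x) = 1 by rewrite /= DMi D1x rmorph1.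
have DMt : DM (i2 t) != 0 by rewrite DMi fmorph_eq0.
have [w0 wt ode] := ode_from_root (kap := i \o kap) (ev := i2 \o ev) M0 dDM DMk DMx DMt
  (fun c => congr1 i2 (evc c)) (congr1 i2 evt) (congr1 i2 evphi) ew.
exists M, DM, i, (i2 t), w; split=> //.
- by move=> a; rewrite /= DMi D1i.
- apply: (finite_span_trans (i := i1)).
    by exists 'I_n1, e1.
  by exists 'I_n2, e2.
- split=> //.
  have hi (P : {poly C}) : (map_poly (i \o kap) P).[i2 t] = i2 (map_poly (i1 \o kap) P).[t].
    by rewrite -horner_map -map_poly_comp.
  by rewrite !hi -[i x]/(i2 (i1 x)) -(rmorphM i2) -(rmorphD i2) rt rmorph0.
Qed.

End SchwarzSolutions.

(** * Solution spaces *)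

Section SolutionSpace.
Variables (E : fieldType) (d : E -> E) (q : E).
Hypothesis dd : derivation d.

(** The classical variation of a pair of solutions: the Wronskian of two
    solutions is constant, so coordinates in a basis of solutions are. *)
Lemma solution_coordinates (y0 y1 u : E) :
  d (d y0) + q * y0 = 0 -> d (d y1) + q * y1 = 0 -> d (d u) + q * u = 0 ->
  y0 * d y1 - d y0 * y1 != 0 ->
  exists c0 c1, [/\ d c0 = 0, d c1 = 0 & u = y0 * c0 + y1 * c1].
Proof.
have wr a b : d (d a) + q * a = 0 -> d (d b) + q * b = 0 -> d (a * d b - d a * b) = 0.
  move=> /eqP; rewrite addr_eq0 => /eqP ea /eqP; rewrite addr_eq0 => /eqP eb.
  by rewrite (derB dd) !(derM dd) ea eb; ring.
move=> h0 h1 hu W0; set W := y0 * d y1 - d y0 * y1 in W0.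
have dW : d W = 0 by exact: wr.
exists ((u * d y1 - d u * y1) / W), ((y0 * d u - d y0 * u) / W); split.
- by rewrite (der_div dd) dW wr // mulr0 !mul0r subr0.
- by rewrite (der_div dd) dW wr // mulr0 !mul0r subr0.
- by rewrite /W; field.
Qed.

End SolutionSpace.

Lemma sqr_ratio (K : fieldType) (a b c : K) :
  b != 0 -> a ^+ 2 = b ^+ 2 * c -> (a / b) ^+ 2 = c.
Proof. by move=> b0 e; rewrite expr_div_n e mulrC mulKf // expf_neq0. Qed.

Lemma quadratic_eq0 (R : nzRingType) (a b c : R) :
  a%:P + b *: 'X + c *: 'X^2 = 0 -> [/\ a = 0, b = 0 & c = 0].
Proof.
move/polyP=> h; have := h 0%N; have := h 1%N; have := h 2%N.
by rewrite !coefD !coefC !coefZ !coefX !coefXn ?coef0 /= !(mulr0, mulr1, addr0, add0r).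
Qed.

Section PicardVessiotSchwarz.
Variables (C : closedFieldType) (N : nat) (tq : C -> Prop) (m n k : nat).
Variables (P1 P2 P3 : {poly C}) (r : ratfun C) (A B D : C).
Hypothesis C0 : char0 C.
Hypothesis N_gt0 : (0 < N)%N.
Hypothesis sd : schwarz_data N tq m n k P1 P2 P3 r.
Hypotheses (eA : A = angle C m) (eD : D = angle C n) (eABD : A + B + D = angle C k).

Variables (L0 : fieldType) (delta : L0 -> L0) (iota : {rmorphism ratfun C -> L0}).
Hypothesis pv : picard_vessiot (q_coef A B D) delta iota.

Variable kap : {rmorphism C -> L0}.
Hypothesis kapE : forall c, kap c = iota (rconst c).
Local Notation x := (iota (rvar C)).
Local Notation phi := (schwarz_fun P1 P3).
Local Notation psi := (rderiv (schwarz_fun P1 P3)).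

Lemma pv_der : derivation delta. Proof. by case: pv. Qed.
Lemma pv_iota f : delta (iota f) = iota (rderiv f). Proof. by case: pv. Qed.
Lemma pv_const c : delta c = 0 -> exists a, c = kap a. Proof. by case: pv => _ _ H _ /H[a ->]; exists a; rewrite kapE. Qed.
Lemma pv_kap c : delta (kap c) = 0.
Proof. by rewrite kapE pv_iota rderiv_const rmorph0. Qed.
Lemma pv_x : delta x = 1. Proof. by rewrite pv_iota rderiv_var rmorph1. Qed.
Lemma pv_char0 : char0 L0. Proof. exact: (char0_morph kap). Qed.
Lemma pv_q : iota (q_coef A B D) = ode_coef (kap A) (kap B) (kap D) x.
Proof. by rewrite !kapE; exact: (rmorph_ode_coef iota (rconst A) (rconst B) (rconst D) (rvar C)). Qed.

(** The solutions obtained by adjoining a root of [phi t = x] to L0 are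
    combinations with constant coefficients of those of L0. *)
Lemma pv_schwarz_sol : exists t w, schwarz_sol P1 P3 A B D delta kap x t w.
Proof.
have dd := pv_der.
have [M [DM [i [t [w [dDM DMi cM _ sol]]]]]] :=
  schwarz_extension C0 N_gt0 sd eA eD eABD dd pv_char0 pv_kap pv_const pv_x.
have [_ _ _ [y [yode yW] _]] := pv.
have DMx : DM (i x) = 1 by rewrite DMi pv_x rmorph1.
have [tw_ode _] := schwarz_sol_pair dDM sol.
have [w0 wt rt wode] := sol.
have yi j : DM (DM (i (y 0 j))) + ode_coef ((i \o kap) A) ((i \o kap) B) ((i \o kap) D) (i x) * i (y 0 j) = 0.
  rewrite !DMi -(rmorph_ode_coef i) -rmorphM -rmorphD -pv_q.
  by have := yode j; rewrite /ode_solution => ->; rewrite rmorph0.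
have yWi : i (y 0 0) * DM (i (y 0 1)) - DM (i (y 0 0)) * i (y 0 1) != 0.
  by rewrite !DMi -!rmorphM -rmorphB fmorph_eq0.
have inL0 u : DM (DM u) + ode_coef ((i \o kap) A) ((i \o kap) B) ((i \o kap) D) (i x) * u = 0 ->
    exists v, u = i v.
  move=> hu; have [c0 [c1 [/cM[a0 ->] /cM[a1 ->] ->]]] := solution_coordinates dDM (yi 0) (yi 1) hu yWi.
  by exists (y 0 0 * kap a0 + y 0 1 * kap a1); rewrite rmorphD !rmorphM.
have [w' ew] := inL0 _ wode; have [s es] := inL0 _ tw_ode.
have w'0 : w' != 0 by rewrite -(fmorph_eq0 i) -ew.
have et : t = i (s / w') by rewrite fmorph_div -es -ew mulfK.
exists (s / w'), w'; split=> //.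
- by apply: (fmorph_inj i); rewrite rmorphM rmorphXn rmorph1 -DMi -et -ew.
- apply: (fmorph_inj i); rewrite rmorph0 -rt et rmorphD rmorphM.
  by rewrite -!horner_map -!map_poly_comp.
- apply: (fmorph_inj i); rewrite rmorph0 -wode ew rmorphD rmorphM !DMi.
  by rewrite (rmorph_ode_coef i).
Qed.

Variables t w : L0.
Hypothesis sol : schwarz_sol P1 P3 A B D delta kap x t w.

Let dd := pv_der.
Let w0 : w != 0 := ss_neq0 sol.
Let wt : w ^+ 2 * delta t = 1 := ss_der sol.

Lemma pv_dt : delta t = (w ^+ 2)^-1.
Proof. by rewrite -[RHS]mulr1 -wt mulKf // expf_neq0. Qed.

Lemma pv_dt_neq0 : delta t != 0.
Proof. by rewrite pv_dt invr_eq0 expf_neq0. Qed.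

Lemma pv_transcendental : transcendental kap t.
Proof. exact: (transcendental_der dd pv_kap pv_dt_neq0 pv_char0). Qed.

Lemma affine_eq0 (a b : C) : kap a + kap b * t = 0 -> a = 0 /\ b = 0.
Proof.
move=> h; have : a%:P + b *: 'X = 0.
  apply: pv_transcendental; rewrite rmorphD /= map_polyC map_polyZ map_polyX.
  by rewrite hornerD hornerC hornerZ hornerX.
move=> e; split.
  by have := congr1 (fun P : {poly C} => P`_0) e; rewrite coefD coefC coefZ coefX /= mulr0 addr0 coef0.
by have := congr1 (fun P : {poly C} => P`_1) e; rewrite coefD coefC coefZ coefX /= mulr1 add0r coef0.
Qed.

Lemma moebius_den_neq0 (M : 'M[C]_2) : \det M = 1 -> kap (M 0 0) + kap (M 1 0) * t != 0.
Proof.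
move=> dM; apply/eqP=> /affine_eq0[h0 h1].
by move: dM => /eqP; rewrite det_mx2 h0 h1 mul0r mulr0 subrr eq_sym oner_eq0.
Qed.

Lemma moebius_eq (M Q : 'M[C]_2) : \det M = 1 -> \det Q = 1 ->
  moebius kap M t = moebius kap Q t -> M = Q \/ M = - Q.
Proof.
move=> dM dQ; have jM := moebius_den_neq0 dM; have jQ := moebius_den_neq0 dQ.
rewrite /moebius => /eqP; rewrite eqr_div // -subr_eq0 => /eqP h.
have : (M 0 1 * Q 0 0 - Q 0 1 * M 0 0)%:P
     + (M 0 1 * Q 1 0 + M 1 1 * Q 0 0 - (Q 0 1 * M 1 0 + Q 1 1 * M 0 0)) *: 'X
     + (M 1 1 * Q 1 0 - Q 1 1 * M 1 0) *: 'X^2 = 0.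
  apply: pv_transcendental; rewrite 2!rmorphD /= !map_polyZ map_polyC map_polyX map_polyXn.
  rewrite !hornerD !hornerZ hornerC hornerX hornerXn -[RHS]h.
  by rewrite !(rmorphB, rmorphD, rmorphM); ring.
case/quadratic_eq0.
move=> /eqP; rewrite subr_eq0 => /eqP e0 /eqP; rewrite subr_eq0 => /eqP e1.
move=> /eqP; rewrite subr_eq0 => /eqP e2.
rewrite !det_mx2 in dM dQ.
pose s := M 0 0 * Q 1 1 - M 0 1 * Q 1 0.
have s' : s = M 1 1 * Q 0 0 - M 1 0 * Q 0 1.
  rewrite /s; apply/eqP; rewrite subr_eq addrAC eq_sym subr_eq; apply/eqP.
  by rewrite addrC e1; ring.
have q00 : Q 0 0 = s * M 0 0.
  rewrite s' -[LHS]mulr1 -dM; transitivity (Q 0 0 * M 0 0 * M 1 1 - M 1 0 * (M 0 1 * Q 0 0)); first by ring.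
  by rewrite e0; ring.
have q01 : Q 0 1 = s * M 0 1.
  rewrite s' -[LHS]mulr1 -dM; transitivity (M 1 1 * (Q 0 1 * M 0 0) - Q 0 1 * M 0 1 * M 1 0); first by ring.
  by rewrite -e0; ring.
have q11 : Q 1 1 = s * M 1 1.
  rewrite /s -[LHS]mulr1 -dM; transitivity (Q 1 1 * M 0 0 * M 1 1 - M 0 1 * (Q 1 1 * M 1 0)); first by ring.
  by rewrite -e2; ring.
have q10 : Q 1 0 = s * M 1 0.
  rewrite /s -[LHS]mulr1 -dM; transitivity (M 0 0 * (M 1 1 * Q 1 0) - Q 1 0 * M 0 1 * M 1 0); first by ring.
  by rewrite e2; ring.
have /eqP : s ^+ 2 = 1.
  by rewrite -[RHS]dQ q00 q01 q10 q11 -[LHS]mulr1 -dM; ring.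
rewrite sqrf_eq1 => /orP[] /eqP s1; [left|right]; apply: eq_mx2;
by rewrite ?mxE ?q00 ?q01 ?q10 ?q11 s1 ?mul1r // mulN1r opprK.
Qed.

Variable ev : {rmorphism ratfun C -> L0}.
Hypothesis evP : forall P : {poly C}, ev P%:F = (map_poly kap P).[t].
Hypothesis evc : forall c, ev (rconst c) = kap c.
Hypothesis evt : ev (rvar C) = t.
Hypothesis evphi : ev phi = x.
Hypothesis evw : w ^+ 2 = ev psi.
Hypothesis evD : forall f, delta (ev f) = ev (rderiv f) * delta t.

Lemma eval_in (T : set L0) : subfield T -> range iota `<=` T -> T t -> forall f, T (ev f).
Proof.
move=> sT iT Tt; apply: ratfun_gen (subfield_preimage ev sT) _ _ => [c|] /=.
  by rewrite evc kapE; apply: iT; exists (rconst c).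
by rewrite evt.
Qed.

Lemma pv_dw : delta w = ev (rderiv psi) / (2%:R * w * w ^+ 2).
Proof.
have e : 2%:R * w * delta w = ev (rderiv psi) / w ^+ 2.
  by rewrite -pv_dt -evD -evw (derX dd) expr1.
have n2 : 2%:R * w != 0 by rewrite mulf_neq0 // (pv_char0 1).
by apply: (mulfI n2); rewrite e; field; rewrite w0 (pv_char0 1).
Qed.

(** The fundamental system of the definition of L0 and the pair [(w, t w)] span
    the same space of solutions. *)
Lemma pv_generated (T : set L0) : subfield T -> range iota `<=` T -> T t -> T w ->
  forall u, T u.
Proof.
move=> sT iT Tt Tw; have [_ _ _ [y [yode _] gen]] := pv.
have [tw_ode tw_W] := schwarz_sol_pair dd sol.
have Tev := eval_in sT iT Tt.
have Tk c : T (kap c) by rewrite ?kapE; apply: iT; exists (rconst c).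
have T2 : T 2%:R by rewrite -(rmorph_nat kap).
have Tdw : T (delta w).
  rewrite pv_dw; apply: (subfield_div sT); first exact: Tev.
  by apply: (subfieldM sT); [exact: (subfieldM sT)|exact: (subfieldX sT 2 Tw)].
have Tdt : T (delta t) by rewrite pv_dt; apply: (subfieldV sT); exact: (subfieldX sT 2 Tw).
have Ty j : T (y 0 j) /\ T (delta (y 0 j)).
  have hj : delta (delta (y 0 j)) + ode_coef (kap A) (kap B) (kap D) x * y 0 j = 0.
    by rewrite -pv_q; exact: yode.
  have W1 : w * delta (t * w) - delta w * (t * w) != 0 by rewrite tw_W oner_neq0.
  have [c0 [c1 [/pv_const[a0 ->] /pv_const[a1 ->] ->]]] :=
    solution_coordinates dd (ss_ode sol) tw_ode hj W1.
  split.
    by do ?[apply: subfieldD | apply: subfieldM | exact: Tk | by []].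
  rewrite (derD dd) !(derM dd) !pv_kap.
  by do ?[apply: subfieldD | apply: subfieldM | exact: Tk | exact: subfield0 | by []].
by apply: (field_adjoin_setT gen) => // u [j [->|->]]; case: (Ty j).
Qed.

Lemma w_not_eval a : ev a <> w.
Proof.
move=> e; apply: (psi_nonsquare C0 sd eA eD eABD (s := a)).
by apply: (fmorph_inj ev); rewrite rmorphXn e evw.
Qed.

(** The field generated by C(t) and [w] is of degree 2 over C(t), because
    [w ^ 2] is a function of [t]; and [x] is one too. *)
Lemma pv_coordinates u : exists a b, u = ev a + ev b * w.
Proof.
apply: (pv_generated (T := [set u | exists a b, u = ev a + ev b * w])).
- split.
  + by exists 1, 0; rewrite rmorph1 rmorph0 mul0r addr0.
  + move=> _ _ [a [b ->]] [a' [b' ->]]; exists (a - a'), (b - b').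
    by rewrite !rmorphB; ring.
  + move=> _ v [a [b ->]] [a' [b' ev']].
    have [v0|v0] := eqVneq v 0.
      by exists 0, 0; rewrite v0 invr0 mulr0 rmorph0 mul0r addr0.
    have n0 : a' ^+ 2 - b' ^+ 2 * psi != 0.
      rewrite subr_eq0; apply/eqP=> h.
      have [b'0|b'0] := eqVneq b' 0.
        move: h; rewrite b'0 expr0n mul0r => /eqP; rewrite expf_eq0 /= => /eqP a'0.
        by move: v0; rewrite ev' a'0 b'0 rmorph0 mul0r addr0 eqxx.
      apply: (psi_nonsquare C0 sd eA eD eABD (s := a' / b')).
      exact: sqr_ratio.
    exists ((a * a' - b * b' * psi) / (a' ^+ 2 - b' ^+ 2 * psi)),
       ((b * a' - a * b') / (a' ^+ 2 - b' ^+ 2 * psi)).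
    have eden : ev (a' ^+ 2 - b' ^+ 2 * psi) = ev a' ^+ 2 - ev b' ^+ 2 * w ^+ 2.
      by rewrite rmorphB (rmorphXn ev 2 a') (rmorphM ev (b' ^+ 2)) (rmorphXn ev 2 b') evw.
    have en1 : ev (a * a' - b * b' * psi) = ev a * ev a' - ev b * ev b' * w ^+ 2.
      by rewrite rmorphB (rmorphM ev a) (rmorphM ev (b * b')) (rmorphM ev b) evw.
    have en2 : ev (b * a' - a * b') = ev b * ev a' - ev a * ev b'.
      by rewrite rmorphB (rmorphM ev b) (rmorphM ev a).
    have en0 : ev a' ^+ 2 - ev b' ^+ 2 * w ^+ 2 != 0.
      by rewrite -eden fmorph_eq0.
    rewrite ev' in v0 *; rewrite !fmorph_div en1 en2 eden; field.
    by rewrite exprMn en0 v0.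
- move=> _ [f _ <-]; suff [a ->] : exists a, iota f = ev a.
    by exists a, 0; rewrite rmorph0 mul0r addr0.
  suff [a _ <-] : range ev (iota f) by exists a.
  move: f; apply: ratfun_gen (subfield_preimage iota (subfield_range ev)) _ _ => [c|] /=.
    by exists (rconst c); rewrite // evc kapE.
  by exists phi.
- by exists (rvar C), 0; rewrite evt rmorph0 mul0r addr0.
- by exists 0, 1; rewrite rmorph0 rmorph1 mul1r add0r.
Qed.

Lemma pv_coordinates_inj a b a' b' :
  ev a + ev b * w = ev a' + ev b' * w -> a = a' /\ b = b'.
Proof.
move=> h; have e : ev (b - b') * w = ev (a' - a).
  by rewrite !rmorphB; apply/eqP; rewrite -subr_eq0 -(subrr (ev a + ev b * w)) {2}h; apply/eqP; ring.
have [b0|b0] := eqVneq (b - b') 0.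
  split; last by apply/eqP; rewrite -subr_eq0 b0.
  move: e; rewrite b0 rmorph0 mul0r => /esym/eqP; rewrite fmorph_eq0 subr_eq0.
  by move=> /eqP.
case: (@w_not_eval ((a' - a) / (b - b'))).
by rewrite fmorph_div -e mulrC mulKf // fmorph_eq0.
Qed.

(** ** The Galois action on the pair of solutions *)

Local Notation gal := (diff_galois delta iota).

(** The automorphism [s] sends the row [(w, t w)] to [(w, t w) M]. *)
Definition acts (s : L0 -> L0) (M : 'M[C]_2) : Prop :=
  s w = w * kap (M 0 0) + t * w * kap (M 1 0) /\
  s (t * w) = w * kap (M 0 1) + t * w * kap (M 1 1).

Section Automorphism.
Variable s : {rmorphism L0 -> L0}.
Hypothesis gs : gal s.

Lemma gal_kap c : s (kap c) = kap c.
Proof. by have [_ _ h] := gs; rewrite kapE h. Qed.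

Lemma gal_x : s x = x. Proof. by have [_ _ h] := gs; rewrite h. Qed.

Lemma gal_delta u : s (delta u) = delta (s u). Proof. by have [_ h _] := gs. Qed.

Lemma acts_exists : exists M, acts s M.
Proof.
have [tw_ode tw_W] := schwarz_sol_pair dd sol.
have W1 : w * delta (t * w) - delta w * (t * w) != 0 by rewrite tw_W oner_neq0.
have im u : delta (delta u) + ode_coef (kap A) (kap B) (kap D) x * u = 0 ->
    exists c0 c1, s u = w * kap c0 + t * w * kap c1.
  move=> hu; have hs : delta (delta (s u)) + ode_coef (kap A) (kap B) (kap D) x * s u = 0.
    have := congr1 s hu; rewrite rmorph0 rmorphD rmorphM !gal_delta (rmorph_ode_coef s).
    by rewrite !gal_kap gal_x.
  have [c0 [c1 [/pv_const[a0 ->] /pv_const[a1 ->] ->]]] :=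
    solution_coordinates dd (ss_ode sol) tw_ode hs W1.
  by exists a0, a1.
have [a00 [a10 e0]] := im _ (ss_ode sol); have [a01 [a11 e1]] := im _ tw_ode.
by exists (mx2 a00 a01 a10 a11); rewrite /acts !mx2E.
Qed.

Variable M : 'M[C]_2.
Hypothesis sM : acts s M.

Lemma acts_det : \det M = 1.
Proof.
have [_ tw_W] := schwarz_sol_pair dd sol.
have [e0 e1] := sM; have := congr1 s tw_W.
rewrite rmorphB !rmorphM !gal_delta -rmorphM e0 e1 rmorph1.
rewrite !(derD dd) !(derM dd _ (kap _)) !pv_kap => h.
apply: (fmorph_inj kap); rewrite rmorph1 -[RHS]h det_mx2 rmorphB !rmorphM -[LHS]mulr1 -tw_W.
by ring.
Qed.

Lemma acts_moebius : s t = moebius kap M t.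
Proof.
have [e0 e1] := sM; have j0 := moebius_den_neq0 acts_det.
have sw0 : s w != 0 by rewrite fmorph_eq0.
rewrite -[t in LHS](mulfK w0) fmorph_div e0 e1 /moebius.
have -> : w * kap (M 0 0) + t * w * kap (M 1 0) = w * (kap (M 0 0) + kap (M 1 0) * t) by ring.
by field; rewrite w0 j0.
Qed.

Lemma acts_root :
  (map_poly kap P1).[s t] + x * (map_poly kap P3).[s t] = 0.
Proof.
have hs (P : {poly C}) : (map_poly kap P).[s t] = s (map_poly kap P).[t].
  by rewrite -horner_map -map_poly_comp; congr _.[_]; apply: eq_map_poly => c /=; rewrite gal_kap.
by rewrite !hs -{1}gal_x -rmorphM -rmorphD (ss_root sol) rmorph0.
Qed.

End Automorphism.

Lemma acts_comp (s s' : {rmorphism L0 -> L0}) M M' : gal s ->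
  acts s M -> acts s' M' -> acts (s \o s') (M *m M').
Proof.
move=> gs [e0 e1] [e0' e1']; rewrite /acts /= e0' e1'.
by rewrite !rmorphD !(rmorphM s _ (kap _)) !(gal_kap gs) e0 e1 !mul_mx2 !rmorphD !rmorphM; split; ring.
Qed.

Lemma gal_comp (s s' : {rmorphism L0 -> L0}) : gal s -> gal s' ->
  gal [the {rmorphism L0 -> L0} of s \o s'].
Proof.
move=> [b h k1] [b' h' k1']; split=> /=; first exact: bij_comp.
  by move=> u; rewrite h' h.
by move=> f; rewrite k1' k1.
Qed.

Lemma acts_eq (s s' : {rmorphism L0 -> L0}) M :
  gal s -> gal s' -> acts s M -> acts s' M -> s =1 s'.
Proof.
move=> gs gs' h h'; apply: (pv_generated (T := [set u | s u = s' u])).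
- exact: subfield_equalizer.
- by move=> _ [f _ <-] /=; have [_ _ ->] := gs; have [_ _ ->] := gs'.
- by rewrite /= (acts_moebius gs h) (acts_moebius gs' h').
- by case: h => h _; case: h' => h' _; rewrite /= h h'.
Qed.

(** The root [t'] and [w' = w (M 0 0 + M 1 0 t)] satisfy the same equations as
    [t] and [w]; since [(1, w)] is a basis of L0 over C(t), sending [t] to [t']
    and [w] to [w'] defines an endomorphism, and its image contains [t] and [w],
    which generate L0. *)
Lemma acts_realized (M : 'M[C]_2) : \det M = 1 ->
  (map_poly kap P1).[moebius kap M t] + x * (map_poly kap P3).[moebius kap M t] = 0 ->
  exists2 s, gal s & acts s M.
Proof.
move=> dM rt'; have j0 := moebius_den_neq0 dM.
set j := _ + _ in j0; set t' := moebius kap M t in rt'; pose w' := w * j.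
have w'0 : w' != 0 by rewrite mulf_neq0.
have dt' : delta t' = delta t / j ^+ 2.
  rewrite /t' /moebius (der_div dd) !(derD dd) !(derM dd) !pv_kap !mul0r !add0r -/j.
  have : kap (M 0 0) * kap (M 1 1) - kap (M 0 1) * kap (M 1 0) = 1.
    by rewrite -!rmorphM -rmorphB -det_mx2 dM rmorph1.
  move=> d1; transitivity ((kap (M 0 0) * kap (M 1 1) - kap (M 0 1) * kap (M 1 0)) * delta t / j ^+ 2).
    by rewrite /j; field; exact: j0.
  by rewrite d1 mul1r.
have wt' : w' ^+ 2 * delta t' = 1.
  by rewrite dt' /w' -[RHS]wt; field.
have [ev' [[evP' evc' evt' evphi'] [evw' evD']]] :=
  root_evaluation sd pv_char0 dd pv_kap pv_x wt' rt'.
have /choice[g gE] : forall u, exists p : ratfun C * ratfun C, u = ev p.1 + ev p.2 * w.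
  by move=> u; have [a [b ->]] := pv_coordinates u; exists (a, b).
pose s u := ev' (g u).1 + ev' (g u).2 * w'.
have sE a b : s (ev a + ev b * w) = ev' a + ev' b * w'.
  by have := gE (ev a + ev b * w) => /pv_coordinates_inj[]; rewrite /s => <- <-.
have sw : s w = w'.
  by have := sE 0 1; rewrite !rmorph0 !rmorph1 !add0r !mul1r.
have sev a : s (ev a) = ev' a.
  by have := sE a 0; rewrite !rmorph0 !mul0r !addr0.
have sB : zmod_morphism s.
  move=> u v; have [a [b ->]] := pv_coordinates u; have [a' [b' ->]] := pv_coordinates v.
  have -> : ev a + ev b * w - (ev a' + ev b' * w) = ev (a - a') + ev (b - b') * w.
    by rewrite !rmorphB; ring.
  by rewrite !sE !rmorphB; ring.
have sM : monoid_morphism s.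
  split; first by rewrite -(rmorph1 ev) sev !rmorph1.
  move=> u v; have [a [b ->]] := pv_coordinates u; have [a' [b' ->]] := pv_coordinates v.
  have -> : (ev a + ev b * w) * (ev a' + ev b' * w)
      = ev (a * a' + b * b' * psi) + ev (a * b' + b * a') * w.
    rewrite !rmorphD (rmorphM ev (b * b')) !(rmorphM ev a) !(rmorphM ev b) -evw; ring.
  rewrite !sE !rmorphD (rmorphM ev' (b * b')) !(rmorphM ev' a) !(rmorphM ev' b) -evw'; ring.
pose sZ := GRing.isZmodMorphism.Build _ _ s sB.
pose sR := GRing.isMonoidMorphism.Build _ _ s sM.
have [S SE] : exists S : {rmorphism L0 -> L0}, S =1 s.
  pose S : {rmorphism L0 -> L0} := HB.pack s sZ sR.
  by exists S.
have Sev a : S (ev a) = ev' a by rewrite SE sev.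
have Sw : S w = w' by rewrite SE sw.
have Sk c : S (kap c) = kap c by rewrite -evc Sev evc' evc.
have St : S t = t' by rewrite -[in LHS]evt Sev.
have Si f : S (iota f) = iota f.
  move: f; apply: ratfun_gen (subfield_equalizer (S \o iota) iota) _ _ => [c|] /=.
    by rewrite -kapE Sk.
  by rewrite -[in LHS]evphi Sev.
have actS : acts S M.
  split; first by rewrite Sw /w' /j; ring.
  rewrite rmorphM St Sw /w' /t' /moebius -/j; field.
  exact: j0.
exists S => //; split=> //.
- have tin : range S t.
    have inT := subfield_range S.
    have kin c : range S (kap c) by exists (kap c).
    have t'in : range S t' by exists t.
    have n0 : kap (M 1 1) - kap (M 1 0) * t' != 0.
      have -> : kap (M 1 1) - kap (M 1 0) * t' =
          (kap (M 0 0) * kap (M 1 1) - kap (M 0 1) * kap (M 1 0)) / j.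
        by rewrite /t' /moebius -/j /j; field; exact: j0.
      by rewrite -!rmorphM -rmorphB -det_mx2 dM rmorph1 mul1r invr_eq0.
    have -> : t = (kap (M 0 0) * t' - kap (M 0 1)) / (kap (M 1 1) - kap (M 1 0) * t').
      apply: (mulIf n0); rewrite divfK // /t' /moebius -/j /j; field; exact: j0.
    have k_t' c : range S (kap c * t') by apply: (subfieldM inT) => //; exact: kin.
    by apply: (subfield_div inT); apply: (subfieldB inT); rewrite ?k_t' //; exact: kin.
  have win : range S w.
    have -> : w = w' / j by rewrite mulfK.
    apply: (subfield_div (subfield_range S)); first by exists w.
    have kin c : range S (kap c) by exists (kap c).
    by apply: (subfieldD (subfield_range S)) => //; apply: (subfieldM (subfield_range S)).
  have surj u : exists v, S v = u.
    suff [v _ <-] : range S u by exists v.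
    apply: (pv_generated (subfield_range S)) => // _ [f _ <-].
    by exists (iota f).
  have [f' f'P] := choice surj; exists f' => // u.
  by apply: (fmorph_inj S); rewrite f'P.
- move=> u; apply/esym; move: u; apply: (pv_generated (T := [set u | delta (S u) = S (delta u)])).
  + exact: subfield_der_equalizer.
  + by move=> _ [f _ <-] /=; rewrite Si pv_iota Si.
  + by rewrite /= St dt' pv_dt !fmorphV rmorphXn Sw /w' exprMn; field; rewrite w0 j0.
  + have w2 := congr1 delta evw'; rewrite (derX dd) evD' expr1 in w2.
    have n2 : 2%:R * w' != 0 by rewrite mulf_neq0 // (pv_char0 1).
    apply: (mulfI n2); rewrite /= Sw w2 pv_dw.
    rewrite (fmorph_div S) Sev (rmorphM S _ (w ^+ 2)) (rmorphXn S 2 w) (rmorphM S 2%:R) (rmorph_nat S) Sw.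
    have -> : delta t' = (w' ^+ 2)^-1 by rewrite -[RHS]mulr1 -wt' mulKf // expf_neq0.
    by field; rewrite w'0 (pv_char0 1).
Qed.

(** ** Roots of [phi T = x] and the fixed field *)

Let p0 : {poly L0} := map_poly kap P1 + x *: map_poly kap P3.

Lemma x_affine (a b : C) : kap a + x * kap b = 0 -> a = 0 /\ b = 0.
Proof.
move=> h; have b0 : b = 0.
  apply: (fmorph_inj kap); rewrite rmorph0.
  have := congr1 delta h; rewrite (derD dd) (derM dd) !pv_kap pv_x (der0 dd).
  by rewrite add0r mulr0 addr0 mul1r.
split=> //; apply: (fmorph_inj kap).
by move: h; rewrite b0 rmorph0 mulr0 addr0.
Qed.

Lemma coef_p0 : p0`_N != 0.
Proof.
rewrite coefD coefZ !coef_map; apply/eqP=> /x_affine[h1 h3]; apply: (sd_lead sd); split=> //.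
by have := congr1 (fun P : {poly C} => P`_N) (sd_sum sd); rewrite /= !coefD h1 h3 coef0 add0r addr0.
Qed.

Lemma size_p0 : (size p0 <= N.+1)%N.
Proof.
have [s1 _ s3] := sd_size sd.
apply: size_leD; first by rewrite size_map_poly.
by rewrite (leq_trans (size_scale_leq _ _)) // size_map_poly.
Qed.

Lemma p0_root u : root p0 u <-> (map_poly kap P1).[u] + x * (map_poly kap P3).[u] = 0.
Proof. by rewrite rootE hornerD hornerZ; split=> [/eqP|->]. Qed.

Lemma p0_all_roots (rs : seq L0) u :
  uniq rs -> size rs = N -> all (root p0) rs -> root p0 u -> u \in rs.
Proof.
move=> urs srs rrs pu; apply: contraT => nu.
have p00 : p0 != 0 by apply: contraNneq coef_p0 => ->; rewrite coef0.
have := max_poly_roots (rs := u :: rs) p00; rewrite /= pu rrs nu urs => /(_ isT isT).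
by rewrite srs ltnNge size_p0.
Qed.

(** A fixed element is a function [ev a] of [t], and reducing numerator and
    denominator modulo the equation of [t] over C(x) leaves a polynomial of
    degree less than N with N roots. *)
Lemma fixed_field (z : L0) (s1 : {rmorphism L0 -> L0}) (rs : seq L0) :
  gal s1 -> acts s1 (- 1%:M) -> s1 z = z -> uniq rs -> size rs = N ->
  (forall u, u \in rs -> exists s : {rmorphism L0 -> L0}, [/\ gal s, s z = z & u = s t]) ->
  exists g, z = iota g.
Proof.
move=> g1 a1 z1 urs srs rsP.
have s1t : s1 t = t.
  rewrite (acts_moebius g1 a1) /moebius !mxE /= oppr0 !rmorphN rmorph1 rmorph0 mul0r addr0 add0r.
  by rewrite invrN invr1 mulrN1 mulN1r opprK.
have s1w : s1 w = - w.
  by have [e _] := a1; rewrite e !mxE /= !rmorphN rmorph1 rmorph0 oppr0 mulr0 addr0 mulrN1.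
have s1ev f : s1 (ev f) = ev f.
  have [s1' s1'E] : exists h : {rmorphism ratfun C -> L0}, h =1 s1 \o ev by exists (s1 \o ev).
  rewrite -[LHS]/((s1 \o ev) f) -s1'E; move: f; apply: ratfun_rmorph_eq => [c|].
    by rewrite s1'E /= evc (gal_kap g1).
  by rewrite s1'E /= evt s1t.
have [a [b ez]] := pv_coordinates z.
have b0 : ev b * w = 0.
  have h : ev b * w = - (ev b * w).
    by apply: (addrI (ev a)); rewrite -ez -{1}z1 ez rmorphD rmorphM !s1ev s1w mulrN.
  have /eqP : 2%:R * (ev b * w) = 0.
    by rewrite mulr2n mulrDl mul1r {2}h subrr.
  by rewrite mulf_eq0 (negbTE (pv_char0 1)) => /eqP.
rewrite b0 addr0 in ez.
have [u [v [v0 ea]]] := fracP a; rewrite ea fmorph_div !evP in ez.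
pose p1 : {poly ratfun C} := map_poly (@rconst C) P1 + rvar C *: map_poly (@rconst C) P3.
have kmap (P : {poly C}) : map_poly kap P = map_poly iota (map_poly (@rconst C) P).
  by rewrite -map_poly_comp; apply: eq_map_poly => c; rewrite /= kapE.
have ep : map_poly iota p1 = p0.
  by rewrite /p1 /p0 rmorphD /= map_polyZ !kmap.
have p10 : p1 != 0.
  by apply: contraNneq coef_p0 => h; rewrite -ep h rmorph0 coef0.
pose uu := map_poly (@rconst C) u %% p1; pose vv := map_poly (@rconst C) v %% p1.
have red (P : {poly C}) y : root p0 y ->
    (map_poly kap P).[y] = (map_poly iota (map_poly (@rconst C) P %% p1)).[y].
  move=> /rootP hy; rewrite kmap {1}(divp_eq (map_poly (@rconst C) P) p1).
  by rewrite rmorphD rmorphM /= ep hornerD hornerM hy mulr0 add0r.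
have rt : root p0 t by apply/p0_root/(ss_root sol).
have vt : (map_poly kap v).[t] != 0.
  by apply/eqP=> /pv_transcendental/eqP; rewrite (negbTE v0).
pose R := map_poly iota uu - z *: map_poly iota vv.
have Rroots : all (root R) rs.
  apply/allP=> y /rsP[s [gs sz ey]].
  have ry : root p0 y by apply/p0_root; rewrite ey; have [M sM] := acts_exists gs; exact: (acts_root gs).
  have sP (P : {poly C}) : s (map_poly kap P).[t] = (map_poly kap P).[y].
    rewrite ey -horner_map -map_poly_comp; congr _.[_].
    by apply: eq_map_poly => c /=; rewrite (gal_kap gs).
  have vy : (map_poly kap v).[y] != 0 by rewrite -sP fmorph_eq0.
  rewrite rootE /R hornerD hornerN hornerZ -!red //.
  by rewrite -sz ez fmorph_div !sP divfK // subrr.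
have sR : (size R <= N)%N.
  have sz (P : {poly ratfun C}) : (size (map_poly iota (P %% p1)) <= N)%N.
    rewrite size_map_poly -ltnS (leq_trans (ltn_modpN0 _ p10)) //.
    by rewrite -(size_map_poly iota) ep size_p0.
  apply: size_leD; first exact: sz.
  by rewrite size_polyN (leq_trans (size_scale_leq _ _)) // sz.
have R0 : R = 0.
  apply/eqP; apply: contraT => R0; have := max_poly_roots R0 Rroots urs.
  by rewrite srs ltnNge sR.
have vv0 : vv != 0.
  by apply: contraNneq vt => h; rewrite red // -/vv h rmorph0 horner0.
have lc0 : iota (lead_coef vv) != 0 by rewrite fmorph_eq0 lead_coef_eq0.
exists (uu`_(size vv).-1 / lead_coef vv); rewrite fmorph_div.
apply: (mulIf lc0); rewrite divfK //.
have := congr1 (fun P : {poly L0} => P`_(size vv).-1) R0.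
rewrite /R coefD coefN coefZ !coef_map coef0 /= => /eqP.
by rewrite subr_eq0 => /eqP ->.
Qed.

Lemma pair_coord_inj (a b a' b' : C) :
  w * kap a + t * w * kap b = w * kap a' + t * w * kap b' -> a = a' /\ b = b'.
Proof.
move=> h; have : kap (a - a') + kap (b - b') * t = 0.
  apply: (mulfI w0); rewrite mulr0 !rmorphB -[RHS](subrr (w * kap a + t * w * kap b)) {2}h.
  by ring.
by case/affine_eq0=> /eqP + /eqP; rewrite !subr_eq0 => /eqP -> /eqP ->.
Qed.

(** ** The matrix group of the Galois group *)

Section GaloisGroup.
Variables (gT : finGroupType) (AA : {group gT}) (G : set 'M[C]_2) (f : 'M[C]_2 -> gT).
Hypothesis GS : SL2_subgroup G.
Hypothesis fP : cover_map AA G f.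
Hypothesis cardA : #|AA| = N.
Variable P : 'M[C]_2.
Hypothesis uP : P \in unitmx.
Hypothesis realized : forall M, G M -> exists2 s, gal s & acts s (P *m M *m invmx P).

Let cj (M : 'M[C]_2) := P *m M *m invmx P.

Lemma cj_mul M M' : cj (M *m M') = cj M *m cj M'.
Proof. by rewrite /cj !mulmxA mulmxKV. Qed.

Lemma cj_N M : cj (- M) = - cj M.
Proof. by rewrite /cj mulmxN mulNmx. Qed.

Lemma cj_det M : G M -> \det (cj M) = 1.
Proof.
case: GS => _ _ _ Gdet /Gdet dM; rewrite /cj !det_mulmx dM mulr1 det_inv.
by rewrite mulrV // -unitmxE.
Qed.

Lemma cj_inj M M' : cj M = cj M' -> M = M'.
Proof.
move=> /(congr1 (mulmx (invmx P))) /(congr1 (mulmxr P)).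
by rewrite /cj /= !mulmxA !(mulVmx uP) !mul1mx -!mulmxA !(mulVmx uP) !mulmx1.
Qed.

Lemma lifts : exists (lf : gT -> 'M[C]_2) (S : gT -> {rmorphism L0 -> L0}),
  forall g, g \in AA -> [/\ G (lf g), f (lf g) = g, gal (S g) & acts (S g) (cj (lf g))].
Proof.
have /choice[h hP] : forall g : gT, exists p : 'M[C]_2 * {rmorphism L0 -> L0},
    g \in AA -> [/\ G p.1, f p.1 = g, gal p.2 & acts p.2 (cj p.1)].
  move=> g; have [gA|gA] := boolP (g \in AA); last by exists (0, (idfun : {rmorphism L0 -> L0})).
  have [M GM fM] := cm_surj fP gA; have [s gs sM] := realized GM.
  by exists (M, s).
by exists (fun g => (h g).1), (fun g => (h g).2).
Qed.

Variables (lf : gT -> 'M[C]_2) (S : gT -> {rmorphism L0 -> L0}).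
Hypothesis SP : forall g, g \in AA ->
  [/\ G (lf g), f (lf g) = g, gal (S g) & acts (S g) (cj (lf g))].

Let rs : seq L0 := [seq S g t | g <- enum AA].

Lemma size_rs : size rs = N. Proof. by rewrite size_map -cardE. Qed.

Lemma uniq_rs : uniq rs.
Proof.
rewrite map_inj_in_uniq ?enum_uniq // => g h; rewrite !mem_enum => gA hA.
have [Gg fg gg ag] := SP gA; have [Gh fh gh ah] := SP hA.
rewrite (acts_moebius gg ag) (acts_moebius gh ah).
case/(moebius_eq (cj_det Gg) (cj_det Gh)) => [/cj_inj e|].
  by rewrite -fg -fh e.
rewrite -cj_N => /cj_inj e; rewrite -fg -fh e.
by have [_ ->] := cover_opp GS fP Gh.
Qed.

(** The elements of the group already move [t] to N different roots of
    phi T = x, so every automorphism moves [t] as one of them does. *)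
Lemma gal_in_group (s : {rmorphism L0 -> L0}) M : gal s -> acts s M ->
  exists2 M', G M' & M = cj M'.
Proof.
move=> gs sM.
have rrs : all (root p0) rs.
  apply/allP=> y /mapP[g]; rewrite mem_enum => gA ->.
  by have [_ _ gg ag] := SP gA; apply/p0_root; exact: acts_root.
have : s t \in rs.
  by apply: p0_all_roots; rewrite ?uniq_rs ?size_rs //; apply/p0_root; exact: acts_root.
case/mapP=> g; rewrite mem_enum => gA; have [Gg fg gg ag] := SP gA.
rewrite (acts_moebius gs sM) (acts_moebius gg ag).
case/(moebius_eq (acts_det gs sM) (cj_det Gg)) => ->; first by exists (lf g).
by exists (- lf g); [case: (cover_opp GS fP Gg)|rewrite cj_N].
Qed.

(* The lemmas above compute the matrices in the basis [(w, t w)]; conjugation by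
   [P] becomes a change of fundamental system. *)
Lemma galois_group : has_galois_group (q_coef A B D) delta iota G.
Proof.
have [tw_ode tw_W] := schwarz_sol_pair dd sol.
pose Y : 'rV[L0]_2 := \row_j (if j == 0 then w else t * w).
have Y0 : Y 0 0 = w by rewrite mxE. have Y1 : Y 0 1 = t * w by rewrite mxE.
have actsE (s : {rmorphism L0 -> L0}) M : acts s M <-> map_mx s Y = Y *m map_mx kap M.
  split=> [[e0 e1]|e].
    by apply: eq_rv2; rewrite mxE mul_mx2 !Y0 !Y1 !mxE.
  have := congr1 (fun Z : 'rV[L0]_2 => Z 0 0) e; have := congr1 (fun Z : 'rV[L0]_2 => Z 0 1) e.
  by rewrite !mul_mx2 !Y0 !Y1 ![map_mx _ _ _ _]mxE Y0 Y1 => e1 e0.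
have Yfree (M M' : 'M[C]_2) : Y *m map_mx kap M = Y *m map_mx kap M' -> M = M'.
  move=> e; have e0 := congr1 (fun Z : 'rV[L0]_2 => Z 0 0) e.
  have e1 := congr1 (fun Z : 'rV[L0]_2 => Z 0 1) e; move: e0 e1.
  rewrite !mul_mx2 !Y0 !Y1 ![map_mx _ _ _ _]mxE => e0 e1.
  have [h00 h10] := pair_coord_inj e0; have [h01 h11] := pair_coord_inj e1.
  exact: eq_mx2.
exists (Y *m map_mx kap P).
  have yE j : (Y *m map_mx kap P) 0 j = w * kap (P 0 j) + t * w * kap (P 1 j).
    by rewrite mul_mx2 Y0 Y1 !mxE.
  have dyE j : delta ((Y *m map_mx kap P) 0 j) = delta w * kap (P 0 j) + delta (t * w) * kap (P 1 j).
    by rewrite yE (derD dd) !(derM dd _ (kap _)) !pv_kap !mulr0 !addr0.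
  split=> [j|].
    rewrite /ode_solution pv_q dyE (derD dd) !(derM dd _ (kap _)) !pv_kap yE.
    transitivity ((delta (delta w) + ode_coef (kap A) (kap B) (kap D) x * w) * kap (P 0 j)
      + (delta (delta (t * w)) + ode_coef (kap A) (kap B) (kap D) x * (t * w)) * kap (P 1 j)).
      by ring.
    by rewrite (ss_ode sol) tw_ode !mul0r addr0.
  rewrite !dyE !yE.
  have -> : (w * kap (P 0 0) + t * w * kap (P 1 0)) * (delta w * kap (P 0 1) + delta (t * w) * kap (P 1 1))
     - (delta w * kap (P 0 0) + delta (t * w) * kap (P 1 0)) * (w * kap (P 0 1) + t * w * kap (P 1 1))
     = (w * delta (t * w) - delta w * (t * w)) * kap (\det P).
    by rewrite det_mx2 rmorphB !rmorphM; ring.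
  by rewrite tw_W mul1r fmorph_eq0 -unitfE -unitmxE.
have iotaE (M : 'M[C]_2) : map_mx (fun c => iota (rconst c)) M = map_mx kap M.
  by apply/matrixP=> i j; rewrite !mxE kapE.
have map_yP (s : {rmorphism L0 -> L0}) : gal s ->
    map_mx s (Y *m map_mx kap P) = map_mx s Y *m map_mx kap P.
  move=> gs; rewrite map_mxM; congr (_ *m _); apply/matrixP=> i j.
  by rewrite !mxE (gal_kap gs).
move=> M; split=> [GM|[s gs e]].
  have [s gs sM] := realized GM; exists s => //.
  rewrite map_yP // iotaE; have /actsE -> := sM.
  by rewrite -!mulmxA -!map_mxM !mulmxA mulmxKV.
have [M0 sM0] := acts_exists gs; have [M' GM' eM0] := gal_in_group gs sM0.
move: e; rewrite map_yP // iotaE; have /actsE -> := sM0.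
rewrite -!mulmxA -!map_mxM => /Yfree; rewrite eM0 /cj mulmxKV // => h.
by rewrite (_ : M = M') //; rewrite -[M](mulKmx uP) -h mulKmx.
Qed.
(** ** Solutions have no primitive *)

Variables MA MB : 'M[C]_2.
Hypotheses (GA : G MA) (GB : G MB).
Hypothesis irr : fricke (\tr MA) (\tr MB) (\tr (MA *m MB)) != 4%:R.

Local Notation comb a b := (w * kap a + t * w * kap b).

(** A line stable under the Galois group would be a common eigenvector of two
    matrices with the traces of [MA] and [MB]. *)
Lemma solution_moved (a b : C) : (a != 0) || (b != 0) ->
  exists2 s : {rmorphism L0 -> L0}, gal s & forall c, s (comb a b) <> kap c * comb a b.
Proof.
move=> ab0; apply: contrapT => H.
have trcj M : \tr (cj M) = \tr M by rewrite /cj mxtrace_mulC mulmxA mulVmx // mul1mx.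
pose e : 'rV[C]_2 := \row_j (if j == 0 then a else b).
have e0 : e != 0.
  apply/eqP=> /rowP h; move: ab0; have := h 0; have := h 1; rewrite !mxE /= => -> ->.
  by rewrite eqxx.
have eig M : G M -> exists c, e *m (cj M)^T = c *: e.
  move=> GM; have [s gs sM] := realized GM.
  have [c hc] : exists c, s (comb a b) = kap c * comb a b.
    by apply: contrapT => h; apply: H; exists s => // c hc; apply: h; exists c.
  exists c; have [e1 e2] := sM; move: hc.
  rewrite rmorphD !(rmorphM s _ (kap _)) !(gal_kap gs) e1 e2 -/(cj M) => hc.
  have /pair_coord_inj[h1 h2] : comb (cj M 0 0 * a + cj M 0 1 * b) (cj M 1 0 * a + cj M 1 1 * b)
      = comb (c * a) (c * b).
    by move: hc; rewrite !rmorphD !rmorphM => hc; transitivity (kap c * comb a b); [rewrite -hc|]; ring.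
  clear hc e1 e2 sM; move: (cj M) h1 h2 => X h1 h2.
  apply: eq_rv2; rewrite mul_mx2 !mxE /=; first by rewrite -h1; ring.
  by rewrite -h2; ring.
have [c1 h1] := eig _ GA; have [c2 h2] := eig _ GB.
have dt M : G M -> \det (cj M)^T = 1 by move=> GM; rewrite det_tr cj_det.
move: irr; rewrite -(common_eigenvector (dt _ GA) (dt _ GB) e0 h1 h2).
by rewrite -trmx_mul !mxtrace_tr -cj_mul !trcj [\tr (MB *m MA)]mxtrace_mulC eqxx.
Qed.

Variables (hm : (1 < m)%N) (hn : (1 < n)%N) (hk : (1 < k)%N).

(** The mean of [z] over the Galois group satisfies the same equation. The mean
    is taken over {1, -1} first, then over lifts of the elements of the
    quotient. *)
Lemma inhomogeneous_no_solution (z : L0) :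
  delta (delta z) + iota (q_coef A B D) * z <> 1.
Proof.
move=> hz.
have [GN1 fN1] := cm_N1 fP; have [s1 g1 a1] := realized GN1.
have cj1 : cj (- 1%:M) = - 1%:M by rewrite cj_N /cj mulmx1 mulmxV.
rewrite -/(cj _) cj1 in a1.
have gq (s : {rmorphism L0 -> L0}) y : gal s ->
    delta (delta (s y)) + iota (q_coef A B D) * s y = s (delta (delta y) + iota (q_coef A B D) * y).
  by move=> gs; rewrite rmorphD rmorphM !(gal_delta gs); have [_ _ ->] := gs.
pose z1 := z + s1 z.
have hz1 : delta (delta z1) + iota (q_coef A B D) * z1 = 2%:R.
  rewrite /z1 !(derD dd) mulrDr addrACA hz gq // hz rmorph1.
  by rewrite -[1 + 1]/(2%:R).
have id_gal : gal (idfun : {rmorphism L0 -> L0}) by split=> //; exists id.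
have id_acts : acts idfun 1%:M.
  by rewrite /acts !mxE /= !rmorph1 !rmorph0 !mulr1 !mulr0 addr0 add0r.
have s1s1 y : s1 (s1 y) = y.
  have ac := acts_comp g1 a1 a1; rewrite mulNmx mul1mx opprK in ac.
  exact: (acts_eq (gal_comp g1 g1) id_gal ac id_acts).
have s1z1 : s1 z1 = z1 by rewrite /z1 rmorphD s1s1 addrC.
pose Z := \sum_(g in AA) S g z1.
have SZ h : h \in AA -> S h Z = Z.
  move=> hA; rewrite /Z rmorph_sum [RHS](reindex_inj (mulgI h)) /=.
  apply: eq_big => [g|g gA]; first by rewrite groupMl.
  have [Gh fh gh ah] := SP hA; have [Gg fg gg ag] := SP gA.
  have [Gp fp gp ap] := SP (groupM hA gA).
  have ac := acts_comp gh ah ag; rewrite -cj_mul in ac.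
  have GM := cm_mul fP Gh Gg; rewrite fh fg -fp in GM.
  have Ghg : G (lf h *m lf g) by case: GS => _ H _ _; exact: H.
  case: (cover_eq GS fP Ghg Gp GM) => e; rewrite e in ac.
    exact: (acts_eq (gal_comp gh gg) gp ac ap).
  have ac' := acts_comp gp ap a1; rewrite mulmxN mulmx1 -cj_N in ac'.
  by rewrite -[in RHS]s1z1; exact: (acts_eq (gal_comp gh gg) (gal_comp gp g1) ac ac').
have s1Z : s1 Z = Z.
  rewrite /Z rmorph_sum; apply: eq_bigr => g gA; have [Gg fg gg ag] := SP gA.
  have ac := acts_comp g1 a1 ag; have ac' := acts_comp gg ag a1.
  rewrite mulNmx mul1mx in ac; rewrite mulmxN mulmx1 in ac'.
  by rewrite -[in RHS]s1z1; exact: (acts_eq (gal_comp g1 gg) (gal_comp gg g1) ac ac').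
have hZ : delta (delta Z) + iota (q_coef A B D) * Z = (2 * N)%:R.
  rewrite /Z !(der_sum dd) mulr_sumr -big_split /=.
  rewrite (eq_bigr (fun=> 2%:R)) => [|g gA]; last first.
    by have [_ _ gg _] := SP gA; rewrite gq // hz1 rmorph_nat.
  by rewrite sumr_const cardA -mulrnA.
have [g eg] : exists g, Z = iota g.
  apply: (fixed_field g1 a1 s1Z uniq_rs size_rs) => y /mapP[h]; rewrite mem_enum => hA ->.
  by have [_ _ gh _] := SP hA; exists (S h); rewrite SZ.
have N0 : (2 * N)%:R != 0 :> L0.
  by rewrite -(prednK (_ : 0 < 2 * N)%N) ?muln_gt0 //; exact: pv_char0.
have N0' : (2 * N)%:R != 0 :> ratfun C by rewrite -(fmorph_eq0 iota) rmorph_nat.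
apply: (no_rational_solution (m := m) (n := n) (k := k) C0 hm hn hk eA eD eABD (z := g / (2 * N)%:R)).
have dr := @rderiv_derivation C.
have dn (h : ratfun C) : rderiv (h / (2 * N)%:R) = rderiv h / (2 * N)%:R.
  by rewrite (der_div dr h (2 * N)%:R) (der_nat dr) mulr0 mul0r subr0.
rewrite !dn mulrA -mulrDl; apply: (fmorph_inj iota).
rewrite fmorph_div rmorph_nat rmorph1 rmorphD rmorphM -!pv_iota -eg hZ divff //.
Qed.

(** If [v' = u] and [u2 = s u] is a second solution, with primitive [s v], then
    [(u s(v) - u2 v) / (u' u2 - u u2')] solves z'' + q z = 1. *)
Lemma no_primitive (a b : C) (v : L0) : (a != 0) || (b != 0) ->
  delta v <> comb a b.
Proof.
move=> ab0 hv; have [s gs hs] := solution_moved ab0.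
have [tw_ode tw_W] := schwarz_sol_pair dd sol.
pose u := comb a b; pose u2 := s u.
have u_ode : delta (delta u) + iota (q_coef A B D) * u = 0.
  rewrite /u pv_q (derD dd) (derD dd) !(derM dd _ (kap _)) !pv_kap !mulr0 !addr0 !(derM dd _ (kap _)) !pv_kap.
  transitivity ((delta (delta w) + ode_coef (kap A) (kap B) (kap D) x * w) * kap a
      + (delta (delta (t * w)) + ode_coef (kap A) (kap B) (kap D) x * (t * w)) * kap b).
    by ring.
  by rewrite (ss_ode sol) tw_ode !mul0r addr0.
have u2_ode : delta (delta u2) + iota (q_coef A B D) * u2 = 0.
  have := congr1 s u_ode; rewrite rmorph0 rmorphD rmorphM !(gal_delta gs).
  by have [_ _ ->] := gs.
have u0 : u != 0.
  apply/eqP=> hu; have /pair_coord_inj[ea eb] : comb a b = comb 0 0.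
    by rewrite -/u hu !rmorph0 !mulr0 addr0.
  by move: ab0; rewrite ea eb eqxx.
have W0 : delta u * u2 - u * delta u2 != 0.
  apply/eqP=> hW; have : delta (u2 / u) = 0.
    rewrite (der_div dd); transitivity (- (delta u * u2 - u * delta u2) / u ^+ 2); first by field.
    by rewrite hW oppr0 mul0r.
  by move/pv_const=> [c hc]; apply: (hs c); rewrite -/u -hc divfK.
have ddu : delta (delta u) = - (iota (q_coef A B D) * u).
  by apply/eqP; rewrite -addr_eq0 u_ode.
have ddu2 : delta (delta u2) = - (iota (q_coef A B D) * u2).
  by apply/eqP; rewrite -addr_eq0 u2_ode.
have hv2 : delta (s v) = u2 by rewrite -(gal_delta gs) hv.
have dW : delta (delta u * u2 - u * delta u2) = 0.
  by rewrite (derB dd) !(derM dd) ddu ddu2; ring.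
apply: (@inhomogeneous_no_solution ((u * s v - u2 * v) / (delta u * u2 - u * delta u2))).
have hvu : delta v = u := hv.
clearbody u2; clear hv hs u0 u_ode u2_ode; clearbody u.
set W := delta u * u2 - u * delta u2 in dW W0 *.
have dWd y : delta (y / W) = delta y / W by rewrite (der_div dd) dW mulr0 mul0r subr0.
have num : delta (delta (u * s v - u2 * v)) + iota (q_coef A B D) * (u * s v - u2 * v) = W.
  by rewrite !(derB dd) !(derM dd) hvu hv2 !(derD dd) !(derM dd) ddu ddu2 hvu hv2 /W; ring.
by rewrite !dWd mulrA -mulrDl num divff.
Qed.

End GaloisGroup.
End PicardVessiotSchwarz.

(** * Rational first integrals *)

Variant ord3_spec : 'I_3 -> Type :=
  | Ord3_0 : ord3_spec 0 | Ord3_1 : ord3_spec 1 | Ord3_2 : ord3_spec 2%:R.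

Lemma ord3P (i : 'I_3) : ord3_spec i.
Proof.
case: i => [[|[|[|i]]] hi] //.
- by rewrite (_ : Ordinal hi = 0); [constructor | exact: val_inj].
- by rewrite (_ : Ordinal hi = 1); [constructor | exact: val_inj].
- by rewrite (_ : Ordinal hi = 2%:R); [constructor | exact: val_inj].
Qed.

Section Partials.
Variables (F : fieldType) (D : F -> F).
Hypothesis dD : derivation D.

Lemma partials_derivation i : derivation (partials D i).
Proof.
rewrite /partials; case: (val i) => [|[|a]].
- exact/rlift_derivation/rlift_derivation.
- exact/rlift_derivation/rderiv_derivation.
- exact: rderiv_derivation.
Qed.

Lemma partials_const i c :
  partials D i (r2const c) = r2const (if i == 0 then D c else 0).
Proof.
have dr := @rderiv_derivation F; rewrite /r2const /partials.
case/ord3P: i => /=; last by rewrite rderiv_const !rmorph0.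
- by rewrite (rlift_const (rlift_derivation dD)) rlift_const.
- by rewrite (rlift_const dr) rderiv_const !rmorph0.
Qed.

Lemma partials_y i : partials D i (r2y F) = (i == 1)%:R.
Proof.
have dr := @rderiv_derivation F; rewrite /r2y /partials.
case/ord3P: i => /=; last by rewrite rderiv_const.
- by rewrite (rlift_const (rlift_derivation dD)) rlift_var // rmorph0.
- by rewrite (rlift_const dr) rderiv_var rmorph1.
Qed.

Lemma partials_z i : partials D i (r2z F) = (i == 2%:R)%:R.
Proof.
have dr := @rderiv_derivation F; rewrite /r2z /partials.
case/ord3P: i => /=; last by rewrite rderiv_var.
- by rewrite (rlift_var (rlift_derivation dD)).
- by rewrite (rlift_var dr).
Qed.

Lemma ratfun2_gen (S : set (ratfun2 F)) :
  subfield S -> (forall c, S (r2const c)) -> S (r2y F) -> S (r2z F) -> forall f, S f.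
Proof.
move=> sS Sc Sy Sz; apply: (ratfun_gen sS); last exact: Sz.
exact: (ratfun_gen (subfield_preimage (@rconst (ratfun F)) sS) Sc Sy).
Qed.

(* Unfolding these constants would expose nested fraction fields to
   unification. *)
#[local] Opaque partials r2const r2y r2z.

(* The commutator of two derivations is a derivation, so it suffices to evaluate
   it on generators. *)
Lemma partials_comm i j f :
  partials D i (partials D j f) = partials D j (partials D i f).
Proof.
have di := partials_derivation i; have dj := partials_derivation j.
suff : partials D i (partials D j f) - partials D j (partials D i f) = 0 by move/subr0_eq.
move: f; apply: (ratfun2_gen (deriv_const_subfield (derivation_comm di dj))) => /= [c||].
- apply/eqP; rewrite subr_eq0; apply/eqP.
  apply: (eq_trans (congr1 (partials D i) (partials_const j c))).
  apply: (eq_trans (partials_const i _)).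
  apply: esym; apply: (eq_trans (congr1 (partials D j) (partials_const i c))).
  apply: (eq_trans (partials_const j _)).
  by congr r2const; case: (i == 0); case: (j == 0); rewrite ?(der0 dD).
- apply/eqP; rewrite subr_eq0; apply/eqP.
  apply: (eq_trans (congr1 (partials D i) (partials_y j))).
  apply: (eq_trans (der_nat di _)).
  apply: esym; apply: (eq_trans (congr1 (partials D j) (partials_y i))).
  exact: der_nat dj _.
- apply/eqP; rewrite subr_eq0; apply/eqP.
  apply: (eq_trans (congr1 (partials D i) (partials_z j))).
  apply: (eq_trans (der_nat di _)).
  apply: esym; apply: (eq_trans (congr1 (partials D j) (partials_z i))).
  exact: der_nat dj _.
Qed.

End Partials.

#[local] Opaque partials r2const r2y r2z.

Section FirstIntegral.
Variables (F : fieldType) (d : F -> F) (q u1 u2 : F).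
Hypotheses (dd : derivation d) (F0 : char0 F).
Hypotheses (ode1 : d (d u1) + q * u1 = 0) (ode2 : d (d u2) + q * u2 = 0).
Hypothesis W0 : u1 * d u2 - d u1 * u2 != 0.
Hypothesis nop : forall c1 c2 v, d c1 = 0 -> d c2 = 0 -> (c1 != 0) || (c2 != 0) ->
  d v <> c1 * u1 + c2 * u2.

(* The field L plays the role of F(y, z). *)
Variables (L : fieldType) (cst : {rmorphism F -> L}) (y z : L).
Hypothesis gen : forall S : set L,
  subfield S -> (forall c, S (cst c)) -> S y -> S z -> forall f, S f.
(* The three partial derivatives. *)
Variables d0 d1 d2 : L -> L.
Hypotheses (p0 : derivation d0) (p1 : derivation d1) (p2 : derivation d2).
Hypotheses (d0c : forall c, d0 (cst c) = cst (d c)) (d1c : forall c, d1 (cst c) = 0)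
  (d2c : forall c, d2 (cst c) = 0).
Hypotheses (d0y : d0 y = 0) (d1y : d1 y = 1) (d2y : d2 y = 0).
Hypotheses (d0z : d0 z = 0) (d1z : d1 z = 0) (d2z : d2 z = 1).

(** The derivative along the vector field (1, q z - 1, - y). *)
Definition flow (f : L) : L := d0 f + (cst q * z - 1) * d1 f - y * d2 f.

Lemma flow_derivation : derivation flow.
Proof.
split=> f g; rewrite /flow; first by rewrite (derD p0) (derD p1) (derD p2); ring.
by rewrite (derM p0) (derM p1) (derM p2); ring.
Qed.

Lemma flow_const c : flow (cst c) = cst (d c).
Proof. by rewrite /flow d0c d1c d2c !mulr0 subr0 addr0. Qed.
Lemma flow_y : flow y = cst q * z - 1.
Proof. by rewrite /flow d0y d1y d2y mulr1 mulr0 subr0 add0r. Qed.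
Lemma flow_z : flow z = - y.
Proof. by rewrite /flow d0z d1z d2z mulr1 mulr0 addr0 add0r. Qed.

Lemma flow_linear u : d (d u) + q * u = 0 ->
  flow (cst u * y + cst (d u) * z) = cst (- u).
Proof.
move=> /eqP; rewrite addr_eq0 => /eqP h; have fd := flow_derivation.
rewrite (derD fd) !(derM fd) !flow_const flow_y flow_z h !rmorphN rmorphM; ring.
Qed.

(** The functions [u_i y + u_i' z] are coordinates on the plane over F, in which
    the flow is an iterated extension by primitives of the [- u_i]. *)
Lemma first_integral_const h : flow h = 0 -> exists2 c, d c = 0 & h = cst c.
Proof.
have L0 : char0 L := char0_morph cst F0.
pose v1 := cst u1 * y + cst (d u1) * z; pose v2 := cst u2 * y + cst (d u2) * z.
have dv1 u : d1 (cst u * y + cst (d u) * z) = cst u.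
  by rewrite (derD p1) !(derM p1) !d1c d1y d1z !mul0r mulr0 !add0r addr0 mulr1.
have dv2 u : d2 (cst u * y + cst (d u) * z) = cst (d u).
  by rewrite (derD p2) !(derM p2) !d2c d2y d2z !mul0r mulr0 !add0r mulr1.
have cW : cst u1 * cst (d u2) - cst (d u1) * cst u2 != 0.
  by rewrite -!rmorphM -rmorphB fmorph_eq0.
pose e1 f := cst (d u2) * d1 f + - cst u2 * d2 f.
pose e2 f := - cst (d u1) * d1 f + cst u1 * d2 f.
have de1 : derivation e1 by exact: derivation_comb.
have de2 : derivation e2 by exact: derivation_comb.
have e1c c : e1 (cst c) = 0.
  by rewrite /e1 d1c d2c !mulr0 addr0.
have e2c c : e2 (cst c) = 0.
  by rewrite /e2 d1c d2c !mulr0 addr0.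
have e1v1 : e1 v1 != 0.
  by rewrite /e1 /v1 dv1 dv2 mulNr [_ * cst u1]mulrC [cst u2 * _]mulrC.
have e2v1 : e2 v1 = 0 by rewrite /e2 /v1 dv1 dv2; ring.
have e2v2 : e2 v2 != 0.
  by rewrite /e2 /v2 dv1 dv2 mulNr addrC.
have [j1 [_ j1c j1v]] := ratfun_eval (transcendental_der (h := cst) de1 e1c e1v1 L0).
have e2j1 f : e2 (j1 f) = 0.
  move: f; apply: ratfun_gen.
  - exact: (subfield_preimage j1 (deriv_const_subfield de2)).
  - by move=> c /=; rewrite j1c e2c.
  - by rewrite /= j1v.
have [j2 [_ j2c j2v]] := ratfun_eval (transcendental_der de2 e2j1 e2v2 L0).
have fd := flow_derivation.
pose D1 := der_ext d (- u1); have dD1 : derivation D1 by exact: der_ext_derivation.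
have flow1 f : flow (j1 f) = j1 (D1 f).
  move: f; apply: ratfun_der_eq => // [c|].
    by rewrite j1c flow_const /D1 der_ext_const // j1c.
  by rewrite j1v flow_linear // /D1 der_ext_var // j1c.
pose D2 := der_ext D1 (rconst (- u2)).
have dD2 : derivation D2 by exact: der_ext_derivation.
have flow2 f : flow (j2 f) = j2 (D2 f).
  move: f; apply: ratfun_der_eq => // [c|].
    by rewrite j2c flow1 /D2 der_ext_const // j2c.
  by rewrite j2v flow_linear // /D2 der_ext_var // j2c j1c.
have surj : exists g, h = j2 g.
  suff [g _ <-] : range j2 h by exists g.
  have sR := subfield_range j2.
  have cin c : range j2 (cst c) by exists (rconst (rconst c)); rewrite // j2c j1c.
  have v1in : range j2 v1 by exists (rconst (rvar F)); rewrite // j2c j1v.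
  have v2in : range j2 v2 by exists (rvar _).
  have min c v : range j2 v -> range j2 (cst c * v) by apply: (subfieldM sR); exact: cin.
  have Win : range j2 (cst u1 * cst (d u2) - cst (d u1) * cst u2).
    by apply: (subfieldB sR); apply: (subfieldM sR); exact: cin.
  apply: (gen sR cin).
    have -> : y = (cst (d u2) * v1 - cst (d u1) * v2) / (cst u1 * cst (d u2) - cst (d u1) * cst u2).
      by apply: (mulIf cW); rewrite divfK // /v1 /v2; ring.
    by apply: (subfield_div sR) => //; apply: (subfieldB sR); exact: min.
  have -> : z = (cst u1 * v2 - cst u2 * v1) / (cst u1 * cst (d u2) - cst (d u1) * cst u2).
    by apply: (mulIf cW); rewrite divfK // /v1 /v2; ring.
  by apply: (subfield_div sR) => //; apply: (subfieldB sR); exact: min.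
case: surj => g ->; rewrite flow2 => /eqP; rewrite fmorph_eq0 => /eqP hg.
have np1 a : d a <> - u1.
  move=> ha; apply: (nop (c1 := -1) (c2 := 0) (v := a)).
  - by rewrite (derN dd) (der1 dd) oppr0.
  - exact: der0.
  - by rewrite oppr_eq0 oner_neq0.
  - by rewrite ha mulN1r mul0r addr0.
have F10 := ratfun_char0 F0.
have np2 a : D1 a <> rconst (- u2).
  move=> ha; have [a0 [a1 [da1 ea]]] := der_ext_primitive dd F0 np1 ha.
  move: ha; rewrite ea (derD dD1) (derM dD1) /D1 !der_ext_const // der_ext_var // da1.
  rewrite rmorph0 mul0r add0r -rmorphM -rmorphD => /fmorph_inj e.
  apply: (nop (c1 := a1) (c2 := -1) (v := a0)) => //.
  - by rewrite (derN dd) (der1 dd) oppr0.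
  - by rewrite oppr_eq0 oner_neq0 orbT.
  - by rewrite mulN1r -e; ring.
have [g1 hg1 ->] := der_ext_no_new_constant dD1 F10 np2 hg.
have [c hc ->] := der_ext_no_new_constant dd F0 np1 hg1.
by exists c; rewrite // j2c j1c.
Qed.

(** For an invariant form with components P, Q along dy, dz, the products
    [P u' - Q u], one for each solution [u], are all multiplied by the same
    factor [a] under the flow: their ratios are first integrals. *)
Lemma invariant_form_solution P Q a :
  (P != 0) || (Q != 0) -> flow P = Q + a * P -> flow Q = - cst q * P + a * Q ->
  exists c1 c2, [/\ d c1 = 0, d c2 = 0, (c1 != 0) || (c2 != 0), P != 0
    & P * cst (d (c1 * u1 + c2 * u2)) = Q * cst (c1 * u1 + c2 * u2)].
Proof.
move=> PQ fP fQ; have fd := flow_derivation.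
pose th u := P * cst (d u) - Q * cst u.
have thE u : d (d u) + q * u = 0 -> flow (th u) = a * th u.
  move=> /eqP; rewrite addr_eq0 => /eqP h.
  by rewrite /th (derB fd) !(derM fd) !flow_const h fP fQ rmorphN rmorphM; ring.
have thc c1 c2 : d c1 = 0 -> d c2 = 0 ->
    th (c1 * u1 + c2 * u2) = cst c1 * th u1 + cst c2 * th u2.
  move=> h1 h2; rewrite /th (derD dd) !(derM dd) h1 h2 !(rmorphD, rmorphM, rmorph0).
  by ring.
have [c1 [c2 [h1 h2 c12 e]]] : exists c1 c2, [/\ d c1 = 0, d c2 = 0,
    (c1 != 0) || (c2 != 0) & th (c1 * u1 + c2 * u2) = 0].
  have [t2|t2] := eqVneq (th u2) 0.
    exists 0, 1; rewrite (der0 dd) (der1 dd) oner_neq0 orbT; split=> //.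
    by rewrite mul0r add0r mul1r.
  have fr : flow (th u1 / th u2) = 0.
    by rewrite (der_div fd) !thE //; field.
  have [c hc ec] := first_integral_const fr.
  exists 1, (- c); rewrite (derN dd) (der1 dd) hc oppr0 oner_neq0; split=> //.
  rewrite thc ?(derN dd) ?(der1 dd) ?hc ?oppr0 // rmorph1 rmorphN -ec.
  by rewrite mul1r mulNr divfK // subrr.
exists c1, c2; have {}e : P * cst (d (c1 * u1 + c2 * u2)) = Q * cst (c1 * u1 + c2 * u2).
  by apply/eqP; rewrite -subr_eq0; apply/eqP.
split=> //; apply: contraTneq PQ => P0; rewrite P0 eqxx /= negbK.
move: e; rewrite P0 mul0r => /esym/eqP; rewrite mulf_eq0 fmorph_eq0.
case/orP => // /eqP eu.
have eu' : c1 * d u1 + c2 * d u2 = 0.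
  by have := congr1 d eu; rewrite (derD dd) !(derM dd) h1 h2 (der0 dd) !mul0r !add0r.
have k1 : c1 * (u1 * d u2 - d u1 * u2) = 0.
  transitivity ((c1 * u1 + c2 * u2) * d u2 - u2 * (c1 * d u1 + c2 * d u2)); first by ring.
  by rewrite eu eu' mul0r mulr0 subrr.
have k2 : c2 * (u1 * d u2 - d u1 * u2) = 0.
  transitivity (u1 * (c1 * d u1 + c2 * d u2) - (c1 * u1 + c2 * u2) * d u1); first by ring.
  by rewrite eu eu' mul0r mulr0 subrr.
move/eqP: k1; move/eqP: k2; rewrite !mulf_eq0 (negbTE W0) !orbF => z2 z1.
by rewrite z1 z2 in c12.
Qed.

End FirstIntegral.

(** * Invariant forms *)

Section FormEntries.
Variables (L : fieldType) (D : 'I_3 -> L -> L).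

Lemma ord3_add :
  [/\ 0 + 1 = 1 :> 'I_3, 1 + 1 = 2%:R :> 'I_3 & 2%:R + 1 = 0 :> 'I_3] /\
  [/\ 0 + 2%:R = 2%:R :> 'I_3, 1 + 2%:R = 0 :> 'I_3 & 2%:R + 2%:R = 1 :> 'I_3].
Proof. by split; split; exact: val_inj. Qed.

Lemma wedge11E (u v : 'rV[L]_3) :
  [/\ wedge11 u v 0 0 = u 0 1 * v 0 2%:R - u 0 2%:R * v 0 1,
      wedge11 u v 0 1 = u 0 2%:R * v 0 0 - u 0 0 * v 0 2%:R
    & wedge11 u v 0 2%:R = u 0 0 * v 0 1 - u 0 1 * v 0 0].
Proof.
have [[a1 a2 a3] [b1 b2 b3]] := ord3_add.
by split; rewrite mxE ?a1 ?a2 ?a3 ?b1 ?b2 ?b3.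
Qed.

Lemma dformE (w : 'rV[L]_3) :
  [/\ dform D w 0 0 = D 1 (w 0 2%:R) - D 2%:R (w 0 1),
      dform D w 0 1 = D 2%:R (w 0 0) - D 0 (w 0 2%:R)
    & dform D w 0 2%:R = D 0 (w 0 1) - D 1 (w 0 0)].
Proof.
have [[a1 a2 a3] [b1 b2 b3]] := ord3_add.
by split; rewrite mxE ?a1 ?a2 ?a3 ?b1 ?b2 ?b3.
Qed.

Lemma sum_ord3 (f : 'I_3 -> L) : \sum_i f i = f 0 + f 1 + f 2%:R.
Proof.
rewrite !big_ord_recl big_ord0 addr0 addrA.
by congr (f _ + f _ + f _); exact: val_inj.
Qed.

Lemma vf_formE (P Q R : L) :
  [/\ vf_form P Q R 0 0 = P, vf_form P Q R 0 1 = Q & vf_form P Q R 0 2%:R = R].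
Proof. by split; rewrite mxE. Qed.

(** The condition w /\ Omega = 0 gives the component along dx from the other
    two. The factor [a] is the contraction of the one-form [alpha] with the
    vector field. *)
Lemma integrating_form_flow (c y z : L) (w : 'rV[L]_3) :
  (forall i, derivation (D i)) ->
  D 1 c = 0 -> D 2%:R c = 0 -> D 1 y = 1 -> D 2%:R y = 0 -> D 1 z = 0 -> D 2%:R z = 1 ->
  integrating_forms D (vf_form 1 (c * z - 1) (- y)) w ->
  let X f := D 0 f + (c * z - 1) * D 1 f - y * D 2%:R f in
  (w 0 1 != 0) || (w 0 2%:R != 0) /\
  exists a, X (w 0 1) = w 0 2%:R + a * w 0 1 /\
            X (w 0 2%:R) = - c * w 0 1 + a * w 0 2%:R.
Proof.
move=> dD c1 c2 y1 y2 z1 z2 [w0 [al [e dw _]]] X.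
have [v0 v1 v2] := vf_formE 1 (c * z - 1) (- y).
move: e; rewrite /wedge12 sum_ord3 v0 v1 v2 mulr1 => e.
have {}e : w 0 0 = - ((c * z - 1) * w 0 1 - y * w 0 2%:R).
  by apply/eqP; rewrite -subr_eq0 -e; apply/eqP; ring.
have [w1 w2 w3] := wedge11E al w; have [f1 f2 f3] := dformE w.
rewrite dw w1 in f1; rewrite dw w2 in f2; rewrite dw w3 in f3.
have D1w : D 1 (w 0 0) = - ((c * z - 1) * D 1 (w 0 1) - w 0 2%:R - y * D 1 (w 0 2%:R)).
  rewrite e (derN (dD 1)) !(derB (dD 1)) !(derM (dD 1)) (derB (dD 1)) (derM (dD 1)).
  by rewrite c1 z1 y1 (der1 (dD 1)); ring.
have D2w : D 2%:R (w 0 0) = - (c * w 0 1 + (c * z - 1) * D 2%:R (w 0 1) - y * D 2%:R (w 0 2%:R)).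
  have d2 := dD 2%:R.
  rewrite e (derN d2) !(derB d2) !(derM d2) (derB d2) (derM d2).
  by rewrite c2 z2 y2 (der1 d2); ring.
split.
  rewrite -negb_and; apply: contraNN w0 => /andP[/eqP p0 /eqP q0].
  apply/eqP/rowP => i; rewrite [RHS]mxE.
  by case/ord3P: i; rewrite ?e ?p0 ?q0 ?mulr0 ?subrr ?oppr0.
exists (al 0 0 + (c * z - 1) * al 0 1 - y * al 0 2%:R); rewrite /X.
have g0 : D 0 (w 0 1) = D 1 (w 0 0) + (al 0 0 * w 0 1 - al 0 1 * w 0 0) by rewrite f3; ring.
have g1 : D 0 (w 0 2%:R) = D 2%:R (w 0 0) - (al 0 2%:R * w 0 0 - al 0 0 * w 0 2%:R).
  by rewrite f2; ring.
have g2 : D 1 (w 0 2%:R) = D 2%:R (w 0 1) + (al 0 1 * w 0 2%:R - al 0 2%:R * w 0 1).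
  by rewrite f1; ring.
by split; rewrite ?g0 ?g1 ?D1w ?D2w g2 e; ring.
Qed.

End FormEntries.

Lemma map_vf_form (K L : fieldType) (h : K -> L) (P Q R : K) :
  map_mx h (vf_form P Q R) = vf_form (h P) (h Q) (h R).
Proof.
have [a0 a1 a2] := vf_formE P Q R; have [b0 b1 b2] := vf_formE (h P) (h Q) (h R).
apply/rowP => i; rewrite [LHS]mxE.
by case/ord3P: i; rewrite ?a0 ?a1 ?a2 ?b0 ?b1 ?b2.
Qed.

Lemma r2map_const (F E : fieldType) (h : {rmorphism F -> E}) (c : F) :
  r2map h (r2const c) = r2const (h c).
Proof. exact: eq_trans (rmap_const _ _) (congr1 _ (rmap_const _ _)). Qed.

Lemma r2map_y (F E : fieldType) (h : {rmorphism F -> E}) : r2map h (r2y F) = r2y E.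
Proof. exact: eq_trans (rmap_const _ _) (congr1 _ (rmap_var _)). Qed.

Lemma r2map_z (F E : fieldType) (h : {rmorphism F -> E}) : r2map h (r2z F) = r2z E.
Proof. exact: rmap_var. Qed.

Lemma ratfun2_rmorph_eq (F E : fieldType) (g h : {rmorphism ratfun2 F -> E}) :
  (forall c, g (r2const c) = h (r2const c)) -> g (r2y F) = h (r2y F) ->
  g (r2z F) = h (r2z F) -> g =1 h.
Proof. by move=> gc gy gz; apply: (ratfun2_gen (subfield_equalizer g h)). Qed.

Lemma map_Omega_q (F E : fieldType) (h : {rmorphism ratfun F -> E}) (q : ratfun F) :
  map_mx (r2map h) (Omega_q q) = vf_form 1 (r2const (h q) * r2z E - 1) (- r2y E).
Proof.
have e3 : r2map h (- r2y (ratfun F)) = - r2y E.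
  exact: eq_trans (rmorphN (r2map h) _) (congr1 _ (r2map_y h)).
have e2 : r2map h (r2const q * r2z (ratfun F) - 1) = r2const (h q) * r2z E - 1.
  apply: (eq_trans (rmorphB (r2map h) _ _)); apply: congr2; last exact: congr1 (rmorph1 (r2map h)).
  apply: (eq_trans (rmorphM (r2map h) _ _)); apply: congr2; first exact: r2map_const.
  exact: r2map_z.
have e1 : r2map h 1 = 1 by exact: rmorph1.
apply: (eq_trans (map_vf_form _ _ _ _)).
exact: (congr2 (fun u f => f u) e3 (congr2 (@vf_form _) e1 e2)).
Qed.

(* Two vectors (a, b) proportional to the nonzero vector (P, Q) are
   proportional. *)
Lemma proportional_pairs (F L : fieldType) (h : {rmorphism F -> L}) (P Q : L) (a b a' b' : F) :
  P != 0 -> P * h b = Q * h a -> P * h b' = Q * h a' -> b * a' = a * b'.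
Proof.
move=> P0 e e'; apply/eqP; rewrite -subr_eq0 -(fmorph_eq0 h) -[_ == 0]orFb -(negbTE P0).
rewrite -mulf_eq0 rmorphB !rmorphM mulrBr.
have -> : P * (h b * h a') = h a * (Q * h a') by rewrite mulrA e; ring.
by rewrite -e' subr_eq0; apply/eqP; ring.
Qed.

Section NoInvariantForm.
Variables (C : fieldType) (q : ratfun C).
Variables (L0 : fieldType) (delta : L0 -> L0) (iota : {rmorphism ratfun C -> L0}).
Variables (u1 u2 : L0).
Hypotheses (dd : derivation delta) (F0 : char0 L0).
Hypotheses (ode1 : ode_solution q delta iota u1) (ode2 : ode_solution q delta iota u2).
Hypothesis W0 : u1 * delta u2 - delta u1 * u2 != 0.
Hypothesis nop : forall c1 c2 v, delta c1 = 0 -> delta c2 = 0 ->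
  (c1 != 0) || (c2 != 0) -> delta v <> c1 * u1 + c2 * u2.
Hypothesis moved : forall c1 c2, delta c1 = 0 -> delta c2 = 0 ->
  (c1 != 0) || (c2 != 0) -> exists2 s : {rmorphism L0 -> L0}, diff_galois delta iota s &
  forall c, delta c = 0 -> s (c1 * u1 + c2 * u2) <> c * (c1 * u1 + c2 * u2).

Local Notation dd2 := (partials delta).
#[local] Opaque partials r2const r2y r2z r2map.

(** An invariant form over C(x, y, z) would give a solution [u] whose
    logarithmic derivative is fixed by the Galois group, hence a line of
    solutions that is stable under it. *)
Lemma no_invariant_form :
  integrating_forms dd2 (map_mx (r2map iota) (Omega_q q))
    `&` range (fun w : 'rV[ratfun2 (ratfun C)]_3 => map_mx (r2map iota) w) = set0.
Proof.
rewrite -subset0 => W [wI [w _ ew]]; move: wI; rewrite map_Omega_q => wI.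
have pc i c : i != 0 -> dd2 i (r2const c) = 0.
  move=> i0; apply: (eq_trans (partials_const dd i c)).
  by rewrite (negbTE i0); exact: rmorph0.
have p0c c : dd2 0 (r2const c) = r2const (delta c) := partials_const dd 0 c.
have py i := partials_y dd i; have pz i := partials_z dd i.
have pd := partials_derivation dd.
have c1 c := pc 1 c erefl; have c2 c := pc 2%:R c erefl.
have [PQ [a [fP fQ]]] := integrating_form_flow pd (c1 _) (c2 _) (py 1) (py 2%:R) (pz 1) (pz 2%:R) wI.
have [k1 [k2 [h1 h2 k12 P0 e]]] := invariant_form_solution dd F0 ode1 ode2 W0 nop
  (@ratfun2_gen L0) (pd 0) (pd 1) (pd 2%:R) p0c c1 c2
  (py 0) (py 1) (py 2%:R) (pz 0) (pz 1) (pz 2%:R) PQ fP fQ.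
have [s [_ sd si] ns] := moved h1 h2 k12.
set u := k1 * u1 + k2 * u2 in e ns.
have si2 f : r2map s (r2map iota f) = r2map iota f.
  move: f; apply: (ratfun2_rmorph_eq (g := r2map s \o r2map iota)) => [c||] /=.
  - apply: (eq_trans (congr1 (r2map s) (r2map_const iota c))).
    apply: (eq_trans (r2map_const s _)); apply: (eq_trans (congr1 (@r2const _) (si c))).
    exact: esym (r2map_const iota c).
  - apply: (eq_trans (congr1 (r2map s) (r2map_y iota))).
    by apply: (eq_trans (r2map_y s)); exact: esym (r2map_y iota).
  - apply: (eq_trans (congr1 (r2map s) (r2map_z iota))).
    by apply: (eq_trans (r2map_z s)); exact: esym (r2map_z iota).
have [Pf eP] : exists f, W 0 1 = r2map iota f by exists (w 0 1); rewrite -ew mxE.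
have [Qf eQ] : exists f, W 0 2%:R = r2map iota f by exists (w 0 2%:R); rewrite -ew mxE.
move: (W 0 1) (W 0 2%:R) eP eQ P0 e => P Q eP eQ P0 e.
have e' : P * r2const (delta (s u)) = Q * r2const (s u).
  rewrite eP eQ -(si2 Pf) -(si2 Qf) -sd.
  rewrite -(r2map_const s (delta u)) -(r2map_const s u) -!(rmorphM (r2map s)) -eP -eQ.
  by rewrite e.
have u0 : u != 0.
  by apply/eqP=> u0; apply: (ns 0); [exact: der0|rewrite u0 rmorph0 mulr0].
have ek : delta (s u) * u = s u * delta u by exact: (proportional_pairs P0 e' e).
apply: (ns (s u / u)); last by rewrite divfK.
by rewrite (der_div dd) -ek; field.
Qed.

End NoInvariantForm.

(** * Finite extensions *)

(** A nonzero root of a nonzero polynomial over F is inverted by a polynomial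
    over F: cancel powers of the variable until the constant term is nonzero. *)
Lemma algebraic_inverse (F E : fieldType) (i : {rmorphism F -> E}) (a : E) (p : {poly F}) :
  p != 0 -> (map_poly i p).[a] = 0 -> a != 0 ->
  exists r : {poly F}, a^-1 = (map_poly i r).[a].
Proof.
move=> + + a0; elim/poly_ind: p => [|p c IH]; first by rewrite eqxx.
have -> : (map_poly i (p * 'X + c%:P)).[a] = (map_poly i p).[a] * a + i c.
  by rewrite rmorphD rmorphM /= map_polyX map_polyC hornerD hornerM hornerX hornerC.
have [->|c0] := eqVneq c 0.
  rewrite polyC0 rmorph0 !addr0 mulf_eq0 negb_or => /andP[p0 _] /eqP.
  by rewrite mulf_eq0 (negbTE a0) orbF => /eqP /(IH p0).
move=> _ e; exists (- c^-1 *: p); apply: (mulIf a0); rewrite mulVf //.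
have -> : (map_poly i (- c^-1 *: p)).[a] = - (i c)^-1 * (map_poly i p).[a].
  by rewrite map_polyZ /= hornerZ rmorphN fmorphV.
have -> : - (i c)^-1 * (map_poly i p).[a] * a = (i c)^-1 * - ((map_poly i p).[a] * a) by ring.
have -> : - ((map_poly i p).[a] * a) = i c by apply/eqP; rewrite -subr_eq0 -opprD oppr_eq0 addrC addrC e.
by rewrite mulVf // fmorph_eq0.
Qed.

Section SpanSubfield.
Variables (F E : fieldType) (i : {rmorphism F -> E}) (I : finType) (e : I -> E).

Definition span : set E := [set u | exists c : I -> F, u = \sum_j i (c j) * e j].

Lemma spanD u v : span u -> span v -> span (u + v).
Proof.
move=> [c ->] [d ->]; exists (fun j => c j + d j); rewrite -big_split.
by apply: eq_bigr => j _; rewrite rmorphD mulrDl.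
Qed.

Lemma spanZ r u : span u -> span (i r * u).
Proof.
move=> [c ->]; exists (fun j => r * c j); rewrite mulr_sumr.
by apply: eq_bigr => j _; rewrite rmorphM mulrA.
Qed.

Lemma span0 : span 0.
Proof. by exists (fun=> 0); rewrite big1 // => j _; rewrite rmorph0 mul0r. Qed.

Lemma span_sum (J : finType) (f : J -> E) : (forall j, span (f j)) -> span (\sum_j f j).
Proof. by move=> Sf; apply: (big_ind span) => //; [exact: span0|exact: spanD]. Qed.

Lemma spanM u v : (forall j l, span (e j * e l)) -> span u -> span v -> span (u * v).
Proof.
move=> Se [c ->] [d ->]; rewrite mulr_suml; apply: span_sum => j.
rewrite mulr_sumr; apply: span_sum => l.
have -> : i (c j) * e j * (i (d l) * e l) = i (c j) * (i (d l) * (e j * e l)) by ring.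
exact/spanZ/spanZ.
Qed.

(** More powers of [a] than there are elements in the spanning family are
    linearly dependent. *)
Lemma span_relation a : (forall n, span (a ^+ n)) ->
  exists2 p : {poly F}, p != 0 & (map_poly i p).[a] = 0.
Proof.
move=> Sa; have [c cP] := choice Sa.
pose M : 'M[F]_(#|I|.+1, #|I|) := \matrix_(l, m) c l (enum_val m).
have : kermx M != 0.
  rewrite kermx_eq0 /row_free neq_ltn; apply/orP; left.
  by rewrite ltnS rank_leq_col.
case/rowV0Pn => v /sub_kermxP vM v0; exists (rVpoly v).
  by apply: contraNneq v0 => h; rewrite -[v]rVpolyK h linear0.
rewrite (@horner_coef_wide _ #|I|.+1); last first.
  by rewrite size_map_poly size_poly.
have -> : \sum_(l < #|I|.+1) (map_poly i (rVpoly v))`_l * a ^+ l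
    = \sum_(l < #|I|.+1) \sum_j i (v 0 l * c l j) * e j.
  apply: eq_bigr => l _; rewrite coef_map coef_rVpoly_ord cP mulr_sumr.
  by apply: eq_bigr => j _; rewrite rmorphM mulrA.
rewrite exchange_big /= big1 // => j _; rewrite -mulr_suml -rmorph_sum.
have -> : \sum_(l < #|I|.+1) v 0 l * c l j = (v *m M) 0 (enum_rank j).
  by rewrite mxE; apply: eq_bigr => l _; rewrite mxE enum_rankK.
by rewrite vM mxE rmorph0 mul0r.
Qed.

(** A finite-dimensional domain is a field. *)
Lemma span_subfield : span 1 -> (forall j l, span (e j * e l)) -> subfield span.
Proof.
move=> S1 Se; have SX a n : span a -> span (a ^+ n).
  by move=> Sa; elim: n => [|n IH]; rewrite ?expr0 // exprS; exact: spanM.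
split=> // [a b Sa Sb|a b Sa Sb].
  by rewrite -mulN1r -(rmorph1 i) -rmorphN; exact/spanD/spanZ.
apply: spanM => //; have [->|b0] := eqVneq b 0; first by rewrite invr0; exact: span0.
have [p p0 pb] := span_relation (fun n => SX b n Sb).
have [r ->] := algebraic_inverse p0 pb b0.
rewrite horner_coef; apply: span_sum => l; rewrite coef_map; apply: spanZ; exact: SX.
Qed.

End SpanSubfield.

(** The span over F(v) of a family that spans E is a field by [span_subfield], and it
    contains E and v. *)
Lemma finite_span_rmap (F E : fieldType) (i : {rmorphism F -> E}) :
  finite_span i -> finite_span (rmap i).
Proof.
move=> [I [e eP]]; exists I, (fun j => rconst (e j)).
have Sc u : span (rmap i) (fun j => rconst (e j)) (rconst u).
  have [c ->] := eP u; rewrite rmorph_sum; apply: span_sum => j.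
  rewrite (_ : _ (_ * _) = rmap i (rconst (c j)) * rconst (e j)); last first.
    by rewrite rmap_const; exact: rmorphM.
  apply: spanZ; exists (fun l => (l == j)%:R); rewrite (bigD1 j) //= eqxx rmorph1 mul1r.
  by rewrite big1 ?addr0 // => l /negbTE ->; rewrite rmorph0 mul0r.
have S1 : span (rmap i) (fun j => rconst (e j)) 1 := Sc 1.
have SM j l : span (rmap i) (fun j => rconst (e j)) (rconst (e j) * rconst (e l)).
  rewrite (_ : _ * _ = rconst (e j * e l)); first exact: Sc.
  exact: esym (rmorphM (@rconst E) _ _).
have sS := span_subfield S1 SM.
apply: (ratfun_gen sS Sc).
have := spanZ (rvar F) S1.
by rewrite (_ : _ * 1 = rvar E) //; exact: eq_trans (mulr1 _) (rmap_var i).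
Qed.

Lemma finite_span_over (F E L : fieldType) (i : {rmorphism F -> E}) (h : {rmorphism E -> L}) :
  finite_span i -> finite_over (range (h \o i)) (range h).
Proof.
move=> [I [e eP]]; pose s := [seq h (e (enum_val k)) | k <- enum 'I_#|I|].
have hs : size s = #|I| by rewrite size_map size_enum_ord.
have sE (k : 'I_(size s)) : s`_k = h (e (enum_val (cast_ord hs k))).
  have hk : (k < #|I|)%N := ltn_ord (cast_ord hs k).
  rewrite (nth_map (cast_ord hs k)) ?size_enum_ord //.
  by congr (h (e (enum_val _))); apply: val_inj; rewrite /= nth_enum_ord.
exists s; split=> [k|u [v _ <-]]; first by rewrite sE; exists (e (enum_val (cast_ord hs k))).
have [c ->] := eP v; exists (fun k => h (i (c (enum_val (cast_ord hs k))))).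
split=> [k|]; first by exists (c (enum_val (cast_ord hs k))).
rewrite rmorph_sum (reindex (fun k : 'I_#|I| => enum_val k)) /=; last first.
  by exists enum_rank => j _; rewrite ?enum_valK ?enum_rankK.
rewrite (reindex (cast_ord hs)) /=; last first.
  by exists (cast_ord (esym hs)) => j _; rewrite ?cast_ordK ?cast_ordKV.
by apply: eq_bigr => k _; rewrite sE rmorphM.
Qed.

(** * Liouvillian extensions *)

#[local] Opaque partials r2const r2y r2z r2map.

Section PartialsExtension.
Variables (F E : fieldType) (d : F -> F) (D : E -> E) (i : {rmorphism F -> E}).
Hypotheses (dd : derivation d) (dD : derivation D) (E0 : char0 E).
Hypothesis Di : forall a, D (i a) = i (d a).

Lemma partials_r2map j f : partials D j (r2map i f) = r2map i (partials d j f).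
Proof.
have pd := partials_derivation dd j; have pD := partials_derivation dD j.
move: f; apply: (ratfun2_gen (subfield_der_equalizer (r2map i) pd pD)) => /= [c||].
- apply: (eq_trans (congr1 (partials D j) (r2map_const i c))).
  apply: (eq_trans (partials_const dD j _)); apply: esym.
  apply: (eq_trans (congr1 (r2map i) (partials_const dd j c))).
  apply: (eq_trans (r2map_const i _)).
  by congr r2const; case: (j == 0) => //; exact: rmorph0.
- apply: (eq_trans (congr1 (partials D j) (r2map_y i))).
  apply: (eq_trans (partials_y dD j)); apply: esym.
  apply: (eq_trans (congr1 (r2map i) (partials_y dd j))).
  exact: rmorph_nat.
- apply: (eq_trans (congr1 (partials D j) (r2map_z i))).
  apply: (eq_trans (partials_z dD j)); apply: esym.
  apply: (eq_trans (congr1 (r2map i) (partials_z dd j))).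
  exact: rmorph_nat.
Qed.

Lemma partials_diff_extension :
  diff_extension (partials d) (partials D) (r2map i).
Proof.
split; first exact: partials_derivation.
- exact: partials_comm.
- exact: partials_r2map.
Qed.

Hypothesis Dconst : forall u, D u = 0 -> exists2 a, d a = 0 & u = i a.

(** An element killed by the three partial derivatives does not involve z, then
    not y, and is a constant of E. *)
Lemma partials_same_constants :
  same_constants (partials d) (partials D) (r2map i).
Proof.
apply/seteqP; split=> [f Df|_ [f df <-] j]; last first.
  apply: (eq_trans (partials_r2map j f)).
  by apply: (eq_trans (congr1 (r2map i) (df j))); exact: rmorph0.
have := Df 2%:R; have := Df 1; have := Df 0; move: Df => _.
move=> D0 D1 D2.
have [g eg] := rderiv_eq0 (ratfun_char0 E0) D2.
clear D2; subst f.
have D1' : rconst (rderiv g) = 0.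
  exact: (eq_trans (esym (rlift_const (@rderiv_derivation E) g)) D1).
have {}D1' : rderiv g = 0.
  apply: (fmorph_inj (@rconst (ratfun E))); apply: (eq_trans D1').
  exact: esym (rmorph0 _).
have [u eu] := rderiv_eq0 E0 D1'.
clear D1 D1'; subst g.
have D0' : r2const (D u) = 0 := eq_trans (esym (partials_const dD 0 u)) D0.
have {}D0' : D u = 0.
  apply: (fmorph_inj (@r2const E)); apply: (eq_trans D0').
  exact: esym (rmorph0 _).
have [a da ea] := Dconst D0'; clear D0 D0'; exists (r2const a).
  move=> j; apply: (eq_trans (partials_const dd j a)).
  by rewrite da; case: (j == 0); exact: rmorph0.
by subst u; exact: (r2map_const i a).
Qed.

End PartialsExtension.

(** A primitive [U] of a solution [u] yields the first integral
    [U + u y + u' z] of the system. *)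
Lemma primitive_first_integral (F E : fieldType) (D : E -> E) (i : {rmorphism ratfun F -> E})
    (q : ratfun F) (u U : E) :
  derivation D -> u != 0 -> D U = u -> D (D u) + i q * u = 0 ->
  exists2 phi, dfun (partials D) phi != 0 &
    wedge12 (dfun (partials D) phi) (map_mx (r2map i) (Omega_q q)) = 0.
Proof.
move=> dD u0 DU ode; have pd := partials_derivation dD.
have alg (L : fieldType) (D' : 'I_3 -> L -> L) (c : {rmorphism E -> L}) (y z : L) :
    (forall j, derivation (D' j)) -> (forall v, D' 0 (c v) = c (D v)) ->
    (forall v, D' 1 (c v) = 0) -> (forall v, D' 2%:R (c v) = 0) ->
    (forall j, D' j y = (j == 1)%:R) -> (forall j, D' j z = (j == 2%:R)%:R) ->
    exists2 phi, dfun D' phi != 0 & wedge12 (dfun D' phi) (vf_form 1 (c (i q) * z - 1) (- y)) = 0.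
  move=> dD' c0 c1 c2 y1 z1; exists (c U + c u * y + c (D u) * z).
    apply/eqP=> /rowP /(_ 1); rewrite !mxE (derD (dD' 1)) (derD (dD' 1)) !(derM (dD' 1)).
    rewrite !c1 y1 z1 /= !mul0r !add0r mulr0 addr0 mulr1 => /eqP.
    by rewrite fmorph_eq0 (negbTE u0).
  have [v0 v1 v2] := vf_formE 1 (c (i q) * z - 1) (- y).
  rewrite /wedge12 sum_ord3 v0 v1 v2 !mxE.
  rewrite !(derD (dD' _)) !(derM (dD' _)) !c0 !c1 !c2 !y1 !z1 /= DU.
  have -> : D (D u) = - (i q * u) by apply/eqP; rewrite -addr_eq0 ode.
  rewrite rmorphN rmorphM; ring.
rewrite map_Omega_q; apply: alg => //.
- exact: (partials_const dD 0).
- by move=> v; apply: (eq_trans (partials_const dD 1 v)); exact: rmorph0.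
- by move=> v; apply: (eq_trans (partials_const dD 2%:R v)); exact: rmorph0.
- exact: partials_y.
- exact: partials_z.
Qed.

Lemma finite_over_r2map (F E L : fieldType) (i : {rmorphism F -> E}) (h : {rmorphism E -> L})
    (g : ratfun2 F -> ratfun2 L) :
  finite_span i -> (forall f, g f = r2map h (r2map i f)) ->
  finite_over (range g) (range (r2map h)).
Proof.
move=> fi gE; have -> : g = r2map h \o r2map i by apply/funext => f; exact: gE.
exact: (finite_span_over (r2map h) (finite_span_rmap (finite_span_rmap fi))).
Qed.

Section LiouvillianSolution.
Variables (C : fieldType) (q : ratfun C) (E : fieldType) (D : E -> E).
Variables (i : {rmorphism ratfun C -> E}) (u : E).
Hypotheses (C0 : char0 C) (dD : derivation D) (Di : forall a, D (i a) = i (rderiv a)).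
Hypothesis Dconst : forall v, D v = 0 -> exists c, v = i (rconst c).
Hypotheses (fi : finite_span i) (u0 : u != 0) (ode : D (D u) + i q * u = 0).

Lemma r2map_comp (F1 F2 F3 : fieldType) (h : {rmorphism F1 -> F2}) (g : {rmorphism F2 -> F3})
    (f : ratfun2 F1) : r2map (g \o h) f = r2map g (r2map h f).
Proof.
move: f; apply: (ratfun2_rmorph_eq (h := r2map g \o r2map h)) => [c||] /=.
- apply: (eq_trans (r2map_const (g \o h) c)); apply: esym.
  apply: (eq_trans (congr1 (r2map g) (r2map_const h c))); exact: r2map_const.
- apply: (eq_trans (r2map_y (g \o h))); apply: esym.
  apply: (eq_trans (congr1 (r2map g) (r2map_y h))); exact: r2map_y.
- apply: (eq_trans (r2map_z (g \o h))); apply: esym.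
  apply: (eq_trans (congr1 (r2map g) (r2map_z h))); exact: r2map_z.
Qed.

(** The finite extension E, followed by the adjunction of a primitive of [u]
    if there is none in E. *)
Lemma finite_solution_integrable :
  liouvillian_integrable (partials (@rderiv C)) (Omega_q q).
Proof.
have dr := @rderiv_derivation C; have E0 := char0_morph (i \o @rconst C) C0.
have Dc v : D v = 0 -> exists2 a, rderiv a = 0 & v = i a.
  by move=> /Dconst[c ->]; exists (rconst c); rewrite ?rderiv_const.
have [[U DU]|noU] := pselect (exists U, D U = u).
  exists (ratfun2 E), (partials D), (r2map i); split; last first.
    exact: primitive_first_integral dD u0 DU ode.
  split; [exact: partials_diff_extension|exact: partials_same_constants|].
  exists 1%N, (fun n => if n is 0%N then range (r2map i) else setT).
  split=> // -[|//] _; apply: Or33; split=> //.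
  have := @finite_over_r2map _ _ _ i idfun (r2map i) fi.
  have rid f : r2map (@idfun E) f = f.
    move: f; apply: (ratfun2_rmorph_eq (h := idfun)) => [c||]; [exact: r2map_const|exact: r2map_y|exact: r2map_z].
  rewrite (_ : range (r2map idfun) = setT); last first.
    by apply/seteqP; split=> // f _; exists f.
  by apply=> f; rewrite rid.
have np a : D a <> u by move=> Da; apply: noU; exists a.
pose D' := der_ext D u; pose E' := ratfun E; pose i' := @rconst E \o i.
have dD' : derivation D' by exact: der_ext_derivation.
have Di' a : D' (i' a) = i' (rderiv a) by rewrite /D' /i' /= der_ext_const // Di.
have D'E a : D' (rconst a) = rconst (D a) by exact: der_ext_const.
have Dc' v : D' v = 0 -> exists2 a, rderiv a = 0 & v = i' a.
  by move=> /(der_ext_no_new_constant dD E0 np)[b /Dc[a da ->] ->]; exists a.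
have E'0 := ratfun_char0 E0.
exists (ratfun2 E'), (partials D'), (r2map i'); split; last first.
  apply: (primitive_first_integral (u := rconst u) (U := rvar E) dD').
  - by rewrite fmorph_eq0.
  - exact: der_ext_var.
  - rewrite !D'E -(rmorphM (@rconst E)) -(rmorphD (@rconst E)).
    by rewrite ode; exact: rmorph0.
split; [exact: partials_diff_extension|exact: partials_same_constants|].
exists 2%N, (fun n => match n with 0%N => range (r2map i') | 1%N => range (r2map (@rconst E)) | _ => setT end).
split=> // -[|[|//]] _.
  apply: Or33; split; first exact: subfield_range.
    by move=> _ [f _ <-]; exists (r2map i f); rewrite // -r2map_comp.
  by apply: (finite_over_r2map fi) => f; exact: r2map_comp.
apply: Or32; exists (r2const (rvar E)), (dfun (partials D') (r2const (rvar E))); split=> //.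
  move=> j; rewrite mxE; exists (r2const (if j == 0 then u else 0)) => //.
  apply: (eq_trans (r2map_const _ _)); apply: esym.
  apply: (eq_trans (partials_const dD' j _)); congr r2const.
  by case: (j == 0); rewrite ?rmorph0 //; exact: der_ext_var.
apply: esym; apply: field_adjoin_setTP => T sT ST At f.
have Sy : T (r2y E') by apply: ST; exists (r2y E) => //; exact: r2map_y.
have Sz : T (r2z E') by apply: ST; exists (r2z E) => //; exact: r2map_z.
apply: (ratfun2_gen sT _ Sy Sz) => {f}.
apply: (ratfun_gen (subfield_preimage (@r2const E') sT)) => [c|] /=; last exact: At.
by apply: ST; exists (r2const c) => //; exact: r2map_const.
Qed.

End LiouvillianSolution.

(** * The system of a platonic Schwarz triple *)

(** An element of G is determined up to sign by its image in A, which is a word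
    in the images of [MA] and [MB]. *)
Lemma cover_generated (C : fieldType) (C0 : char0 C) (gT : finGroupType) (A : {group gT})
    (G S : set 'M[C]_2) (f : 'M[C]_2 -> gT) (MA MB : 'M[C]_2) :
  SL2_subgroup G -> cover_map A G f -> G MA -> G MB ->
  (forall g, g \in A -> exists s, g = word (f MA) (f MB) s) ->
  S 1%:M -> S (- 1%:M) -> S MA -> S MB -> (forall M N, S M -> S N -> S (M *m N)) ->
  forall M, G M -> S M.
Proof.
move=> GS fP GA GB gen S1 SN1 SA SB SM M GM; have [G1 Gmul GV Gdet] := GS.
have [s] := gen _ (cm_in fP GM).
elim: s M GM => [|c s IH] M GM /= e; first by have [->|->] := cm_ker fP GM e.
pose X := if c then MA else MB.
have GX : G X by rewrite /X; case: c {X e}.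
have SX : S X by rewrite /X; case: c {X e GX}.
have uX : X \in unitmx by rewrite unitmxE Gdet // unitr1.
have GN : G (invmx X *m M) by apply/Gmul => //; exact: GV.
have XN : X *m (invmx X *m M) = M by rewrite mulKVmx.
rewrite -XN; apply: SM => //; apply: IH => //; apply: (mulgI (f X)).
by rewrite -(cm_mul fP) // XN e /X; case: (c).
Qed.

(* The squares of the possible traces are 1, 2 and tau + 1, and none of them is
   3. *)
Lemma fricke_trace_eq (C : fieldType) p (tau : C) : char0 C -> platonic p -> trace_eq p tau ->
  fricke 0 1 tau != 4%:R.
Proof.
move=> C0 hp ht; rewrite /fricke expr0n !mul0r subr0 add0r expr1n.
apply/eqP=> e; have {e} e3 : tau ^+ 2 = 3%:R.
  by apply/eqP; rewrite -subr_eq0; apply/eqP; transitivity (1 + tau ^+ 2 - 4%:R); [ring|rewrite e subrr].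
move: hp ht; rewrite /platonic !inE => /or3P[] /eqP -> /= h.
- move: e3; rewrite h expr1n => /eqP; rewrite -subr_eq0 -opprB oppr_eq0.
  by rewrite (_ : 3%:R - 1 = 2%:R) ?(negbTE (C0 1)) //; ring.
- have : 1%:R = 0 :> C by transitivity (tau ^+ 2 - 2%:R); [rewrite e3; ring|rewrite h subrr].
  by move/eqP; rewrite (negbTE (C0 0)).
- have ht : tau = 2%:R by transitivity (tau + 1 - 1); [ring|rewrite -h e3; ring].
  have : 1%:R = 0 :> C by transitivity (tau ^+ 2 - 3%:R); [rewrite ht; ring|rewrite e3 subrr].
  by move/eqP; rewrite (negbTE (C0 0)).
Qed.

Lemma platonic_case_generators (C : fieldType) (G : set 'M[C]_2) m n p :
  platonic_case G m n p ->
  exists (q : nat) (gT : finGroupType) (A : {group gT}) (a b : gT),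
    [/\ platonic q, triangle_generators A q (platonic_order q) a b,
        isog_SL2_cover A G & perm_eq [:: m; n; p] [:: 2; 3; q]%N].
Proof.
case=> -[hG hp]; [have [a [b h]] := alt4_generators|have [a [b h]] := sym4_generators
  |have [a [b h]] := alt5_generators]; [exists 3%N|exists 4%N|exists 5%N];
by do 4!eexists; split; [|exact: h|exact: hG|exact: hp].
Qed.

Lemma perm_gt1 m n p q : platonic q -> perm_eq [:: m; n; p] [:: 2; 3; q]%N ->
  [/\ 1 < m, 1 < n & 1 < p]%N.
Proof.
move=> hq /(perm_all (ltn 1)) /=; rewrite !andbT.
have -> : (1 < q)%N by move: hq; rewrite /platonic !inE => /or3P[] /eqP ->.
by case/and3P=> -> -> ->.
Qed.

Lemma quadratic_root (C : closedFieldType) (a b : C) : exists l, l ^+ 2 = a + b * l.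
Proof.
have [|l el] := solve_monicpoly (n := 2) (fun i => if i == 0%N then a else b : C); first by [].
by exists l; rewrite el !big_ord_recl big_ord0 /= expr0 expr1; ring.
Qed.

(** Algebraic closedness and characteristic 0 are the only properties of the
    field of complex numbers that matter. *)
Theorem platonic_system (C : closedFieldType) (G : set 'M[C]_2) (m n p : nat) (A B D : C) :
  char0 C -> SL2_subgroup G -> platonic_case G m n p ->
  A = angle C m -> D = angle C n -> A + B + D = angle C p ->
  liouvillian_integrable (partials (@rderiv C)) (Omega_q (q_coef A B D)) /\
  forall (L0 : fieldType) (delta : L0 -> L0) (iota : {rmorphism ratfun C -> L0}),
    picard_vessiot (q_coef A B D) delta iota ->
    has_galois_group (q_coef A B D) delta iota G /\
    integrating_forms (partials delta) (map_mx (r2map iota) (Omega_q (q_coef A B D)))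
      `&` range (fun w : 'rV[ratfun2 (ratfun C)]_3 => map_mx (r2map iota) w) = set0.
Proof.
move=> C0 GS hcase eA eD eABD.
have [q [gT [AA [a [b [hq tg iso hperm]]]]]] := platonic_case_generators hcase.
have [P1 [P2 [P3 [r sd]]]] := perm_schwarz_data C0 hq hperm.
have N_gt0 : (0 < platonic_order q)%N by move: hq; rewrite /platonic !inE => /or3P[] /eqP ->.
have [hm hn hp] := perm_gt1 hq hperm.
have dr := @rderiv_derivation C.
split.
  have cst f : rderiv f = 0 -> exists c : C, f = rconst c := fun h => rderiv_eq0 C0 h.
  have [M [DM [i [t [w [dDM DMi cM fi sol]]]]]] :=
    schwarz_extension C0 N_gt0 sd eA eD eABD dr (ratfun_char0 C0) (@rderiv_const C) cst (rderiv_var C).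
  apply: (finite_solution_integrable C0 dDM DMi cM fi (ss_neq0 sol)).
  have -> : i (q_coef A B D) = ode_coef (i (rconst A)) (i (rconst B)) (i (rconst D)) (i (rvar C)).
    exact: (rmorph_ode_coef i (rconst A) (rconst B) (rconst D) (rvar C)).
  exact: (ss_ode sol).
move=> L0 delta iota pv.
pose kap : {rmorphism C -> L0} := iota \o @rconst C.
have kapE c : kap c = iota (rconst c) by [].
clearbody kap.
have [t [w sol]] := pv_schwarz_sol C0 N_gt0 sd eA eD eABD pv kapE.
have dd := pv_der pv; have L00 := pv_char0 C0 kap.
have [ev [[evP evc evt evphi] [evw evD]]] :=
  root_evaluation sd L00 dd (pv_kap pv kapE) (pv_x pv) (ss_der sol) (ss_root sol).
have sqrtC (c : C) : exists s, s ^+ 2 = c.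
  by have [s es] := quadratic_root c 0; exists s; rewrite es mul0r addr0.
have [f fP] := cover_map_exists C0 sqrtC GS iso.
have [MA [MB [tau [[GA GB fA fB] [htau tA tB tAB]]]]] := cover_generators GS fP hq tg.
have [a0 [c0 [[da dc ta tc tac] sym]]] := sd_symmetries sd htau.
have [_ _ _ Gdet] := GS.
pose R M := exists2 s : {rmorphism L0 -> L0}, diff_galois delta iota s & acts kap t w s M.
have RM M M' : R M -> R M' -> R (M *m M').
  move=> [s gs sM] [s' gs' sM']; exists [the {rmorphism L0 -> L0} of s \o s'].
    exact: gal_comp.
  exact: (acts_comp kapE gs sM sM').
have Rsym M chi : \det M = 1 ->
    covariant (platonic_order q) P1 M chi -> covariant (platonic_order q) P3 M chi -> R M.
  move=> dM h1 h3.
  apply: (acts_realized C0 sd eA eD eABD pv kapE sol evc evt evphi evw evD dM).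
  have j0 := moebius_den_neq0 C0 pv kapE sol dM.
  apply: (mulIf (expf_neq0 (platonic_order q) j0)).
  rewrite mulrDl h1 // -mulrA h3 // mulrCA -mulrDr (ss_root sol).
  by rewrite mulr0 mul0r.
have Ra : R a0 by have [|chi _ [h1 _ h3]] := sym a0; [left|exact: Rsym da h1 h3].
have Rc : R c0 by have [|chi _ [h1 _ h3]] := sym c0; [right|exact: Rsym dc h1 h3].
(* A half turn has trace 0, so its square is -1 by Cayley-Hamilton. *)
have aa : a0 *m a0 = - 1%:M by rewrite mx2_cayley_hamilton ta da scale0r sub0r.
have RN1 : R (- 1%:M) by rewrite -aa; exact: RM.
have R1 : R 1%:M by have := RM _ _ RN1 RN1; rewrite mulNmx mul1mx opprK.
(* The pair (a0, b0) has the traces 0, 1, tau of the pair (MA, MB). *)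
pose b0 := - (a0 *m c0).
have Rb : R b0 by rewrite /b0 -[_ *m _]mul1mx -mulNmx; exact: RM RN1 (RM _ _ Ra Rc).
have db : \det b0 = 1 by rewrite detN2 det_mulmx da dc mulr1.
have tb : \tr b0 = 1 by rewrite raddfN /= tac opprK.
have ab : a0 *m b0 = c0 by rewrite /b0 mulmxN mulmxA aa mulNmx mul1mx opprK.
have irr : fricke (\tr MA) (\tr MB) (\tr (MA *m MB)) != 4%:R.
  by rewrite tA tB tAB; exact: (fricke_trace_eq C0 hq htau).
have root2 (e : C) : exists l, l ^+ 2 + 1 = e * l.
  by have [l el] := quadratic_root (-1) e; exists l; rewrite el; ring.
have tr1 : \tr a0 = \tr MA by rewrite ta tA.
have tr2 : \tr b0 = \tr MB by rewrite tb tB.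
have tr3 : \tr (a0 *m b0) = \tr (MA *m MB) by rewrite ab tc tAB.
have [P uP [PA PB]] :=
  trace_pair_conjugate root2 (Gdet _ GA) (Gdet _ GB) da db tr1 tr2 tr3 irr.
have realized M : G M -> R (P *m M *m invmx P).
  apply: (cover_generated (S := [set M | R (P *m M *m invmx P)]) C0 GS fP GA GB) => /=.
  - by rewrite fA fB; exact: tg_gen tg.
  - by rewrite mulmx1 mulmxV.
  - by rewrite mulmxN mulmx1 mulNmx mulmxV.
  - by rewrite PA mulmxK.
  - by rewrite PB mulmxK.
  - move=> M1 M2 h1 h2; have -> : P *m (M1 *m M2) *m invmx P
      = P *m M1 *m invmx P *m (P *m M2 *m invmx P) by rewrite !mulmxA mulmxKV.
    exact: RM.
have cardA := tg_card tg.
have [lf [S SP]] := lifts fP realized.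
split.
  exact: (galois_group C0 sd pv kapE sol GS fP cardA uP realized SP).
have kc c : delta c = 0 -> exists e, c = kap e := @pv_const _ _ _ _ _ _ _ pv kap kapE c.
have [ode2 W2] := schwarz_sol_pair dd sol; rewrite -(pv_q A B D kapE) in ode2.
have ode1 := ss_ode sol; rewrite -(pv_q A B D kapE) in ode1.
have W0 : w * delta (t * w) - delta w * (t * w) != 0 by rewrite W2 oner_neq0.
have comb c1 c2 : w * kap c1 + t * w * kap c2 = kap c1 * w + kap c2 * (t * w) by ring.
apply: (no_invariant_form dd L00 ode1 ode2 W0).
- move=> _ _ v /kc[e1 ->] /kc[e2 ->]; rewrite !fmorph_eq0 -comb => e12.
  exact: (no_primitive C0 N_gt0 sd eA eD eABD pv kapE sol evP evc evt evphi evw evD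
    GS fP cardA uP realized SP GA GB irr hm hn hp e12).
- move=> _ _ /kc[e1 ->] /kc[e2 ->]; rewrite !fmorph_eq0 => e12.
  have [s gs hs] := solution_moved C0 pv kapE sol GS uP realized GA GB irr e12.
  by exists s => // _ /kc[e ->]; rewrite -comb; exact: hs.
Qed.

Theorem proposition8 (R : realType) (G : set 'M[R[i]]_2) (m n p : nat)
    (A B C : R[i])
    (hG : SL2_subgroup G)
    (hmnp : platonic_case G m n p)
    (hA : A = 1 - (m%:R ^+ 2)^-1)
    (hC : C = 1 - (n%:R ^+ 2)^-1)
    (hABC : A + B + C = 1 - (p%:R ^+ 2)^-1) :
  liouvillian_integrable (partials (@rderiv R[i])) (Omega_q (q_coef A B C)) /\
  forall (L0 : fieldType) (delta : L0 -> L0)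
      (iota : {rmorphism ratfun R[i] -> L0}),
    picard_vessiot (q_coef A B C) delta iota ->
    has_galois_group (q_coef A B C) delta iota G /\
    integrating_forms (partials delta)
        (map_mx (r2map iota) (Omega_q (q_coef A B C)))
      `&` range (fun w : 'rV[ratfun2 (ratfun R[i])]_3 => map_mx (r2map iota) w)
      = set0.
Proof.
have c0 : char0 R[i] by move=> k; rewrite Num.Theory.pnatr_eq0.
exact: (@platonic_system R[i] G m n p A B C c0 hG hmnp hA hC hABC).
Qed.
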